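(* Let $Y_V$ be a causal MCAR$(p)$ process with $\Sigma_L>0$ (positive definite), and let $a,b\in V$ with $a\neq b$. Then: (a) $Y_a\not\to Y_b\mid Y_V$ if and only if $[\mathbf{C}e^{\mathbf{A}h}\mathbf{E}_j]_{ba}=[e^{\mathbf{A}h}]_{b,\,k(j-1)+a}=0$ for all $h\in[0,1]$ and $j=1,\ldots,p$. (b) $Y_a\not\to_0 Y_b\mid Y_V$ if and only if $[\mathbf{E}_p^\top\mathbf{A}\mathbf{E}_j]_{ba}=0$ for all $j=1,\ldots,p$, equivalently if and only if $[A_j]_{ba}=0$ for all $j=1,\ldots,p$.
   Context: $V=\{1,\ldots,k\}$. $L^2$ is the Hilbert space of square-integrable complex random variables with $\langle X,Y\rangle=\mathbb{E}[X\overline{Y}]$; $P_{\mathcal L}$ is orthogonal projection onto a closed subspace; l.i.m. is the $L^2$-limit. $\mathcal{L}_{Y_A}(s,t)$ is the closed linear span of $\{Y_a(u):a\in A,u\in[s,t]\cap\mathbb{R}\}$ and $\mathcal{L}_{Y_A}(t)=\mathcal{L}_{Y_A}(-\infty,t)$. $\mathcal{L}_1\perp\mathcal{L}_2\mid\mathcal{L}_3$ means $\mathbb{E}[(X-P_{\mathcal{L}_3}X)\overline{(Y-P_{\mathcal{L}_3}Y)}]=0$ for all $X\in\mathcal{L}_1,Y\in\mathcal{L}_2$. $D^{(j)}$ is the $j$-th mean-square derivative, $D^{(0)}Y_v=Y_v$. Each component $Y_v$ of the MCAR$(p)$ process is $p-1$ times mean-square differentiable and the $p$-th derivative does not exist.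 $Y_a\not\to Y_b\mid Y_V$ (Granger non-causality): $\mathcal{L}_{Y_b}(t,t+1)\perp\mathcal{L}_{Y_a}(t)\mid\mathcal{L}_{Y_{V\setminus\{a\}}}(t)$ for all $t\in\mathbb{R}$. $Y_a\not\to_0Y_b\mid Y_V$ (local Granger non-causality): for all $t\in\mathbb{R}$, with $Q_h=h^{-1}(D^{(p-1)}Y_b(t+h)-D^{(p-1)}Y_b(t))$, the limits $\mathrm{l.i.m.}_{h\downarrow0}P_{\mathcal{L}_{Y_V}(t)}Q_h$ and $\mathrm{l.i.m.}_{h\downarrow0}P_{\mathcal{L}_{Y_{V\setminus\{a\}}}(t)}Q_h$ exist and are a.s. equal. Lévy process: $L$ is a two-sided $k$-dimensional Lévy process, i.e. $L(t)=L_1(t)$ for $t\ge0$ and $L(t)=-\lim_{s\nearrow-t}L_2(s)$ for $t<0$ with independent copies $L_1,L_2$ of a one-sided Lévy process, with $\mathbb{E}L(1)=0$, $\mathbb{E}\|L(1)\|^2<\infty$, $\Sigma_L=\mathbb{E}[L(1)L(1)^\top]$. Causal MCAR$(p)$ process, $p\ge1$: let $A_1,\ldots,A_p\in\mathbb{R}^{k\times k}$ and let $\mathbf{A}\in\mathbb{R}^{kp\times kp}$ be the block companion matrix whose $i$-th block row, $i=1,\ldots,p-1$, has $I_k$ in block column $i+1$ and zeros otherwise, and whose last block row is $(-A_p,\ldots,-A_1)$; all eigenvalues of $\mathbf{A}$ have strictly negative real part. Let $\mathbf{B}^\top=(0_k,\ldots,0_k,I_k)$, $\mathbf{C}=(I_k,0_k,\ldots,0_k)\in\mathbb{R}^{k\times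 kp}$, and $\mathbf{E}_j^\top=(0_{k\times k(j-1)},I_k,0_{k\times k(p-j)})\in\mathbb{R}^{k\times kp}$. Then $Y_V(t)=\mathbf{C}X(t)$ with $X(t)=\int_{-\infty}^te^{\mathbf{A}(t-u)}\mathbf{B}\,dL(u)$, the unique stationary solution of $dX(t)=\mathbf{A}X(t)dt+\mathbf{B}dL(t)$. *)

(* Defs.v *)
From mathcomp Require Import all_boot all_order all_algebra complex.
From mathcomp Require Import all_classical all_reals all_analysis.

Set Implicit Arguments.
Unset Strict Implicit.
Unset Printing Implicit Defensive.

Import Order.TTheory GRing.Theory Num.Theory numFieldNormedType.Exports.

Local Open Scope classical_set_scope.
Local Open Scope ring_scope.

(** * The Hilbert space L^2 of complex random variables

    Elements of L^2 are represented by functions; sets of them such as closed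
    spans are stable under almost sure equality. *)
Section L2.
Context {R : realType} {d : measure_display} {T : measurableType d}.
Variable P : probability T R.
Implicit Types (X Y Z : T -> R[i]) (G H : set (T -> R[i])).

Definition cL2 : set (T -> R[i]) :=
  [set X | (fun w => complex.Re (X w)) \in Lfun P 2%:E /\
           (fun w => complex.Im (X w)) \in Lfun P 2%:E].

Definition cexpectation X : R[i] :=
  (fine (expectation P (fun w => complex.Re (X w))) +i*
   fine (expectation P (fun w => complex.Im (X w))))%C.

Definition cinner X Y : R[i] := cexpectation (fun w => X w * (Y w)^*).

(* The squared L^2-distance E|X - Y|^2. *)
Definition msdist2 X Y : \bar R :=
  expectation P
    (fun w => complex.Re (X w - Y w) ^+ 2 + complex.Im (X w - Y w) ^+ 2).

Definition ms_cvg {I : Type} (F : set_system I) (X : I -> T -> R[i]) Z : Prop :=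
  [/\ (\forall i \near F, cL2 (X i)), cL2 Z &
      msdist2 (X i) Z @[i --> F] --> 0%E].

Definition lin_span G : set (T -> R[i]) :=
  [set X | exists (n : nat) (c : 'I_n -> R[i]) (g : 'I_n -> T -> R[i]),
     (forall i, G (g i)) /\ X = (fun w => \sum_(i < n) c i * g i w)].

Definition closed_span G : set (T -> R[i]) :=
  [set Z | cL2 Z /\ forall e : R, 0 < e ->
     exists2 X, lin_span G X & (msdist2 X Z < e%:E)%E].

(* P_H X is a version of the element Z of H with X - Z orthogonal to H; for H
   a closed subspace and X in L^2 it exists and is a.s. unique. *)
Definition orthoproj H X : T -> R[i] :=
  xget (cst 0)
    [set Z | H Z /\ forall W, H W -> cinner (fun w => X w - Z w) W = 0].

Definition cond_orth (L1 L2 L3 : set (T -> R[i])) : Prop :=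
  forall X Y, L1 X -> L2 Y ->
    cinner (fun w => X w - orthoproj L3 X w) (fun w => Y w - orthoproj L3 Y w) = 0.

Definition diff_quotient (Z : R -> T -> R[i]) (t h : R) : T -> R[i] :=
  fun w => (h^-1)%:C%C * (Z (t + h) w - Z t w).

(* [msderiv Z t] is a version of the mean-square derivative of Z at t, and an
   irrelevant value if the latter does not exist. *)
Definition msderiv (Z : R -> T -> R[i]) (t : R) : T -> R[i] :=
  xget (cst 0) [set W | ms_cvg 0^' (diff_quotient Z t) W].

Definition msderivn (j : nat) (Z : R -> T -> R[i]) : R -> T -> R[i] :=
  iter j msderiv Z.

End L2.

(** * Granger non-causality for a k-dimensional real process *)
Section Granger.
Context {R : realType} {d : measure_display} {T : measurableType d}.
Variables (P : probability T R) (k : nat) (Y : R -> T -> 'cV[R]_k).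

Definition component (v : 'I_k) (t : R) : T -> R[i] := fun w => (Y t w v 0)%:C%C.

(* L_{Y_A}(s, t) is [lin_past A `[s, t]] and L_{Y_A}(t) is
   [lin_past A `]-oo, t]]. *)
Definition lin_past (A : set 'I_k) (J : set R) : set (T -> R[i]) :=
  closed_span P [set X | exists v u, [/\ A v, J u & X = component v u]].

Definition granger_noncausal (a b : 'I_k) : Prop :=
  forall t : R,
    cond_orth P (lin_past [set b] `[t, t + 1]) (lin_past [set a] `]-oo, t])
                (lin_past (~` [set a]) `]-oo, t]).

(* p is the order of the MCAR process: the derivative of order p - 1 is used. *)
Definition local_granger_noncausal (p : nat) (a b : 'I_k) : Prop :=
  forall t : R, exists Z1 Z2 : T -> R[i],
    let Q h := diff_quotient (msderivn P p.-1 (component b)) t h in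
    [/\ ms_cvg P 0^'+ (fun h => orthoproj P (lin_past setT `]-oo, t]) (Q h)) Z1,
        ms_cvg P 0^'+
          (fun h => orthoproj P (lin_past (~` [set a]) `]-oo, t]) (Q h)) Z2 &
        {ae P, forall w, Z1 w = Z2 w}].

End Granger.

(** * Lévy processes *)
Section Levy.
Context {R : realType} {d : measure_display} {T : measurableType d}.
Variable P : probability T R.

Definition borel {U : topologicalType} : set (set U) := <<s (@open U) >>.

Definition random_element {U : topologicalType} (X : T -> U) : Prop :=
  forall B, borel B -> measurable (X @^-1` B).

Definition same_law {U : topologicalType} (X Y : T -> U) : Prop :=
  forall B, borel B -> P (X @^-1` B) = P (Y @^-1` B).

(* Taking some of the sets B i to be the whole space gives the product rule for
   subfamilies. *)
Definition mutually_independent {U : topologicalType} {n : nat}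
    (X : 'I_n -> T -> U) : Prop :=
  forall B : 'I_n -> set U, (forall i, borel (B i)) ->
    P [set w | forall i, B i (X i w)] = (\prod_(i < n) P (X i @^-1` B i))%E.

Variable k : nat.
Implicit Types L : R -> T -> 'cV[R]_k.

(* One-sided processes are only looked at on [0, +oo[. *)
Record one_sided_levy L : Prop := OneSidedLevy {
  levy_random : forall t, 0 <= t -> random_element (L t) ;
  levy_start : {ae P, forall w, L 0 w = 0} ;
  levy_independent : forall (n : nat) (t : nat -> R), 0 <= t 0%N ->
    (forall i, t i <= t i.+1) ->
    mutually_independent (fun (i : 'I_n) w => L (t i.+1) w - L (t i) w) ;
  levy_stationary : forall s t, 0 <= s -> 0 <= t ->
    same_law (fun w => L (s + t) w - L s w) (fun w => L t w - L 0 w) ;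
  levy_stoch_continuous : forall t e : R, 0 <= t -> 0 < e ->
    P [set w | e < `|L s w - L t w| ] @[s --> within `[0, +oo[ (nbhs t)]
      --> 0%E ;
  levy_cadlag : {ae P, forall w, forall t, 0 <= t ->
    (L s w @[s --> t^'+] --> L t w) /\
    (0 < t -> cvg (L s w @[s --> t^'-])) }
}.

Definition same_fdd L1 L2 : Prop :=
  forall (n : nat) (t : 'I_n -> R), (forall i, 0 <= t i) ->
    same_law (fun w => \matrix_(i < n, j < k) L1 (t i) w j 0)
             (fun w => \matrix_(i < n, j < k) L2 (t i) w j 0).

Definition generated_sigma L : set (set T) :=
  <<s [set E | exists t B, [/\ 0 <= t, borel B & E = L t @^-1` B] ] >>.

Definition independent_processes L1 L2 : Prop :=
  forall E F, generated_sigma L1 E -> generated_sigma L2 F ->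
    P (E `&` F) = (P E * P F)%E.

Definition two_sided_levy L : Prop :=
  (forall t, random_element (L t)) /\
  exists L1 L2,
    [/\ one_sided_levy L1, one_sided_levy L2, same_fdd L1 L2,
        independent_processes L1 L2 &
        {ae P, forall w,
          (forall t, 0 <= t -> L t w = L1 t w) /\
          (forall t, t < 0 -> L2 s w @[s --> (- t)^'-] --> - L t w) }].

Definition levy_cov L : 'M[R]_k :=
  \matrix_(i, j) fine (expectation P (fun w => L 1 w i 0 * L 1 w j 0)).

Record driving_levy L : Prop := DrivingLevy {
  driving_two_sided : two_sided_levy L ;
  driving_centered : forall i, expectation P (fun w => L 1 w i 0) = 0%E ;
  driving_square_integrable :
    (expectation P (fun w => \sum_i (L 1 w i 0) ^+ 2)%R < +oo)%E
}.

(** Integral over the real line of a deterministic matrix-valued function with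
    respect to L: the mean-square extension of the elementary integral of step
    functions.  The triple [((s, t), M)] stands for M 1_{]s, t]}. *)

Definition step_data (m : nat) := seq (R * R * 'M[R]_(m, k)).

Definition step_fun m (S : step_data m) (u : R) : 'M[R]_(m, k) :=
  \sum_(x <- S | x.1.1 < u <= x.1.2) x.2.

Definition step_integral L m (S : step_data m) (w : T) : 'cV[R]_m :=
  \sum_(x <- S) x.2 *m (L x.1.2 w - L x.1.1 w).

Definition is_levy_integral L m (f : R -> 'M[R]_(m, k)) (Z : T -> 'cV[R]_m) :
    Prop :=
  random_element Z /\
  exists S : nat -> step_data m,
    [/\ forall n, all (fun x => x.1.1 <= x.1.2) (S n),
        (\int[lebesgue_measure]_u
           (\sum_i \sum_j (step_fun (S n) u i j - f u i j) ^+ 2)%:E)%E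
          @[n --> \oo] --> 0%E &
        expectation P
          (fun w => \sum_i (step_integral L (S n) w i 0 - Z w i 0) ^+ 2)
          @[n --> \oo] --> 0%E].

End Levy.

(** * Causal MCAR processes

    The order is p = q + 1; block indices and the coefficients A_1, ..., A_p
    are numbered from 0, so that [A j] is A_{j+1}. *)
Section MCAR.
Context {R : realType}.

Definition mxexp (n : nat) (M : 'M[R]_n) : 'M[R]_n :=
  limn (fun N : nat => \sum_(m < N) ((m`!)%:R^-1 *: M ^+ m) : 'M[R]_n).

Definition posdefmx (n : nat) (S : 'M[R]_n) : Prop :=
  forall x : 'cV[R]_n, x != 0 -> 0 < (x^T *m S *m x) 0 0.

Variables (k q : nat).

Definition dimX : nat := \sum_(i < q.+1) k.

(* The last block row is (-A_p, ..., -A_1). *)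
Definition companion (A : 'I_q.+1 -> 'M[R]_k) : 'M[R]_dimX :=
  \mxblock_(i < q.+1, j < q.+1)
    (if i == ord_max then - A (rev_ord j)
     else if j == i.+1 :> nat then 1%:M else 0 : 'M[R]_k).

Definition Eblock (j : 'I_q.+1) : 'M[R]_(dimX, k) :=
  \mxcol_(i < q.+1) (if i == j then 1%:M else 0 : 'M[R]_k).

Definition Bblock : 'M[R]_(dimX, k) :=
  \mxcol_(i < q.+1) (if i == ord_max then 1%:M else 0 : 'M[R]_k).

Definition Cblock : 'M[R]_(k, dimX) :=
  \mxrow_(j < q.+1) (if j == ord0 then 1%:M else 0 : 'M[R]_k).

(* The position of entry c of block j, see [blockposE]. *)
Definition blockpos (j : 'I_q.+1) (c : 'I_k) : 'I_dimX :=
  @tagnat.Rank q.+1 (fun=> k) j c.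

Lemma blockposE (j : 'I_q.+1) (c : 'I_k) : blockpos j c = (k * j + c)%N :> nat.
Proof.
rewrite /blockpos tagnat.RankEsum.
rewrite -(big_ord_widen _ (fun=> k) (ltnW (ltn_ord j))).
by rewrite sum_nat_const card_ord mulnC.
Qed.

Definition causal_mx (A : 'I_q.+1 -> 'M[R]_k) : Prop :=
  forall z : R[i],
    eigenvalue (map_mx (real_complex R) (companion A)) z -> complex.Re z < 0.

Context {d : measure_display} {T : measurableType d}.

Record causal_mcar (P : probability T R) (A : 'I_q.+1 -> 'M[R]_k)
    (L Y : R -> T -> 'cV[R]_k) : Prop := CausalMCAR {
  mcar_driving : driving_levy P L ;
  mcar_causal : causal_mx A ;
  mcar_integral : exists X : R -> T -> 'cV[R]_dimX, forall t : R,
    is_levy_integral P L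
      (fun u => if u <= t then mxexp ((t - u) *: companion A) *m Bblock else 0)
      (X t) /\
    forall w, Y t w = Cblock *m X t w
}.

End MCAR.

(* Main.v *)
Require Import Defs.
From mathcomp Require Import all_boot all_order all_algebra complex.
From mathcomp Require Import all_classical all_reals all_analysis.
From mathcomp Require Import measurable_realfun ring lra.

Set Implicit Arguments.
Unset Strict Implicit.
Unset Printing Implicit Defensive.

Import Order.TTheory GRing.Theory Num.Theory numFieldNormedType.Exports.
Local Open Scope classical_set_scope.
Local Open Scope ring_scope.

(** The proof works with the state X(t), the vector of the blocks
    X_1(t), ..., X_p(t) whose first block is Y_V(t). Three facts carry it.

    - Each coordinate X_{j,v}(t) belongs to the past of the single component
      Y_v: block j is the (j-1)-th mean-square derivative of the first one
      ([state_deriv]), and left difference quotients only use the past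
      ([past_state]).
    - X(t + h) = e^{Ah} X(t) + noise for h >= 0, where the noise is orthogonal
      to the past of all components ([noise_orth]). Prediction from the whole
      past therefore has the entries of e^{Ah} as coefficients.
    - No nontrivial linear combination of X_{1,a}(t), ..., X_{p,a}(t) belongs to
      the past of the other components ([state_independent]).

    For (a), the first two facts show that Y_b(t + h) is predicted from the past
    without a exactly up to the term W = sum_j [e^{Ah}]_{b,(j,a)} X_{j,a}(t).
    If the coefficients vanish, non-causality follows. Conversely, W lies in the
    past of a, and conditional orthogonality of Y_b(h) and W at t = 0 forces W
    to be in the past of the other components, so that its coefficients vanish by
    the third fact. For (b), the derivative of order p - 1 of Y_b is X_{p,b}, and
    the projected difference quotients converge to the combination of the
    projected coordinates of X(t) with the b-th row of the last block row of A as
    coefficients, as (e^{Ah} - 1) / h tends to A. The limits from the two pasts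
    agree if and only if sum_j [A_{p-j+1}]_{ba} X_{j,a}(t) belongs to the past
    without a, and the third fact applies again.

    The third fact is where positive definiteness of the covariance matrix
    enters. By the isometry of the stochastic integral
    ([levy_integral_isometry]), X(s) corresponds to its kernel
    u |-> 1_{u <= s} e^{A(s-u)} B. Let v be the vector with the powers
    1, lam, ..., lam^{p-1} in component a of the blocks. Then
    (lam - A) v = B p for some p in R^k, since A shifts the blocks. For lam
    large, integrating the kernel of X(s) times p against e^{lam(u-t)} gives
    e^{lam(s-t)} v, because the integrand is the derivative of
    e^{lam(u-t)} e^{A(s-u)} v. Hence the test kernel u |-> e^{lam(u-t)} Sigma_L^{-1} p
    defines a continuous functional on L^2 that vanishes on the coordinates of
    Y_w(s), w <> a, and maps sum_j c_j X_{j,a}(t) to sum_j c_j lam^{j-1}. A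
    combination in the past of the others gives a polynomial that vanishes for
    all large lam, so all c_j are zero.

    What the isometry requires of the driving process is that it has orthogonal
    increments with covariance proportional to elapsed time
    ([levy_covariance]). *)

(** * Semi-inner products and orthogonal projection *)

(** Scaling is an explicit argument because complex random variables are used
    as a real vector space, on which no such structure is canonical; the domain
    is needed because integrals are only bilinear on square-integrable
    functions. *)
Record semi_inner {R : realType} {V : zmodType} (sc : R -> V -> V)
    (D : set V) (f : V -> V -> R) : Prop := SemiInner {
  si_dom0 : D 0 ;
  si_domD : forall x y, D x -> D y -> D (x + y) ;
  si_domN : forall x, D x -> D (- x) ;
  si_domZ : forall a x, D x -> D (sc a x) ;
  si_Dl : forall x y z, D x -> D y -> D z -> f (x + y) z = f x z + f y z ;
  si_Zl : forall a x y, D x -> D y -> f (sc a x) y = a * f x y ;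
  si_C : forall x y, D x -> D y -> f x y = f y x ;
  si_ge0 : forall x, D x -> 0 <= f x x }.

Lemma cvg_eq_near {I : Type} {U : nbhsType} (F : set_system I)
    {FF : Filter F} (f g : I -> U) (l : U) :
  (\forall i \near F, f i = g i) -> f i @[i --> F] --> l ->
  g i @[i --> F] --> l.
Proof.
move=> fg; apply: cvg_trans; apply: near_eq_cvg.
by apply: filterS fg => i ->.
Qed.

Lemma cvg_bigsum {R : numFieldType} {I J : Type} (F : set_system J)
    {FF : Filter F} (r : seq I) (f : I -> J -> R) (l : I -> R) :
  (forall i, f i j @[j --> F] --> l i) ->
  (\sum_(i <- r) f i j) @[j --> F] --> \sum_(i <- r) l i.
Proof.
move=> H; elim: r => [|i r IH].
  by rewrite big_nil; under eq_fun do rewrite big_nil; exact: cvg_cst.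
by rewrite big_cons; under eq_fun do rewrite big_cons; exact: cvgD.
Qed.

(** The discriminant of a quadratic polynomial without sign change; it gives
    both the Cauchy-Schwarz inequality and the first-order condition of the
    projection. *)
Lemma sqr_le_discr {R : realType} (a b c : R) : 0 <= c ->
  (forall x, 0 <= a + 2 * x * b + x ^+ 2 * c) -> b ^+ 2 <= a * c.
Proof.
move=> c0 H; have [c_gt0|] := ltP 0 c.
  have := H (- b / c); rewrite -(pmulr_lge0 _ c_gt0).
  suff -> : (a + 2 * (- b / c) * b + (- b / c) ^+ 2 * c) * c = a * c - b ^+ 2.
    by rewrite subr_ge0.
  by field; rewrite gt_eqF.
move=> c0'; have {c0 c0'}c0 : c = 0 by apply/eqP; rewrite eq_le c0 c0'.
have [->|b0] := eqVneq b 0; first by rewrite expr0n/= c0 mulr0.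
have := H (- (a + 1) / (2 * b)).
have -> : a + 2 * (- (a + 1) / (2 * b)) * b +
    (- (a + 1) / (2 * b)) ^+ 2 * c = -1 by rewrite c0; field.
by rewrite lerNr oppr0 ler10.
Qed.

Section semi_inner_theory.
Context {R : realType} {V : zmodType} (sc : R -> V -> V) (D : set V).
Context (f : V -> V -> R) (si : semi_inner sc D f).
Let D0 := si_dom0 si.
Let DD := si_domD si.
Let DN := si_domN si.
Let DZ := si_domZ si.

Lemma si_domB x y : D x -> D y -> D (x - y).
Proof. by move=> ? ?; apply: DD => //; exact: DN. Qed.
Let DB := si_domB.

Lemma si_dom_sum I (r : seq I) (p : pred I) (x : I -> V) :
  (forall i, p i -> D (x i)) -> D (\sum_(i <- r | p i) x i).
Proof. by move=> H; elim/big_ind : _ => //; exact: DD. Qed.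

Lemma si_0l y : D y -> f 0 y = 0.
Proof.
move=> Dy; apply: (addrI (f 0 y)).
by rewrite -(si_Dl si)// addr0 addr0.
Qed.

Lemma si_Nl x y : D x -> D y -> f (- x) y = - f x y.
Proof.
move=> Dx Dy; apply: (addrI (f x y)).
by rewrite -(si_Dl si)// ?subrr ?si_0l//; exact: DN.
Qed.

Lemma si_Bl x y z : D x -> D y -> D z -> f (x - y) z = f x z - f y z.
Proof. by move=> ? ? ?; rewrite (si_Dl si)// ?si_Nl//; exact: DN. Qed.

Lemma si_0r y : D y -> f y 0 = 0.
Proof. by move=> Dy; rewrite (si_C si)// si_0l. Qed.

Lemma si_Dr x y z : D x -> D y -> D z -> f x (y + z) = f x y + f x z.
Proof.
move=> Dx Dy Dz; rewrite (si_C si)//; last exact: DD.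
by rewrite (si_Dl si)// ![f _ x](si_C si).
Qed.

Lemma si_Nr x y : D x -> D y -> f x (- y) = - f x y.
Proof.
move=> ? ?; rewrite (si_C si)//; last exact: DN.
by rewrite si_Nl// [f y x](si_C si).
Qed.

Lemma si_Br x y z : D x -> D y -> D z -> f x (y - z) = f x y - f x z.
Proof. by move=> ? ? ?; rewrite si_Dr// ?si_Nr//; exact: DN. Qed.

Lemma si_BB x y z w : D x -> D y -> D z -> D w ->
  f (x - y) (z - w) = f x z - f x w - (f y z - f y w).
Proof.
move=> Dx Dy Dz Dw; rewrite (si_Bl Dx Dy (DB Dz Dw)).
by rewrite (si_Br Dx Dz Dw) (si_Br Dy Dz Dw).
Qed.

Lemma si_Zr a x y : D x -> D y -> f x (sc a y) = a * f x y.
Proof.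
move=> ? ?; rewrite (si_C si)//; last exact: DZ.
by rewrite (si_Zl si)// [f y x](si_C si).
Qed.

Lemma si_suml I (r : seq I) (p : pred I) (x : I -> V) y :
  (forall i, p i -> D (x i)) -> D y ->
  f (\sum_(i <- r | p i) x i) y = \sum_(i <- r | p i) f (x i) y.
Proof.
move=> H Dy.
suff [] : D (\sum_(i <- r | p i) x i) /\
   f (\sum_(i <- r | p i) x i) y = \sum_(i <- r | p i) f (x i) y by [].
elim/big_rec2 : _ => [|i a b pi [Db <-]]; first by split=> //; exact: si_0l.
by split; [apply: DD => //; exact: H | rewrite (si_Dl si)//; exact: H].
Qed.

Lemma si_sumr I (r : seq I) (p : pred I) (x : I -> V) y :
  (forall i, p i -> D (x i)) -> D y ->
  f y (\sum_(i <- r | p i) x i) = \sum_(i <- r | p i) f y (x i).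
Proof.
move=> H Dy; rewrite (si_C si)//; last exact: si_dom_sum.
by rewrite si_suml//; apply: eq_bigr => i pi; apply: (si_C si) => //; exact: H.
Qed.

Lemma si_DD x y z w : D x -> D y -> D z -> D w ->
  f (x + y) (z + w) = f x z + f y w + f x w + f z y.
Proof.
move=> Dx Dy Dz Dw; rewrite (si_Dl si Dx Dy (DD Dz Dw)).
by rewrite (si_Dr Dx Dz Dw) (si_Dr Dy Dz Dw) (si_C si Dy Dz); ring.
Qed.

Lemma si_sqrD x y : D x -> D y ->
  f (x + y) (x + y) = f x x + 2 * f x y + f y y.
Proof.
move=> Dx Dy; rewrite (si_Dl si)//; last exact: DD.
by rewrite !si_Dr// [f y x](si_C si)//; ring.
Qed.

Lemma si_sqrN x : D x -> f (- x) (- x) = f x x.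
Proof. by move=> Dx; rewrite si_Nl ?si_Nr ?opprK//; exact: DN. Qed.

Lemma si_sqrB x y : D x -> D y ->
  f (x - y) (x - y) = f x x - 2 * f x y + f y y.
Proof.
move=> Dx Dy; rewrite si_sqrD//; last exact: DN.
by rewrite si_sqrN// si_Nr//; ring.
Qed.

Lemma si_sqr_distC x y : D x -> D y -> f (x - y) (x - y) = f (y - x) (y - x).
Proof. by move=> Dx Dy; rewrite -opprB si_sqrN//; exact: DB. Qed.

Lemma si_sqrD_le x y : D x -> D y ->
  f (x + y) (x + y) <= 2 * (f x x + f y y).
Proof.
move=> Dx Dy; have := si_ge0 si (DB Dx Dy).
rewrite si_sqrB// si_sqrD//; lra.
Qed.

Lemma si_sqr_triangle y x z : D x -> D y -> D z ->
  f (x - z) (x - z) <= 2 * (f (x - y) (x - y) + f (y - z) (y - z)).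
Proof.
move=> Dx Dy Dz; rewrite -(subrKA y x (- z)).
by apply: si_sqrD_le; exact: DB.
Qed.

Lemma cauchy_schwarz x y : D x -> D y -> f x y ^+ 2 <= f x x * f y y.
Proof.
move=> Dx Dy; apply: sqr_le_discr => [|a]; first exact: (si_ge0 si).
have DZy := DZ a Dy.
apply: le_trans (si_ge0 si (DD Dx DZy)) _.
rewrite si_sqrD// si_Zr// (si_Zl si)// si_Zr//.
by rewrite le_eqVlt; apply/orP; left; apply/eqP; ring.
Qed.

Lemma si_null x y : D x -> D y -> f x x = 0 -> f x y = 0.
Proof.
move=> Dx Dy x0; have := cauchy_schwarz Dx Dy; rewrite x0 mul0r.
by rewrite -[f x y ^+ 2 <= 0]subr_ge0 sub0r oppr_ge0 exprn_even_le0//= => /eqP.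
Qed.

Lemma si_nullD x y : D x -> D y -> f x x = 0 -> f y y = 0 ->
  f (x + y) (x + y) = 0.
Proof. by move=> Dx Dy x0 y0; rewrite si_sqrD// x0 y0 si_null// mulr0 !addr0. Qed.

Lemma si_cvg0 {I : Type} (F : set_system I) {FF : Filter F} (x : I -> V) y :
  (\forall i \near F, D (x i)) -> D y ->
  f (x i) (x i) @[i --> F] --> 0 -> f (x i) y @[i --> F] --> 0.
Proof.
move=> Dx Dy x0.
have sq0 : (f (x i) (x i) * f y y) @[i --> F] --> (0 * f y y) by exact: cvgMl.
rewrite mul0r in sq0.
have : Num.sqrt (f (x i) (x i) * f y y) @[i --> F] --> Num.sqrt 0.
  exact: (continuous_cvg _ (@sqrt_continuous _ _) sq0).
rewrite sqrtr0 => sq1; apply/norm_cvg0P; apply: squeeze_cvgr sq1; last first.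
  exact: cvg_cst.
near=> i; rewrite normr_ge0/= -sqrtr_sqr ler_wsqrtr//.
by apply: cauchy_schwarz => //; near: i.
Unshelve. all: by end_near. Qed.

(** Joint continuity of the form for mean-square convergence: the isometry
    of the stochastic integral and all limits of covariances rest on it. *)
Lemma si_cvg {I : Type} (F : set_system I) {FF : Filter F} (x y : I -> V) x0 y0 :
  (\forall i \near F, D (x i)) -> (\forall i \near F, D (y i)) ->
  D x0 -> D y0 ->
  f (x i - x0) (x i - x0) @[i --> F] --> 0 ->
  f (y i - y0) (y i - y0) @[i --> F] --> 0 ->
  f (x i) (y i) @[i --> F] --> f x0 y0.
Proof.
move=> Dx Dy Dx0 Dy0 cx cy.
have Dxx : \forall i \near F, D (x i - x0).
  by near=> i; apply: DB => //; near: i.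
have Dyy : \forall i \near F, D (y i - y0).
  by near=> i; apply: DB => //; near: i.
have c1 : f (x i - x0) y0 @[i --> F] --> 0 by exact: si_cvg0.
have c2 : f x0 (y i - y0) @[i --> F] --> 0.
  apply: cvg_eq_near (si_cvg0 Dyy Dx0 cy).
  by near=> i; apply: (si_C si) => //; near: i.
have c3 : f (x i - x0) (y i - y0) @[i --> F] --> 0.
  have c : (f (x i - x0) (x i - x0) + f (y i - y0) (y i - y0)) @[i --> F] -->
     (0 + 0 : R) by exact: cvgD.
  rewrite addr0 in c; apply/norm_cvg0P; apply: squeeze_cvgr c; last exact: cvg_cst.
  near=> i; rewrite normr_ge0/=.
  have D1 : D (x i - x0) by near: i.
  have D2 : D (y i - y0) by near: i.
  have := si_ge0 si (DB D1 D2); have := si_ge0 si (DD D1 D2).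
  rewrite si_sqrB// si_sqrD// => A B; rewrite ler_norml; apply/andP; split.
    by have := si_ge0 si D1; have := si_ge0 si D2; lra.
  by have := si_ge0 si D1; have := si_ge0 si D2; lra.
have : (f x0 y0 + f (x i - x0) y0 + f x0 (y i - y0) + f (x i - x0) (y i - y0))
   @[i --> F] --> (f x0 y0 + 0 + 0 + 0).
  apply: cvgD => //; apply: cvgD => //; apply: cvgD => //; exact: cvg_cst.
rewrite !addr0; apply: cvg_eq_near; near=> i.
have Dxi : D (x i) by near: i.
have Dyi : D (y i) by near: i.
by rewrite !si_Bl ?si_Br//; [ring|exact: DB].
Unshelve. all: by end_near. Qed.

Lemma si_comb_cvg0 {I J : Type} (F : set_system J) {FF : Filter F} (r : seq I)
    (a : I -> J -> R) (y : I -> V) :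
  (forall i, D (y i)) -> (forall i, a i j @[j --> F] --> 0) ->
  f (\sum_(i <- r) sc (a i j) (y i)) (\sum_(i <- r) sc (a i j) (y i)) @[j --> F] --> 0.
Proof.
move=> Dy a0.
have c : (\sum_(i <- r) \sum_(i' <- r) a i j * (a i' j * f (y i) (y i'))) @[j --> F] -->
    \sum_(i <- r) \sum_(i' <- r) 0 * (0 * f (y i) (y i')).
  apply: cvg_bigsum => i; apply: cvg_bigsum => i'.
  by apply: cvgM => //; exact: cvgMl.
rewrite big1 in c; last by move=> i _; rewrite big1// => i' _; rewrite mul0r.
apply: cvg_eq_near c; near=> j.
have Day i : D (sc (a i j) (y i)) by exact: DZ.
rewrite (si_suml _ (fun i _ => Day i) (si_dom_sum _ (fun i _ => Day i))).
apply: eq_bigr => i _; rewrite (si_sumr _ (fun i' _ => Day i') (Day i)).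
by apply: eq_bigr => i' _; rewrite (si_Zl si)// si_Zr.
Unshelve. all: by end_near. Qed.

Lemma si_cvg_unique {I : Type} (F : set_system I) {FF : ProperFilter F}
    (x : I -> V) y z :
  (\forall i \near F, D (x i)) -> D y -> D z ->
  f (x i - y) (x i - y) @[i --> F] --> 0 ->
  f (x i - z) (x i - z) @[i --> F] --> 0 -> f (y - z) (y - z) = 0.
Proof.
move=> Dx Dy Dz cy cz; apply/eqP; rewrite eq_le (si_ge0 si (DB Dy Dz)) andbT.
have c : (2 * (f (x i - y) (x i - y) + f (x i - z) (x i - z))) @[i --> F] -->
   (2 * (0 + 0) : R) by apply: cvgMr; exact: cvgD.
rewrite addr0 mulr0 in c.
rewrite leNgt; apply/negP => q0; near F => i.
have Dxi : D (x i) by near: i.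
suff : f (y - z) (y - z) < f (y - z) (y - z) by rewrite ltxx.
apply: le_lt_trans (si_sqr_triangle Dy Dxi Dz) _.
rewrite (si_sqr_distC Dy Dxi); near: i.
exact: (cvgr_lt _ c _ q0).
Unshelve. all: by end_near. Qed.

Lemma si_parallelogram x y z : D x -> D y -> D z ->
  f (y - z) (y - z) = 2 * f (x - y) (x - y) + 2 * f (x - z) (x - z) -
    f (x - y + (x - z)) (x - y + (x - z)).
Proof.
move=> Dx Dy Dz.
have -> : y - z = (x - z) - (x - y) by rewrite opprB [RHS]addrC subrKA.
have ? := DB Dx Dy; have ? := DB Dx Dz.
rewrite (@si_sqrB (x - z))// (@si_sqrD (x - y))//.
by rewrite [f (x - z) (x - y)](si_C si)//; ring.
Qed.

(** Completeness is asked for along sequences with geometrically small steps,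
    for which convergence in L^2 comes with almost sure convergence. *)
Definition si_complete := forall x : nat -> V, (forall n, D (x n)) ->
  (forall n, f (x n.+1 - x n) (x n.+1 - x n) <= (4^-1) ^+ n) ->
  exists2 z, D z & f (x n - z) (x n - z) @[n --> \oo] --> 0.

(** A minimising sequence is Cauchy by the parallelogram identity, and
    orthogonality of its limit is the first-order condition at the minimum,
    with errors controlled by [sqr_le_discr]. *)
Lemma projection_exists (G : set V) x : si_complete -> G `<=` D ->
  G 0 -> (forall y z, G y -> G z -> G (y + z)) ->
  (forall a y, G y -> G (sc a y)) ->
  (forall y, D y -> sc 2^-1 y + sc 2^-1 y = y) -> D x ->
  exists z, [/\ D z, forall e : R, 0 < e -> exists2 w, G w & f (w - z) (w - z) < e
     & forall w, G w -> f (x - z) w = 0].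
Proof.
move=> comp GD G0 GDD GZ half Dx.
pose S := [set f (x - y) (x - y) | y in G].
have lbS : lbound S 0.
  by move=> _ [y Gy <-]; apply: (si_ge0 si); apply: DB => //; exact: GD.
have infS : has_inf S by split; [exists (f (x - 0) (x - 0)), 0 | exists 0].
pose m := inf S.
have m_le y : G y -> m <= f (x - y) (x - y).
  by move=> Gy; apply: ge_inf; [exists 0 | exists y].
pose e n : R := (4^-1) ^+ n / 8.
have e0 n : 0 < e n by rewrite /e divr_gt0// exprn_gt0// invr_gt0.
have ex n : exists y, G y /\ f (x - y) (x - y) < m + e n.
  have [_ [y Gy <-] lt] := inf_adherent (e0 n) infS.
  by exists y.
have [y yP] := choice ex.
have Gy n : G (y n) by have [] := yP n.
have Dy n : D (y n) by exact: GD.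
have ylt n : f (x - y n) (x - y n) < m + e n by have [] := yP n.
have dist i j : f (y i - y j) (y i - y j) <= 2 * (e i + e j).
  rewrite (si_parallelogram Dx)//.
  have Gm : G (sc 2^-1 (y i + y j)) by apply: GZ; exact: GDD.
  have Dm := GD _ Gm.
  have Dyy : D (y i + y j) by exact: DD.
  have -> : x - y i + (x - y j) =
      (x - sc 2^-1 (y i + y j)) + (x - sc 2^-1 (y i + y j)).
    by rewrite [LHS]addrACA [RHS]addrACA -!opprD half.
  have := m_le _ Gm; have := ylt i; have := ylt j.
  have ? := DB Dx Dm.
  rewrite (@si_sqrD (x - sc 2^-1 (y i + y j)))//.
  by set u := f _ _; set v := f _ _; set w := f _ _; lra.
have e1 n : e n.+1 = e n / 4 by rewrite /e exprS; ring.
have [n|z Dz zlim] := comp _ Dy.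
  rewrite (le_trans (dist _ _))// e1.
  have : (4^-1) ^+ n = e n * 8 by rewrite /e divfK.
  by have := e0 n; lra.
have ecvg : e n @[n --> \oo] --> 0.
  rewrite -[X in _ --> X](mul0r 8^-1); apply: cvgMl; apply: cvg_expr.
  by rewrite ger0_norm// invf_lt1// ltr1n.
exists z; split => // [c c0|w Gw].
  have [n _ /(_ _ (leqnn n))] := (cvgr_lt _ zlim _ c0).
  by exists (y n).
have Dw := GD _ Gw.
(* first-order condition along the direction w, up to the error e n *)
have foc n : f (x - y n) w ^+ 2 <= e n * f w w.
  apply: sqr_le_discr => [|a]; first exact: (si_ge0 si).
  have DZw := DZ (- a) Dw.
  have := m_le _ (GDD _ _ (Gy n) (GZ (- a) _ Gw)).
  have Dxy := DB Dx (Dy n).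
  rewrite opprD addrA (@si_sqrB (x - y n))// si_Zr// (si_Zl si)// si_Zr//.
  have := ylt n; set u := f _ _; set v := f _ _; set t := f _ _ => A B.
  have -> : e n + 2 * a * v + a ^+ 2 * t =
    (m + e n - u) + (u - 2 * (- a * v) + - a * (- a * t) - m) by ring.
  by rewrite addr_ge0// subr_ge0// ltW.
have c1 : f (x - y n) w ^+ 2 @[n --> \oo] --> (0 : R).
  apply: (@squeeze_cvgr _ _ _ _ (fun=> 0) (fun n => e n * f w w)).
  - by near=> n; rewrite sqr_ge0 foc.
  - exact: cvg_cst.
  - by rewrite -[X in _ --> X](mul0r (f w w)); exact: cvgMl.
have c2 : f (x - y n) w ^+ 2 @[n --> \oo] --> f (x - z) w ^+ 2.
  rewrite expr2; under eq_fun do rewrite expr2.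
  have c : f (x - y n) w @[n --> \oo] --> f (x - z) w.
    apply: si_cvg => //.
    - by near=> n; exact: DB.
    - by near=> n.
    - exact: DB.
    - apply: cvg_eq_near zlim; near=> n.
      have -> : x - y n - (x - z) = - (y n - z) by rewrite opprB addrC subrKA opprB.
      by rewrite si_sqrN//; exact: DB.
    - by rewrite subrr si_0l//; exact: cvg_cst.
  exact: cvgM.
have /esym/eqP : 0 = f (x - z) w ^+ 2 by apply: cvg_unique c1 c2.
by rewrite sqrf_eq0 => /eqP.
Unshelve. all: by end_near. Qed.

End semi_inner_theory.

(** * Square-integrable real functions *)

Section real_L2.
Context {R : realType} {d : measure_display} {T : measurableType d}.
Variable mu : {measure set T -> \bar R}.
Implicit Types f g : T -> R.

Definition sqint : set (T -> R) := [set f : T -> R | measurable_fun setT f /\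
  mu.-integrable setT (fun x => (f x ^+ 2)%:E)].

Definition ip f g : R := \int[mu]_x (f x * g x).

Lemma sqintP f : measurable_fun setT f ->
  (\int[mu]_x (f x ^+ 2)%:E < +oo)%E -> sqint f.
Proof.
move=> mf foo; split => //; apply/integrableP; split.
  by apply/measurable_EFinP; exact: measurable_funX.
by under eq_integral do rewrite gee0_abs ?lee_fin ?sqr_ge0//.
Qed.

Lemma sqint_int_mul f g : sqint f -> sqint g ->
  mu.-integrable setT (fun x => (f x * g x)%:E).
Proof.
move=> [mf intf] [mg intg].
apply: (le_integrable measurableT _ _ (integrableD measurableT intf intg)).
  by apply/measurable_EFinP; exact: measurable_funM.
move=> x _ /=; rewrite -[leRHS]/(`|f x ^+ 2 + g x ^+ 2|%:E) -[leLHS]/(`|f x * g x|%:E) lee_fin.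
rewrite (ger0_norm (addr_ge0 (sqr_ge0 _) (sqr_ge0 _))).
rewrite ler_norml; apply/andP; split.
  by have := sqr_ge0 (f x + g x); have := sqr_ge0 (f x);
     have := sqr_ge0 (g x); rewrite sqrrD; lra.
by have := sqr_ge0 (f x - g x); have := sqr_ge0 (f x);
     have := sqr_ge0 (g x); rewrite sqrrB; lra.
Qed.

Lemma sqint_semi_inner : semi_inner (fun a f => a *: f) sqint ip.
Proof.
split.
- by apply: sqintP; [exact: measurable_cst|]; under eq_integral do rewrite expr0n/=;
     rewrite integral0.
- move=> f g sf sg; have [mf intf] := sf; have [mg intg] := sg.
  split; first exact: measurable_funD.
  have ifg := sqint_int_mul sf sg.
  apply: (@eq_integrable _ _ _ _ _ measurableT
    (fun x => (f x ^+ 2)%:E + (2%:E * (f x * g x)%:E + (g x ^+ 2)%:E))%E).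
    move=> x _ /=; rewrite -!EFinM -!EFinD; congr EFin.
    by rewrite !fctE; ring.
  by apply: integrableD => //; apply: integrableD => //; exact: integrableZl.
- move=> f [mf intf]; split; first exact: measurableT_comp.
  apply: (@eq_integrable _ _ _ _ _ measurableT _ _ _ intf) => x _.
  by rewrite !fctE sqrrN.
- move=> a f [mf intf]; split; first exact: measurable_funM.
  apply: (@eq_integrable _ _ _ _ _ measurableT
    (fun x => (a ^+ 2)%:E * (f x ^+ 2)%:E)%E); last exact: integrableZl.
  by move=> x _; rewrite -EFinM -exprMn.
- move=> f g h sf sg sh; rewrite /ip -RintegralD//; try exact: sqint_int_mul.
  by apply: eq_Rintegral => x _; rewrite !fctE mulrDl.
- move=> a f g sf sg; rewrite /ip -RintegralZl//; try exact: sqint_int_mul.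
  by apply: eq_Rintegral => x _; rewrite mulrA.
- by move=> f g _ _; apply: eq_Rintegral => x _; rewrite mulrC.
- by move=> f _; apply: Rintegral_ge0 => x _; rewrite -expr2 sqr_ge0.
Qed.

Lemma ip_sqrE f : ip f f = \int[mu]_x (f x ^+ 2).
Proof. by apply: eq_Rintegral => x _; rewrite expr2. Qed.

Lemma integral_sqrE f : sqint f -> (\int[mu]_x (f x ^+ 2)%:E)%E = (ip f f)%:E.
Proof.
move=> [mf intf]; rewrite ip_sqrE /Rintegral fineK//.
exact: integrable_fin_num.
Qed.

Lemma ip_ae0 f : measurable_fun setT f -> {ae mu, forall x, f x = 0} ->
  sqint f /\ ip f f = 0.
Proof.
move=> mf f0.
have i0 : (\int[mu]_x (f x ^+ 2)%:E)%E = 0%E.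
  rewrite (@ae_eq_integral _ _ _ _ _ (cst 0%E))//; first by rewrite integral0.
    by apply/measurable_EFinP; exact: measurable_funX.
  by apply: filterS f0 => x -> _; rewrite expr0n.
have sf : sqint f by apply: sqintP => //; rewrite i0.
by split => //; have := integral_sqrE sf; rewrite i0 => -[].
Qed.

Lemma ip0_ae f : sqint f -> ip f f = 0 -> {ae mu, forall x, f x = 0}.
Proof.
move=> sf f0; have [mf intf] := sf.
have := integral_sqrE sf; rewrite f0 => i0.
have mf2 : measurable_fun setT (fun x => (f x ^+ 2)%:E).
  by apply/measurable_EFinP; exact: measurable_funX.
have [+ _] := ae_eq_integral_abs mu measurableT mf2.
under eq_integral do rewrite gee0_abs ?lee_fin ?sqr_ge0//.
move=> /(_ i0); apply: filterS => x /(_ Logic.I)/= [] /eqP.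
by rewrite sqrf_eq0 => /eqP.
Qed.

Lemma sqint_ae_eq f g : sqint f -> measurable_fun setT g ->
  {ae mu, forall x, f x = g x} -> sqint g /\ ip (f - g) (f - g) = 0.
Proof.
move=> sf mg fg; have si := sqint_semi_inner.
have mfg : measurable_fun setT (f - g) by apply: measurable_funB => //; case: sf.
have [] := ip_ae0 mfg.
  by apply: filterS fg => x E; rewrite !fctE E subrr.
move=> sfg i0; split => //; rewrite -[g](subKr f); exact: (si_domB si).
Qed.

Lemma ip_ae_eql f f' g : sqint f -> sqint g -> measurable_fun setT f' ->
  {ae mu, forall x, f x = f' x} -> ip f' g = ip f g.
Proof.
move=> sf sg mf' ff'; have [sf' i0] := sqint_ae_eq sf mf' ff'.
have si := sqint_semi_inner.
have /eqP := si_null si (si_domB si sf sf') sg i0.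
by rewrite (si_Bl si)// subr_eq0 => /eqP.
Qed.

Lemma ip_sqr_le (c : R) f g : 0 <= c -> sqint f -> sqint g ->
  (forall x, `|f x| <= c * `|g x|) -> ip f f <= c ^+ 2 * ip g g.
Proof.
move=> c0 sf sg fg; have si := sqint_semi_inner.
have scg := si_domZ si c sg.
have <- : ip (c *: g) (c *: g) = c ^+ 2 * ip g g.
  by rewrite (si_Zl si)// (si_Zr si)//; ring.
apply: le_Rintegral => //.
- exact: sqint_int_mul.
- exact: sqint_int_mul.
- move=> x _; rewrite -!expr2 -real_normK ?num_real// -[leRHS]real_normK ?num_real//.
  rewrite ler_sqr ?nnegrE// (le_trans (fg x))//.
  by rewrite -[(c *: g) x]/(c * g x) normrM (ger0_norm c0).
Qed.

Lemma ip_indic (A B : set T) : measurable A -> measurable B ->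
  ip \1_A \1_B = fine (mu (A `&` B)).
Proof.
move=> mA mB; rewrite /ip /Rintegral; congr fine.
rewrite -[in RHS](setIT (A `&` B)) -integral_indic//; last exact: measurableI.
by apply: eq_integral => x _; rewrite indicI.
Qed.

Lemma sqint_indic (A : set T) : measurable A -> (mu A < +oo)%E -> sqint \1_A.
Proof.
move=> mA Aoo; apply: sqintP; first exact: measurable_indic.
under eq_integral => x _.
  rewrite (_ : \1_A x ^+ 2 = \1_A x :> R); last first.
    by rewrite indicE; case: (_ \in _); rewrite ?expr1n ?expr0n.
  over.
by rewrite integral_indic// setIT.
Qed.

Lemma Rintegral_bigsum (I : Type) (r : seq I) (f : I -> T -> R) :
  (forall i, mu.-integrable setT (fun x => (f i x)%:E)) ->
  mu.-integrable setT (fun x => (\sum_(i <- r) f i x)%:E) /\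
  \int[mu]_x (\sum_(i <- r) f i x) = \sum_(i <- r) \int[mu]_x f i x.
Proof.
move=> fi; elim: r => [|i r [ir IH]].
  rewrite big_nil; under eq_fun do rewrite big_nil.
  split; first exact: integrable0.
  by under eq_Rintegral do rewrite big_nil; rewrite /Rintegral integral0.
split.
  under eq_fun do rewrite big_cons EFinD.
  exact: integrableD.
under eq_Rintegral do rewrite big_cons.
rewrite big_cons -IH; apply: (RintegralD measurableT (fi i) ir).
Qed.

End real_L2.

Section riesz_fischer.
Context {R : realType} {d : measure_display} {T : measurableType d}.
Variable P : probability T R.
Let si := sqint_semi_inner P.

Lemma sqint_cst (c : R) : sqint P (cst c).
Proof.
split; first exact: measurable_cst.
exact: (finite_measure_integrable_cst P (c ^+ 2) measurableT).
Qed.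

Lemma sqint_integrable (f : T -> R) : sqint P f ->
  P.-integrable setT (EFin \o f).
Proof.
move=> sf; have := sqint_int_mul sf (sqint_cst 1).
by apply: eq_integrable => // w _; rewrite mulr1.
Qed.

Lemma limn_einf_le_cst (u : (\bar R)^nat) (c : \bar R) :
  (forall n, u n <= c)%E -> (limn_einf u <= c)%E.
Proof.
move=> uc; rewrite limn_einf_lim; apply: lime_le; first exact: is_cvg_einfs.
near=> n; apply: le_trans (uc n); apply: ereal_inf_lbound.
by exists n => /=.
Unshelve. all: by end_near. Qed.

(** Bounds on the distances within a sequence become bounds on the distance to
    its almost sure limit. *)
Lemma fatou_sqr (h : nat -> T -> R) (g : T -> R) (c : \bar R) :
  (forall n, measurable_fun setT (h n)) -> measurable_fun setT g ->
  {ae P, forall w, h n w @[n --> \oo] --> g w} ->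
  (forall n, \int[P]_w (h n w ^+ 2)%:E <= c)%E ->
  (\int[P]_w (g w ^+ 2)%:E <= c)%E.
Proof.
move=> mh mg hg hc; pose h2 m w := ((h m w) ^+ 2)%:E.
have mh2 m : measurable_fun setT (h2 m).
  by apply/measurable_EFinP; exact: measurable_funX.
have h20 m w : (0 <= h2 m w)%E by rewrite lee_fin sqr_ge0.
apply: (@le_trans _ _ (\int[P]_w limn_einf (h2^~ w))%E).
  apply: ae_ge0_le_integral => //.
  - by move=> w _; rewrite lee_fin sqr_ge0.
  - by apply/measurable_EFinP; exact: measurable_funX.
  - move=> w _; rewrite limn_einf_lim; apply: lime_ge; first exact: is_cvg_einfs.
    by near=> m; apply: le_ereal_inf_tmp => _ [? _ <-].
  - apply: measurableT_comp => //; apply: measurable_fun_limn_esup => m.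
    exact: measurableT_comp.
  apply: filterS hg => w hw _.
  suff /cvg_limn_einf_sup[-> _] : h2 m w @[m --> \oo] --> ((g w) ^+ 2)%:E by [].
  by apply: cvg_EFin; [exact: nearW | exact: cvgM].
apply: le_trans (fatou _ _ mh2 _) _ => //.
exact: limn_einf_le_cst.
Unshelve. all: by end_near. Qed.

Let geometric_dist (x : nat -> T -> R) : (forall n, sqint P (x n)) ->
  (forall n, ip P (x n.+1 - x n) (x n.+1 - x n) <= (4^-1) ^+ n) ->
  forall m n, ip P (x n - x (m + n)%N) (x n - x (m + n)%N) <= 4 * (4^-1) ^+ n.
Proof.
move=> sx dx; elim=> [|m IH] n.
  rewrite add0n subrr (si_0l si) ?mulr_ge0 ?exprn_ge0//.
  exact: (si_dom0 si).
apply: le_trans (si_sqr_triangle si (sx n) (sx n.+1) (sx _)) _.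
rewrite (si_sqr_distC si (sx n))// addSnnS.
have := IH n.+1; have := dx n; rewrite exprS => A B.
by have : 4 * (4^-1 * 4^-1 ^+ n) = 4^-1 ^+ n :> R; [field | lra].
Qed.

Let ae_cvg (x : nat -> T -> R) : (forall n, sqint P (x n)) ->
  (forall n, ip P (x n.+1 - x n) (x n.+1 - x n) <= (4^-1) ^+ n) ->
  {ae P, forall w, cvgn (fun n => x n w)}.
Proof.
move=> sx dx; pose g n := x n.+1 - x n.
have sg n : sqint P (g n) by exact: (si_domB si).
have mg n : measurable_fun setT (fun w => (`|g n w|)%:E).
  by apply/measurable_EFinP; apply: measurableT_comp => //; case: (sg n).
have ig n : (\int[P]_w (`|g n w|)%:E <= ((2^-1) ^+ n)%:E)%E.
  (* both terms on the right are of order 2^-n after integration *)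
  have le w : `|g n w| <= 2^-1 * (2 ^+ n * g n w ^+ 2 + (2^-1) ^+ n).
    rewrite exprVn -(real_normK (num_real (g n w))); set a := `|_|.
    have p0 : 0 < 2 ^+ n :> R by rewrite exprn_gt0.
    rewrite -subr_ge0.
    have -> : 2^-1 * (2 ^+ n * a ^+ 2 + (2 ^+ n)^-1) - a =
      2^-1 * (2 ^+ n)^-1 * (2 ^+ n * a - 1) ^+ 2.
      by field; rewrite gt_eqF.
    by rewrite mulr_ge0 ?sqr_ge0// mulr_ge0// invr_ge0 ltW.
  have [mgn intg] := sg n.
  apply: (@le_trans _ _ (\int[P]_w
     ((2^-1 * 2 ^+ n)%:E * (g n w ^+ 2)%:E + (2^-1 * (2^-1) ^+ n)%:E))%E).
    apply: ge0_le_integral => //.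
    - apply: emeasurable_funD => //; apply: emeasurable_funM => //.
      by apply/measurable_EFinP; exact: measurable_funX.
    - move=> w _; rewrite -EFinM -EFinD lee_fin.
      by rewrite (le_trans (le w))// mulrDr mulrA.
  rewrite integralD//=; last 2 first.
  - exact: integrableZl.
  - exact: finite_measure_integrable_cst.
  rewrite integralZl// integral_sqrE// integral_cst//.
  rewrite [X in (_ + _ * X)%E](_ : _ = 1%E); last exact: probability_setT.
  rewrite -EFinM mule1 -EFinD lee_fin.
  have := dx n; rewrite -/(g n) => gn.
  apply: (@le_trans _ _ (2^-1 * 2 ^+ n * 4^-1 ^+ n + 2^-1 * 2^-1 ^+ n)).
    by rewrite lerD2r ler_wpM2l// mulr_ge0// exprn_ge0.
  have -> : 4^-1 = 2^-1 * 2^-1 :> R by field.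
  rewrite exprMn -!mulrA [2 ^+ n * _]mulrA -exprMn mulfV// expr1n mul1r.
  by move: (2^-1 ^+ n) => y; lra.
have isum : (\int[P]_w (\sum_(n <oo) (`|g n w|)%:E) < +oo)%E.
  rewrite integral_nneseries//.
  apply: (@le_lt_trans _ _ (\sum_(n <oo) ((2^-1) ^+ n)%:E)%E).
    by apply: lee_nneseries => // n _ _; apply: integral_ge0 => w _; rewrite lee_fin.
  apply: (@le_lt_trans _ _ 2%:E); last exact: ltry.
  apply: lime_le; first by apply: is_cvg_nneseries => *; rewrite lee_fin exprn_ge0.
  near=> n; rewrite sumEFin lee_fin.
  suff -> : \sum_(0 <= i < n) (2^-1) ^+ i = 2 - 2 * (2^-1) ^+ n :> R.
    by rewrite gerBl mulr_ge0// exprn_ge0.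
  elim: {+}n => [|m IH]; first by rewrite big_nil expr0 mulr1 subrr.
  by rewrite big_nat_recr//= IH exprS; field.
have mS : measurable_fun setT (fun w => (\sum_(n <oo) (`|g n w|)%:E)%E).
  by apply: ge0_emeasurable_sum => // n w _ _; rewrite lee_fin.
have intS : P.-integrable setT (fun w => (\sum_(n <oo) (`|g n w|)%:E)%E).
  apply/integrableP; split => //.
  under eq_integral do rewrite gee0_abs ?nneseries_ge0//.
  exact: isum.
have := integrable_ae measurableT intS; apply: filterS => w /(_ Logic.I) fw.
have cv : cvgn (series (fun n => g n w)).
  apply: normed_cvg; apply: nondecreasing_is_cvgn.
    apply/nondecreasing_seqP => n.
    pose a i := `|g i w|.
    rewrite -[leLHS]/(series a n) -[leRHS]/(series a n.+1) seriesSr lerDl; exact: normr_ge0.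
  exists (fine (\sum_(n <oo) (`|g n w|)%:E)%E) => _ [n _ <-].
  rewrite -lee_fin fineK// -[X in X%:E]/(\sum_(0 <= i < n) `|g i w|) -sumEFin.
  by apply: nneseries_lim_ge => *; rewrite lee_fin.
have -> : (fun n => x n w) = (fun n => x 0%N w + series (fun n => g n w) n).
  apply/funext => n; rewrite /series/= telescope_sumr//.
  by rewrite addrC subrK.
exact: (is_cvgD (is_cvg_cst _) cv).
Unshelve. all: by end_near. Qed.

(** The steps are summable in L^1, so the sequence converges almost surely, and
    Fatou's lemma turns this into mean-square convergence. *)
Lemma sqint_complete : si_complete (sqint P) (ip P).
Proof.
move=> x sx dx; have cv := ae_cvg sx dx.
pose z w := fine (limn_esup (fun n => (x n w)%:E)).
have mx n : measurable_fun setT (x n) by case: (sx n).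
have mz : measurable_fun setT z.
  apply: (measurableT_comp (fine_measurable measurableT)) => //.
  by apply: measurable_fun_limn_esup => n; exact/measurable_EFinP.
have zP : {ae P, forall w, x n w @[n --> \oo] --> z w}.
  apply: filterS cv => w cw; rewrite /z.
  have : (fun n => (x n w)%:E) @ \oo --> (limn (fun n => x n w))%:E.
    by apply: cvg_EFin; [exact: nearW|].
  by move=> /cvg_limn_einf_sup[_ ->].
have bnd n : (\int[P]_w ((x n w - z w) ^+ 2)%:E <= (4 * (4^-1) ^+ n)%:E)%E.
  apply: (@fatou_sqr (fun m => x n - x (m + n)%N) (fun w => x n w - z w)).
  - by move=> m; exact: measurable_funB.
  - exact: measurable_funB.
  - apply: filterS zP => w zw; apply: cvgB; first exact: cvg_cst.
    by rewrite (cvg_shiftn n (fun m => x m w)).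
  - move=> m; rewrite integral_sqrE; last exact: (si_domB si).
    by rewrite lee_fin geometric_dist.
have sxz n : sqint P (x n - z).
  apply: sqintP; first exact: measurable_funB.
  exact: le_lt_trans (bnd n) (ltry _).
exists z.
  by rewrite -(subKr (x 0%N) z); exact: (si_domB si).
apply: (@squeeze_cvgr _ _ _ _ (fun=> 0) (fun n => 4 * (4^-1) ^+ n)).
- near=> n; rewrite (si_ge0 si)//=.
  by rewrite -lee_fin -integral_sqrE//; exact: bnd.
- exact: cvg_cst.
- rewrite -[X in _ --> X](mulr0 4); apply: cvgMr; apply: cvg_expr.
  by rewrite ger0_norm// invf_lt1// ltr1n.
Unshelve. all: by end_near. Qed.

End riesz_fischer.

(** * Independence of real random variables *)

Section independence.
Context {R : realType} {d : measure_display} {T : measurableType d}.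
Variable P : probability T R.
Implicit Types X Y : T -> R.

Definition indep2 X Y := forall A B : set R, measurable A -> measurable B ->
  (P (X @^-1` A `&` Y @^-1` B) = P (X @^-1` A) * P (Y @^-1` B))%E.

Section joint_law.
Variables X Y : T -> R.
Hypotheses (mX : measurable_fun setT X) (mY : measurable_fun setT Y).
Hypothesis XY : indep2 X Y.

Let X' : {mfun T >-> R} := mfun_Sub (mem_set mX).
Let Y' : {mfun T >-> R} := mfun_Sub (mem_set mY).
Let PX := distribution P X'.
Let PY := distribution P Y'.
Let Z w := (X w, Y w).
Let mZ : measurable_fun setT Z. Proof. exact: measurable_fun_pair. Qed.

Let joint (f : R * R -> \bar R) :
  (\int[pushforward P Z]_z f z = \int[PX \x PY]_z f z)%E.
Proof.
apply: eq_measure_integral => A mA _.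
apply/esym; apply: product_measure_unique mA => B C mB mC.
by rewrite /pushforward -XY.
Qed.

Let ge0_joint (f : R * R -> \bar R) : measurable_fun setT f ->
  (forall z, 0 <= f z)%E ->
  (\int[P]_w f (X w, Y w) = \int[PX \x PY]_z f z)%E.
Proof. by move=> mf f0; rewrite -joint ge0_integral_pushforward. Qed.

(** By Tonelli, the sum is square-integrable for almost every frozen value of
    the second variable. *)
Lemma indep_sqint_add : sqint P (X + Y) -> sqint P X.
Proof.
move=> [mS iS]; apply: sqintP => //.
pose f (z : R * R) := ((z.1 + z.2) ^+ 2)%:E.
have mf : measurable_fun setT f.
  apply/measurable_EFinP; apply: measurable_funX; apply: measurable_funD.
    exact: measurable_fst.
  exact: measurable_snd.
have f0 z : (0 <= f z)%E by rewrite lee_fin sqr_ge0.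
have foo : (\int[PY]_y \int[PX]_x f (x, y) < +oo)%E.
  rewrite -fubini_tonelli// -fubini_tonelli1// -ge0_joint//.
  exact: integrable_lty iS.
have [y fy] : exists y, (\int[PX]_x f (x, y) < +oo)%E.
  apply: contrapT => /forallNP H; move: foo.
  have -> : (fun y => \int[PX]_x f (x, y))%E = cst +oo%E.
    apply/funext => y; apply/eqP; rewrite -leye_eq leNgt; apply/negP; exact: H.
  by rewrite integral_cst// [X in (_ * X)%E]probability_setT mule1.
rewrite (_ : (\int[P]_w _)%E = \int[PX]_x (x ^+ 2)%:E)%E; last first.
  rewrite ge0_integral_distribution//; last by move=> x; rewrite lee_fin sqr_ge0.
  by apply/measurable_EFinP; exact: measurable_funX.
have mfy : measurable_fun setT (fun x => f (x, y)).
  by apply: (measurableT_comp mf); exact: pair2_measurable.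
apply: (@le_lt_trans _ _ (\int[PX]_x (2%:E * f (x, y) + (2 * y ^+ 2)%:E))%E).
  apply: ge0_le_integral => //.
  - by move=> x _; rewrite lee_fin sqr_ge0.
  - by apply/measurable_EFinP; exact: measurable_funX.
  - by apply: emeasurable_funD => //; exact: emeasurable_funM.
  move=> x _; rewrite /f /= -EFinM -EFinD lee_fin.
  by have := sqr_ge0 (x + 2 * y); rewrite !sqrrD; lra.
rewrite ge0_integralD//; last 3 first.
- by move=> x _; rewrite mule_ge0.
- exact: emeasurable_funM.
- by move=> x _; rewrite lee_fin mulr_ge0// sqr_ge0.
rewrite ge0_integralZl// integral_cst//.
rewrite [X in (_ + _ * X)%E](_ : _ = 1%E); last exact: probability_setT.
rewrite mule1 lte_add_pinfty// ?ltry// lte_mul_pinfty//.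
Qed.

Lemma indep_expectM : sqint P X -> sqint P Y ->
  \int[P]_w (X w * Y w) = (\int[P]_w X w) * (\int[P]_w Y w).
Proof.
move=> sX sY.
pose f (z : R * R) := (z.1 * z.2)%:E.
have mf : measurable_fun setT f.
  apply/measurable_EFinP; apply: measurable_funM.
    exact: measurable_fst.
  exact: measurable_snd.
have iXY := sqint_int_mul sX sY.
have int1 := @sqint_integrable _ _ _ P.
have ifz : (PX \x PY)%E.-integrable setT f.
  apply/integrableP; split => //.
  rewrite -(ge0_joint (f := abse \o f)).
  - by have /integrableP[] := iXY.
  - exact: measurableT_comp.
  - by move=> z; exact: abse_ge0.
have E : (\int[P]_w (X w * Y w)%:E = \int[PX \x PY]_z f z)%E.
  by rewrite -joint integral_pushforward.
have EX : (\int[PX]_x x%:E = \int[P]_w (X w)%:E)%E.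
  by rewrite integral_distribution//; exact: int1.
have EY : (\int[PY]_x x%:E = \int[P]_w (Y w)%:E)%E.
  by rewrite integral_distribution//; exact: int1.
have iX : PX.-integrable setT EFin.
  by apply/integrable_pushforward => //; exact: int1.
have iY : PY.-integrable setT EFin.
  by apply/integrable_pushforward => //; exact: int1.
apply: etrans (congr1 fine E) _.
apply: etrans _ (congr2 *%R (congr1 fine EX) (congr1 fine EY)).
rewrite -integral12_prod_meas1//.
under eq_integral.
  move=> x _; rewrite /fubini_F/f/=.
  under eq_integral do rewrite EFinM.
  rewrite integralZl//.
  over.
rewrite -(@fineK _ (\int[PY]_y y%:E)%E); last exact: integrable_fin_num.
by rewrite integralZr//= fineM//; exact: integrable_fin_num.
Qed.

End joint_law.

Lemma law_ge0_integral X Y (f : R -> \bar R) :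
  measurable_fun setT X -> measurable_fun setT Y ->
  (forall B, measurable B -> P (X @^-1` B) = P (Y @^-1` B)) ->
  measurable_fun setT f -> (forall x, 0 <= f x)%E ->
  (\int[P]_w f (X w) = \int[P]_w f (Y w))%E.
Proof.
move=> mX mY XY mf f0.
rewrite -(ge0_integral_pushforward mX P (D := setT))//.
rewrite -(ge0_integral_pushforward mY P (D := setT))//.
by apply: eq_measure_integral => A mA _; exact: XY.
Qed.

Lemma law_integral X Y :
  measurable_fun setT X -> measurable_fun setT Y ->
  (forall B, measurable B -> P (X @^-1` B) = P (Y @^-1` B)) ->
  \int[P]_w X w = \int[P]_w Y w.
Proof.
move=> mX mY XY; rewrite /Rintegral [in LHS]integralE [in RHS]integralE.
have mp : measurable_fun setT ((EFin : R -> \bar R)^\+)%E.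
  by apply: measurable_funepos; exact: EFin_measurable.
have mn : measurable_fun setT ((EFin : R -> \bar R)^\-)%E.
  by apply: measurable_funeneg; exact: EFin_measurable.
have Ep (Z : T -> R) : (\int[P]_w (fun w => (Z w)%:E)^\+ w =
    \int[P]_w (EFin^\+ (Z w)))%E.
  by apply: eq_integral => w _; rewrite !funeposE.
have En (Z : T -> R) : (\int[P]_w (fun w => (Z w)%:E)^\- w =
    \int[P]_w (EFin^\- (Z w)))%E.
  by apply: eq_integral => w _; rewrite !funenegE.
rewrite !Ep !En (law_ge0_integral mX mY XY mp (funepos_ge0 _)).
by rewrite (law_ge0_integral mX mY XY mn (funeneg_ge0 _)).
Qed.

End independence.

(** * Second moments of one-sided Lévy processes *)

Section borel_sets.
Context {R : realType}.

Lemma borel_preimage {U V : topologicalType} (g : U -> V) (B : set V) :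
  continuous g -> borel B -> borel (g @^-1` B).
Proof.
move=> cg; apply: (smallest_sub (C := sigma_algebra setT)
  (X := [set B | borel (g @^-1` B)])); last first.
  by move=> C oC; apply: sub_sigma_algebra; exact: (open_comp _ oC).
have [b0 bC bU] := smallest_sigma_algebra setT (@open U).
split=> [|C bCc|F bF] /=.
- by rewrite preimage_set0.
- by rewrite setTD preimage_setC -setTD; exact: bC.
- by rewrite preimage_bigcup; exact: bU.
Qed.

Lemma measurable_borel (B : set R) : measurable B -> borel B.
Proof.
move=> mB; have : (@ocitv R).-sigma.-measurable B by [].
move: {mB}B; rewrite RGenOpens.measurableE => B; apply: sub_smallest2r => // _ [x [y ->]].
exact: interval_open.
Qed.

Lemma random_element_measurable {d} {T : measurableType d} {U : topologicalType}
    (X : T -> U) (g : U -> R) :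
  continuous g -> random_element X -> measurable_fun setT (g \o X).
Proof.
move=> cg rX _ B mB; rewrite setTI comp_preimage; apply: rX.
by apply: borel_preimage => //; exact: measurable_borel.
Qed.

End borel_sets.

(** Cauchy's functional equation: the difference h of g and a linear function is
    bounded near the origin and vanishes at the multiples of some 1/N, so it is
    bounded on the half-line, and additivity forces it to be zero. *)
Lemma additive_bounded_linear {R : realType} (g : R -> R) (K e : R) : 0 < e ->
  (forall s t, 0 <= s -> 0 <= t -> g (s + t) = g s + g t) ->
  (forall t, 0 <= t <= e -> `|g t| <= K) ->
  forall t, 0 <= t -> g t = t * g 1.
Proof.
move=> e0 gD gK t t0; pose h t := g t - t * g 1.
have hD (u v : R) : 0 <= u -> 0 <= v -> h (u + v) = h u + h v.
  by move=> u0 v0; rewrite /h gD//; ring.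
have hn n (u : R) : 0 <= u -> h (n%:R * u) = n%:R * h u.
  move=> u0; elim: n => [|n IH].
    rewrite !mul0r; have h00 := hD 0 0 (lexx _) (lexx _).
    by apply: (addrI (h 0)); rewrite addr0 -{1}h00 addr0.
  rewrite -natr1 mulrDl mul1r hD ?mulr_ge0// IH; ring.
have hK (u : R) : 0 <= u <= e -> `|h u| <= K + e * `|g 1|.
  move=> /andP[u0 ue]; rewrite (le_trans (ler_normB _ _))// lerD//.
    by rewrite gK// u0.
  by rewrite normrM (ger0_norm u0) ler_wpM2r.
pose N := (Num.bound e^-1).
have N0 : 0 < N%:R :> R.
  have ei : 0 < e^-1 by rewrite invr_gt0.
  exact: lt_trans ei (archi_boundP (ltW ei)).
have Ne : N%:R^-1 < e.
  by rewrite invf_plt// archi_boundP// invr_ge0 ltW.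
have hN : h N%:R^-1 = 0.
  have : N%:R * h N%:R^-1 = h 1 by rewrite -hn ?invr_ge0 ?ltW// mulfV// gt_eqF.
  rewrite {2}/h mul1r subrr => /eqP; rewrite mulf_eq0 gt_eqF//= => /eqP//.
(* n * t = m / N + r with r small, hence n * h t = h r stays bounded *)
have bnd n : `|n%:R * h t| <= K + e * `|g 1|.
  rewrite -hn//; set x := n%:R * t; have x0 : 0 <= x by rewrite mulr_ge0.
  have xN0 : 0 <= x * N%:R by rewrite mulr_ge0// ltW.
  have /andP[l1 l2] := truncn_itv xN0.
  set m := Num.Def.trunc _ in l1 l2.
  have r0 : 0 <= x - m%:R * N%:R^-1 by rewrite subr_ge0 ler_pdivrMr.
  have -> : x = m%:R * N%:R^-1 + (x - m%:R * N%:R^-1) by ring.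
  rewrite hD// ?hn ?hN ?mulr0 ?add0r ?mulr_ge0 ?invr_ge0//; try exact: ltW.
  apply: hK; rewrite r0/=; apply: ltW; apply: le_lt_trans Ne.
  rewrite lerBlDl -[X in _ <= _ + X]mul1r -mulrDl natr1 ler_pdivlMr//; exact: ltW.
suff : h t = 0 by move=> /eqP; rewrite subr_eq0 => /eqP.
apply/eqP; apply/negPn/negP => h0.
have hp : 0 < `|h t| by rewrite normr_gt0.
have := bnd (Num.bound ((K + e * `|g 1|) / `|h t|)).
rewrite normrM normr_nat -ler_pdivlMr// leNgt => /negP; apply.
apply: archi_boundP; rewrite divr_ge0//.
by rewrite (le_trans _ (bnd 0%N)).
Qed.

Lemma coord_mul_continuous {R : realType} m n (i i' : 'I_m) (j j' : 'I_n) :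
  continuous (fun x : 'M[R]_(m, n) => x i j * x i' j').
Proof.
have c u v : continuous (fun x : 'M[R]_(m, n) => x u v) by exact: coord_continuous.
by move=> x; exact: (continuousM (c i j x) (c i' j' x)).
Qed.

Lemma mx_norm_coord {R : realType} m n (x : 'M[R]_(m, n)) i j :
  `|x i j| <= `|x|.
Proof.
rewrite [leRHS]mx_normrE.
exact: (le_bigmax _ (fun ij : 'I_m * 'I_n => `|x ij.1 ij.2|) (i, j)).
Qed.

Lemma mx_norm_coord_eq {R : realType} m n (x : 'M[R]_(m, n)) :
  `|x| != 0 -> exists i j, `|x| = `|x i j|.
Proof. by move=> /mx_norm_neq0[[i j] E]; exists i, j. Qed.

Section one_sided.
Context {R : realType} {d : measure_display} {T : measurableType d}.
Variables (P : probability T R) (k : nat) (L : R -> T -> 'cV[R]_k).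
Hypothesis HL : one_sided_levy P L.
Hypothesis sq1 : forall i, sqint P (fun w => L 1 w i 0).
Hypothesis mean1 : forall i, \int[P]_w L 1 w i 0 = 0.
Let si := sqint_semi_inner P.

Let inc s t i (w : T) : R := (L t w - L s w) i 0.

Let incE s t i w : inc s t i w = L t w i 0 - L s w i 0.
Proof. by rewrite /inc !mxE. Qed.

Let mL t i : 0 <= t -> measurable_fun setT (fun w => L t w i 0).
Proof.
move=> t0; apply: (@random_element_measurable _ _ _ _ (L t) (fun x => x i 0)).
  exact: coord_continuous.
exact: levy_random HL _ t0.
Qed.

Let minc s t i : 0 <= s -> 0 <= t -> measurable_fun setT (inc s t i).
Proof.
move=> s0 t0; rewrite (_ : inc s t i = fun w => L t w i 0 - L s w i 0).
  by apply: measurable_funB; exact: mL.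
by apply/funext => w; exact: incE.
Qed.

Let inc_indep s t i j : 0 <= s -> s <= t -> indep2 P (inc 0 s i) (inc s t j).
Proof.
move=> s0 st A B mA mB.
pose tt n : R := if n is n'.+1 then if n' is 0%N then s else t else 0.
have tt0 n : tt n <= tt n.+1 by case: n => [|[|n]].
pose C (i0 : 'I_2) : set 'cV[R]_k :=
  if i0 == ord0 then (fun x => x i 0) @^-1` A else (fun x => x j 0) @^-1` B.
have bC i0 : borel (C i0).
  by rewrite /C; case: ifP => _; apply: borel_preimage; try exact: coord_continuous;
    exact: measurable_borel.
have H := levy_independent HL (n := 2) (t := tt) (lexx _) tt0 bC.
apply: (etrans (etrans _ H)); last first.
  by rewrite !big_ord_recl big_ord0 mule1.
congr (P _); apply/seteqP; split => w /=.
  move=> [Aw Bw] i0; case: (unliftP ord0 i0) => [i1|] -> //=.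
  by move: i1 => /= i1; rewrite (ord1 i1).
move=> {}H; split; first exact: (H ord0).
exact: (H (lift ord0 ord0)).
Qed.

Let inc_law s t (g : 'cV[R]_k -> R) : continuous g -> 0 <= s -> 0 <= t ->
  measurable_fun setT (fun w => g (L (s + t) w - L s w)) ->
  measurable_fun setT (fun w => g (L t w - L 0 w)) ->
  \int[P]_w g (L (s + t) w - L s w) = \int[P]_w g (L t w - L 0 w).
Proof.
move=> cg s0 t0 m1 m2; apply: law_integral => // B mB.
apply: (levy_stationary HL s0 t0 (B := g @^-1` B)).
by apply: borel_preimage => //; exact: measurable_borel.
Qed.

Let inc0_ae t i : 0 <= t -> {ae P, forall w, L t w i 0 = inc 0 t i w}.
Proof.
by move=> t0; apply: filterS (levy_start HL) => w; rewrite incE => ->; rewrite mxE subr0.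
Qed.

Let inc0_add s t i : inc 0 t i = inc 0 s i + inc s t i.
Proof. by apply/funext => w; rewrite !fctE !incE [RHS]addrC subrKA. Qed.

Let sq_inc_step s t i : 0 <= s -> 0 <= t -> sqint P (inc 0 s i) ->
  sqint P (inc 0 t i) -> sqint P (inc 0 (s + t) i).
Proof.
move=> s0 t0 ss st; rewrite (inc0_add s); apply: (si_domD si) => //.
have st0 : 0 <= s + t by exact: addr_ge0.
apply: sqintP; first exact: minc.
have [mt it] := st.
have H B : measurable B -> P (inc s (s + t) i @^-1` B) = P (inc 0 t i @^-1` B).
  move=> mB; apply: (levy_stationary HL s0 t0 (B := (fun x => x i 0) @^-1` B)).
  by apply: borel_preimage; [exact: coord_continuous|exact: measurable_borel].
have m2 : measurable_fun setT (fun x : R => (x ^+ 2)%:E).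
  by apply/measurable_EFinP; exact: measurable_funX.
have p2 (x : R) : (0 <= (x ^+ 2)%:E)%E by rewrite lee_fin sqr_ge0.
rewrite (law_ge0_integral (minc i s0 st0) mt H m2 p2).
exact: integrable_lty it.
Qed.

(** Square integrability at time 1 descends to earlier times by independence
    of increments and extends to later ones by stationarity. *)
Let sq_inc t i : 0 <= t -> sqint P (inc 0 t i).
Proof.
have small u : 0 <= u <= 1 -> sqint P (inc 0 u i).
  move=> /andP[u0 u1].
  apply: (indep_sqint_add (minc i (lexx 0) u0) (minc i u0 ler01)).
    exact: inc_indep.
  rewrite -inc0_add.
  have [] // := sqint_ae_eq (sq1 i) (minc i (lexx 0) ler01).
  exact: inc0_ae.
move=> t0; suff H n u : 0 <= u <= n%:R -> sqint P (inc 0 u i).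
  by apply: (H (Num.bound t)); rewrite t0/= ltW// archi_boundP.
elim: n u => [|n IH] u /andP[u0 un]; first by apply: small; rewrite u0 (le_trans un).
have [u1|u1] := leP u 1; first by apply: small; rewrite u0.
rewrite -(subrK 1 u); apply: sq_inc_step => //; first by rewrite subr_ge0 ltW.
- by apply: IH; rewrite subr_ge0 (ltW u1)/= lerBlDr natr1.
- by apply: small; rewrite ler01 lexx.
Qed.

Let sq_incs s t i : 0 <= s -> s <= t -> sqint P (inc s t i).
Proof.
move=> s0 st; rewrite -[inc s t i](addKr (inc 0 s i)) -inc0_add addrC.
by apply: (si_domB si); apply: sq_inc => //; exact: le_trans st.
Qed.

Let mean t i := \int[P]_w inc 0 t i w.
Let cov t i j := ip P (inc 0 t i) (inc 0 t j).

Let mean_add s t i : 0 <= s -> 0 <= t -> mean (s + t) i = mean s i + mean t i.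
Proof.
move=> s0 t0; have st0 : s <= s + t by rewrite lerDl.
have st1 := addr_ge0 s0 t0.
have -> : mean t i = \int[P]_w inc s (s + t) i w.
  apply/esym; apply: (inc_law (g := fun x => x i 0)) => //.
  - exact: coord_continuous.
  - exact: minc.
  - exact: minc.
rewrite /mean -RintegralD//.
- by apply: eq_Rintegral => w _; rewrite (inc0_add s).
- by apply: sqint_integrable; exact: sq_inc.
- by apply: sqint_integrable; exact: sq_incs.
Qed.

Let cov_add s t i j : 0 <= s -> 0 <= t ->
  cov (s + t) i j = cov s i j + cov t i j + mean s i * mean t j + mean t i * mean s j.
Proof.
move=> s0 t0; have st0 : s <= s + t by rewrite lerDl.
have st1 := addr_ge0 s0 t0.
have mt l : mean t l = \int[P]_w inc s (s + t) l w.
  apply/esym; apply: (inc_law (g := fun x => x l 0)) => //.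
  - exact: coord_continuous.
  - exact: minc.
  - exact: minc.
have ct : cov t i j = ip P (inc s (s + t) i) (inc s (s + t) j).
  apply/esym; apply: (inc_law (g := fun x => x i 0 * x j 0)) => //.
  - exact: coord_mul_continuous.
  - by apply: measurable_funM; exact: minc.
  - by apply: measurable_funM; exact: minc.
have cross l m : ip P (inc 0 s l) (inc s (s + t) m) = mean s l * mean t m.
  rewrite mt; apply: indep_expectM; [exact: minc|exact: minc|exact: inc_indep| |].
    exact: sq_inc.
  exact: sq_incs.
have S1 l := sq_inc l s0; have S2 l := sq_incs l s0 st0.
rewrite ct -cross [mean t i * _]mulrC -cross /cov !(inc0_add s (s + t)).
exact: (si_DD si (S1 i) (S2 i) (S1 j) (S2 j)).
Qed.

Let mean1_0 i : mean 1 i = 0.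
Proof.
rewrite -(mean1 i) /mean /Rintegral; congr fine.
apply: ae_eq_integral => //; try (by apply/measurable_EFinP; exact: minc || exact: mL).
by apply: filterS (inc0_ae i ler01) => w + _ => ->.
Qed.

(** A deterministic drift could be a wild solution of Cauchy's equation; it is
    bounded near 0 because the increment is small in probability there while
    its variance is bounded. *)
Let mean0 t i : 0 <= t -> mean t i = 0.
Proof.
pose var u := cov u i i - mean u i ^+ 2.
have varE u : 0 <= u -> var u = ip P (inc 0 u i - cst (mean u i)) (inc 0 u i - cst (mean u i)).
  move=> u0; have su := sq_inc i u0; have sc := sqint_cst P (mean u i).
  rewrite (si_sqrB si)// /var /cov.
  have -> : ip P (inc 0 u i) (cst (mean u i)) = mean u i * mean u i.
    rewrite /ip; under eq_Rintegral do rewrite mulrC.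
    by rewrite RintegralZl//; exact: sqint_integrable.
  have -> : ip P (cst (mean u i)) (cst (mean u i)) = mean u i * mean u i.
    apply: etrans (Rintegral_cst P measurableT (mean u i * mean u i)) _.
    by rewrite [X in _ * fine X](_ : _ = 1%E) ?mulr1//; exact: probability_setT.
  by ring.
have var0 u : 0 <= u -> 0 <= var u.
  move=> u0; rewrite varE//; apply: (si_ge0 si); apply: (si_domB si).
    exact: sq_inc.
  exact: sqint_cst.
have varD u v : 0 <= u -> 0 <= v -> var (u + v) = var u + var v.
  by move=> u0 v0; rewrite /var cov_add// mean_add//; ring.
have var1 u : 0 <= u <= 1 -> var u <= var 1.
  move=> /andP[u0 u1]; rewrite -[X in _ <= var X](subrK u 1) varD// ?subr_ge0//.
  by rewrite lerDr var0// subr_ge0.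
(* probability at least 1/2 that the increment is at most 1 in absolute value *)
have [e e0 He] : exists2 e, 0 < e & forall u, 0 <= u <= e ->
    u <= 1 /\ (2^-1%:E <= P [set w | (`|inc 0 u i w| <= 1)%R])%E.
  have lt2 : nbhs 0%E [set x : \bar R | (x < 2^-1%:E)%E].
    by apply: open_nbhs_nbhs; split; [exact: open_ereal_lt_ereal|rewrite /= lte_fin].
  have /nbhs_ballP[r /= r0 Hr] := levy_stoch_continuous HL (lexx 0) ltr01 lt2.
  exists (Num.min (r / 2) 1) => [|u /andP[u0]]; first by rewrite lt_min ltr01 divr_gt0.
  rewrite le_min => /andP[ur u1]; split => //.
  have /Hr : ball (0 : R) r u by rewrite /ball/= sub0r normrN ger0_norm//; lra.
  rewrite /= in_itv/= u0 => /(_ isT); set D := [set w | _] => PD.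
  have mabs l : measurable_fun setT (fun w => `|inc 0 u l w|).
    by apply: measurableT_comp => //; exact: minc.
  have mlt l : measurable [set w | 1 < `|inc 0 u l w|].
    rewrite -[[set w | _]]setTI.
    have := mabs l measurableT `]1, +oo[%classic (measurable_itv _).
    by congr measurable; apply/seteqP; split => w /=; rewrite in_itv/= andbT.
  have DE : D = \bigcup_(l in [set: 'I_k]) [set w | 1 < `|inc 0 u l w|].
    apply/seteqP; split => w /=; last first.
      by move=> [l _ /= l1]; apply: (lt_le_trans l1); exact: mx_norm_coord.
    move=> w1; have [|l [j E]] := @mx_norm_coord_eq R _ _ (L u w - L 0 w).
      by rewrite gt_eqF// (lt_trans ltr01).
    by exists l => //=; rewrite /inc -(ord1 j) -E.
  have mD : measurable D by rewrite DE; exact: fin_bigcup_measurable.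
  have sub : ~` D `<=` [set w | `|inc 0 u i w| <= 1].
    by rewrite DE => w /= H; rewrite leNgt; apply/negP => H1; apply: H; exists i.
  have mle : measurable [set w | `|inc 0 u i w| <= 1].
    rewrite (_ : [set w | _] = ~` [set w | 1 < `|inc 0 u i w|]).
      exact: measurableC.
    by apply/seteqP; split => w /=; rewrite leNgt => /negP.
  apply: (@le_trans _ _ (P (~` D))); last first.
    by apply: le_measure => //; rewrite inE//; exact: measurableC.
  rewrite probability_setC// leeBrDr//; last first.
    by rewrite ge0_fin_numE// (lt_trans PD)// ltry.
  apply: (@le_trans _ _ (2^-1%:E + 2^-1%:E)%E).
    by rewrite leeD2l// ltW.
  by rewrite -EFinD lee_fin; lra.
have e01 : 0 <= e by exact: ltW.
suff bnd u : 0 <= u <= e -> `|mean u i| <= 1 + (1 + 2 * var 1).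
  move=> t0; rewrite (additive_bounded_linear e0 _ bnd t0) ?mean1_0 ?mulr0// => s' t'.
  exact: mean_add.
move=> /[dup] ue /He[u1 PB]; set B := [set w | _] in PB.
have u0 : 0 <= u by case/andP: ue.
have v0 := var0 1 ler01.
have [M1|M1] := leP `|mean u i| 1; first by rewrite (le_trans M1)// lerDl addr_ge0// mulr_ge0.
have mi : measurable_fun setT (inc 0 u i) by exact: minc.
have mB : measurable B.
  rewrite -[B]setTI.
  have mab : measurable_fun setT (fun w => `|inc 0 u i w|) by exact: measurableT_comp.
  have := mab measurableT `]-oo, 1]%classic (measurable_itv _).
  by congr measurable; apply/seteqP; split => w /=; rewrite in_itv.
pose c := (`|mean u i| - 1) ^+ 2.
have : (c%:E * P B <= (var 1)%:E)%E.
  apply: (@le_trans _ _ (var u)%:E); last by rewrite lee_fin var1// u0.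
  have sq : sqint P (inc 0 u i - cst (mean u i)).
    by apply: (si_domB si); [exact: sq_inc|exact: sqint_cst].
  rewrite varE// -integral_sqrE//.
  rewrite -(integral_cst P mB c%:E).
  have mq : measurable_fun setT (fun w => ((inc 0 u i - cst (mean u i)) w ^+ 2)%:E).
    by apply/measurable_EFinP; apply: measurable_funX; case: sq.
  have q0 w : (0 <= ((inc 0 u i - cst (mean u i)) w ^+ 2)%:E)%E by rewrite lee_fin sqr_ge0.
  apply: (@le_trans _ _
      (\int[P]_(w in B) ((inc 0 u i - cst (mean u i)) w ^+ 2)%:E)%E); last first.
    exact: ge0_subset_integral.
  apply: ge0_le_integral => //.
  - by move=> w _; rewrite lee_fin sqr_ge0.
  - exact: measurable_funTS.
  move=> w; rewrite /B/= => xw; rewrite lee_fin !fctE /c.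
  rewrite -[leRHS]real_normK ?num_real// ler_sqr ?nnegrE//; last by rewrite subr_ge0 ltW.
  rewrite distrC; apply: le_trans (lerB_dist _ _); lra.
move=> H; have : (c%:E * 2^-1%:E <= (var 1)%:E)%E.
  by apply: le_trans H; rewrite lee_wpmul2l// lee_fin sqr_ge0.
rewrite -EFinM lee_fin /c; set m := `|_| in M1 *.
have := sqr_ge0 (m - 2); rewrite !sqrrB; nra.
Qed.

Let cov_linear t i j : 0 <= t -> cov t i j = t * cov 1 i j.
Proof.
move=> t0.
have covD u v l m : 0 <= u -> 0 <= v -> cov (u + v) l m = cov u l m + cov v l m.
  by move=> u0 v0; rewrite cov_add// !mean0// !mulr0 !addr0.
have diag0 u l : 0 <= u -> 0 <= cov u l l.
  by move=> u0; apply: (si_ge0 si); exact: sq_inc.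
have diag1 u l : 0 <= u <= 1 -> cov u l l <= cov 1 l l.
  move=> /andP[u0 u1]; rewrite -[X in _ <= cov X _ _](subrK u 1) covD// ?subr_ge0//.
  by rewrite lerDr diag0// subr_ge0.
apply: (additive_bounded_linear (g := fun u => cov u i j)
  (K := cov 1 i i + cov 1 j j) ltr01 _ _ t0) => [u v|].
  exact: covD.
move=> u /[dup] u01 /andP[u0 _]; have := diag1 u i u01; have := diag1 u j u01.
have si1 := sq_inc i u0; have sj1 := sq_inc j u0.
have := si_ge0 si (si_domD si si1 sj1); have := si_ge0 si (si_domB si si1 sj1).
rewrite (si_sqrD si si1 sj1) (si_sqrB si si1 sj1).
rewrite -/(cov u i i) -/(cov u i j) -/(cov u j j).
have := diag0 u i u0; have := diag0 u j u0.
by rewrite ler_norml => *; apply/andP; split; lra.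
Qed.

Lemma levy_sqint t i : 0 <= t -> sqint P (fun w => L t w i 0).
Proof.
move=> t0; have [|//] := sqint_ae_eq (sq_inc i t0) (mL i t0).
by apply: filterS (inc0_ae i t0) => w ->.
Qed.

Lemma levy_mean t i : 0 <= t -> \int[P]_w L t w i 0 = 0.
Proof.
move=> t0; rewrite -(mean0 i t0) /mean /Rintegral; congr fine.
apply: ae_eq_integral => //.
- by apply/measurable_EFinP; exact: mL.
- by apply/measurable_EFinP; exact: minc.
- by apply: filterS (inc0_ae i t0) => w + _ => ->.
Qed.

Let ip_inc s t i j : 0 <= s -> 0 <= t ->
  ip P (fun w => L s w i 0) (fun w => L t w j 0) = ip P (inc 0 s i) (inc 0 t j).
Proof.
move=> s0 t0.
have ae u l : 0 <= u -> {ae P, forall w, inc 0 u l w = L u w l 0}.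
  by move=> u0; apply: filterS (inc0_ae l u0) => w ->.
rewrite (ip_ae_eql (sq_inc i s0) (levy_sqint j t0) (mL i s0) (ae _ _ s0)).
rewrite (si_C si (sq_inc i s0) (levy_sqint j t0)).
rewrite (ip_ae_eql (sq_inc j t0) (sq_inc i s0) (mL j t0) (ae _ _ t0)).
by rewrite (si_C si (sq_inc i s0) (sq_inc j t0)).
Qed.

(** Increments over disjoint intervals are orthogonal, and the covariance at one
    time is additive, hence linear, in time. *)
Lemma levy_covariance s t i j : 0 <= s -> 0 <= t ->
  ip P (fun w => L s w i 0) (fun w => L t w j 0) =
  Num.min s t * ip P (fun w => L 1 w i 0) (fun w => L 1 w j 0).
Proof.
have le u v l m : 0 <= u -> u <= v ->
    ip P (inc 0 u l) (inc 0 v m) = u * cov 1 l m.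
  move=> u0 uv; rewrite (inc0_add u v) (si_Dr si); try exact: sq_inc; last first.
    exact: sq_incs.
  rewrite -[X in X + _]/(cov u l m) (cov_linear l m u0) -[RHS]addr0.
  congr (_ + _); apply: etrans (indep_expectM (minc l (lexx 0) u0) (minc m u0 (le_trans u0 uv))
    (inc_indep _ _ u0 uv) (sq_inc _ u0) (sq_incs _ u0 uv)) _.
  by rewrite -/(mean u l) mean0// mul0r.
move=> s0 t0; rewrite !ip_inc//.
have [st|/ltW ts] := leP s t; first exact: le.
by rewrite (si_C si (sq_inc i s0) (sq_inc j t0)) le// (si_C si (sq_inc i ler01) (sq_inc j ler01)).
Qed.

End one_sided.

(** * Two-sided Lévy processes: covariances as integrals *)

Section chi.
Context {R : realType}.

(** Signed indicator of the interval between 0 and t, so that the indicator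
    of the interval from s to t is a difference, like an increment. *)
Definition chi (t : R) : R -> R :=
  if 0 <= t then \1_`]0, t] else - \1_`]t, 0].

Lemma chi_sqint t : sqint lebesgue_measure (chi t).
Proof.
rewrite /chi; case: ifP => _.
  by apply: sqint_indic => //=; rewrite lebesgue_measure_itv/=; case: ifP; rewrite ?ltry.
apply: (si_domN (sqint_semi_inner _)); apply: sqint_indic => //=.
by rewrite lebesgue_measure_itv/=; case: ifP; rewrite ?ltry.
Qed.

Lemma chiB s t u : s <= t -> chi t u - chi s u = (s < u <= t)%R%:R.
Proof.
move=> st; rewrite /chi; case: (leP 0 t) => t0; case: (leP 0 s) => s0;
  rewrite ?fctE ?opprK !indicE !mem_setE !in_itv/=.
- case: (ltP 0 u) => u0/=; case: (leP u t) => ut/=; case: (leP u s) => us/=;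
    case: (ltP s u) => su/=; rewrite ?subr0 ?subrr//; lra.
- case: (ltP 0 u) => u0/=; case: (leP u t) => ut/=; case: (leP u 0) => us/=;
    case: (ltP s u) => su/=; rewrite ?addr0 ?add0r ?subrr//; lra.
- lra.
- case: (ltP t u) => u0/=; case: (leP u t) => ut/=; case: (leP u 0) => us/=;
    case: (ltP s u) => su/=; rewrite ?addr0 ?add0r ?subrr ?oppr0 ?addNr//; lra.
Qed.

Let fine_itv (a b : R) : a <= b ->
  fine (@lebesgue_measure R `]a, b]%classic) = b - a.
Proof.
move=> ab; apply: etrans (congr1 fine (lebesgue_measure_itv `]a, b])) _ => /=.
rewrite lte_fin; case: ltP => // ba.
by rewrite (@le_anti _ _ a b) ?ab ?subrr.
Qed.

Lemma ip_chi_pos s t : 0 <= s -> 0 <= t ->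
  ip lebesgue_measure (chi s) (chi t) = Num.min s t.
Proof.
move=> s0 t0; rewrite /chi s0 t0 ip_indic//.
rewrite (_ : _ `&` _ = `]0, Num.min s t]%classic); last first.
  by apply/seteqP; split => u /=; rewrite !in_itv/= le_min;
     [move=> [/andP[-> ->] /andP[]]|move=> /and3P[-> -> ->]].
by apply: etrans (fine_itv _) _; rewrite ?subr0// le_min s0 t0.
Qed.

Lemma ip_chi_neg s t : s < 0 -> t < 0 ->
  ip lebesgue_measure (chi s) (chi t) = Num.min (- s) (- t).
Proof.
move=> s0 t0; have si := sqint_semi_inner (@lebesgue_measure R).
have sq u : u < 0 -> sqint lebesgue_measure (\1_`]u, 0] : R -> R).
  move=> u0; apply: sqint_indic => //=.
  by rewrite lebesgue_measure_itv/=; case: ifP; rewrite ?ltry.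
rewrite /chi !leNgt s0 t0/= (si_Nl si)//; try exact: sq; last by apply: (si_domN si); exact: sq.
rewrite (si_Nr si) ?opprK//; try exact: sq.
rewrite ip_indic//.
rewrite (_ : _ `&` _ = `]Num.max s t, 0]%classic); last first.
  by apply/seteqP; split => u /=; rewrite !in_itv/= gt_max;
     [move=> [/andP[-> ->] /andP[->]]|move=> /andP[/andP[-> ->] ->]].
by apply: etrans (fine_itv _) _; rewrite ?sub0r ?oppr_max// ge_max !ltW.
Qed.

Lemma ip_dchi s t :
  ip lebesgue_measure (chi t - chi s) (chi t - chi s) = `|t - s|.
Proof.
have pos a b : a <= b ->
    ip lebesgue_measure (chi b - chi a) (chi b - chi a) = b - a.
  move=> ab; have -> : chi b - chi a = \1_`]a, b].
    apply/funext => u; rewrite -[LHS]/(chi b u - chi a u) chiB//.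
    by rewrite indicE mem_setE in_itv.
  by rewrite ip_indic// setIid; apply: etrans (fine_itv ab) _.
have [st|/ltW ts] := leP s t; first by rewrite pos// ger0_norm// subr_ge0.
rewrite (si_sqr_distC (sqint_semi_inner _) (chi_sqint t) (chi_sqint s)) pos//.
by rewrite distrC ger0_norm// subr_ge0.
Qed.

Lemma ip_chi_opp s t : s < 0 -> 0 <= t ->
  ip lebesgue_measure (chi s) (chi t) = 0.
Proof.
move=> s0 t0; rewrite /ip (_ : (fun u => _) = cst 0).
  by rewrite /Rintegral integral0_eq.
apply/funext => u; rewrite /chi t0 leNgt s0/= !fctE !indicE !mem_setE !in_itv/=.
by case: (ltP 0 u); rewrite ?andbF ?oppr0 ?mul0r ?mulr0.
Qed.

End chi.

Section two_sided.
Context {R : realType} {d : measure_display} {T : measurableType d}.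
Variables (P : probability T R) (k : nat) (L : R -> T -> 'cV[R]_k).
Hypothesis HL : driving_levy P L.
Let si := sqint_semi_inner P.
Let X t i (w : T) : R := L t w i 0.

Let mX t i : measurable_fun setT (X t i).
Proof.
apply: (@random_element_measurable _ _ _ _ (L t) (fun x => x i 0)).
  exact: coord_continuous.
by have [] := driving_two_sided HL.
Qed.

Let sqX1 i : sqint P (X 1 i).
Proof.
apply: sqintP => //; have := driving_square_integrable HL; rewrite unlock.
apply: le_lt_trans; apply: ge0_le_integral => //.
- by move=> w _; rewrite lee_fin sqr_ge0.
- by apply/measurable_EFinP; exact: measurable_funX.
- apply/measurable_EFinP; apply: measurable_sum => j.
  by apply: measurable_funX; exact: mX.
- move=> w _; rewrite lee_fin (bigD1 i)//= lerDl.
  by apply: sumr_ge0 => j _; exact: sqr_ge0.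
Qed.

Let meanX1 i : \int[P]_w X 1 i w = 0.
Proof.
by have := driving_centered HL i; rewrite unlock /Rintegral => ->.
Qed.

Let same_marginal (L1 L2 : R -> T -> 'cV[R]_k) t (f : 'cV[R]_k -> R)
    (g : 'M[R]_(1, k) -> R) : same_fdd P L1 L2 -> 0 <= t -> continuous g ->
  (forall x, f x = g x^T) -> forall B, measurable B ->
  P ((fun w => f (L1 t w)) @^-1` B) = P ((fun w => f (L2 t w)) @^-1` B).
Proof.
move=> fdd t0 cg fg B mB.
have bB : borel (g @^-1` B).
  by apply: borel_preimage => //; exact: measurable_borel.
have E (L' : R -> T -> 'cV[R]_k) : (fun w => f (L' t w)) @^-1` B =
    (fun w => \matrix_(i < 1, j < k) L' t w j 0) @^-1` (g @^-1` B).
  apply/seteqP; split => w /=; rewrite fg;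
    by rewrite (_ : (L' t w)^T = \matrix_(i < 1, j < k) L' t w j 0)//;
      apply/rowP => j; rewrite !mxE.
by rewrite !E; exact: (fdd 1%N (fun=> t) (fun=> t0) _ bB).
Qed.

(** For times of the same sign this is the covariance formula of a one-sided
    process; for opposite signs both sides vanish, the left one because the two
    halves of the process are independent and centered. *)
Lemma levy_isometry s t i j :
  [/\ sqint P (X s i), sqint P (X t j) &
   ip P (X s i) (X t j) =
     levy_cov P L i j * ip lebesgue_measure (chi s) (chi t)].
Proof.
have [L1 [L2 [HL1 HL2 fdd indep ae]]] := (driving_two_sided HL).2.
have m1 u l : 0 <= u -> measurable_fun setT (fun w => L1 u w l 0).
  move=> u0; apply: (@random_element_measurable _ _ _ _ (L1 u) (fun x => x l 0)).
    exact: coord_continuous.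
  exact: levy_random HL1 _ u0.
have m2 u l : 0 <= u -> measurable_fun setT (fun w => L2 u w l 0).
  move=> u0; apply: (@random_element_measurable _ _ _ _ (L2 u) (fun x => x l 0)).
    exact: coord_continuous.
  exact: levy_random HL2 _ u0.
have ae1 u l : 0 <= u -> {ae P, forall w, X u l w = L1 u w l 0}.
  by move=> u0; apply: filterS ae => w [+ _] => /(_ u u0); rewrite /X => ->.
have sq1 l : sqint P (fun w => L1 1 w l 0).
  by have [] := sqint_ae_eq (sqX1 l) (m1 _ _ ler01) (ae1 _ _ ler01).
have mean1 l : \int[P]_w L1 1 w l 0 = 0.
  rewrite -(meanX1 l) /Rintegral; congr fine; apply: ae_eq_integral => //.
  - by apply/measurable_EFinP; exact: m1.
  - by apply/measurable_EFinP; exact: mX.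
  - by apply: filterS (ae1 1 l ler01) => w + _ => ->.
have law l : forall B, measurable B -> P ((fun w => L1 1 w l 0) @^-1` B) =
    P ((fun w => L2 1 w l 0) @^-1` B).
  apply: (@same_marginal L1 L2 1 (fun x => x l 0) (fun x => x 0 l) fdd ler01).
    exact: coord_continuous.
  by move=> x; rewrite mxE.
have sq2 l : sqint P (fun w => L2 1 w l 0).
  apply: sqintP; first exact: m2.
  have msq : measurable_fun setT (fun x : R => (x ^+ 2)%:E).
    by apply/measurable_EFinP; exact: measurable_funX.
  have sq0 (x : R) : (0 <= (x ^+ 2)%:E)%E by rewrite lee_fin sqr_ge0.
  rewrite -(law_ge0_integral (m1 _ l ler01) (m2 _ l ler01) (law l) msq sq0).
  by have [_ /integrable_lty] := sq1 l; apply.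
have mean2 l : \int[P]_w L2 1 w l 0 = 0.
  by rewrite -(law_integral (m1 _ l ler01) (m2 _ l ler01) (law l)).
pose V l m := ip P (fun w => L2 1 w l 0) (fun w => L2 1 w m 0).
have V1 l m : ip P (fun w => L1 1 w l 0) (fun w => L1 1 w m 0) = V l m.
  apply: (law_integral (X := fun w => L1 1 w l 0 * L1 1 w m 0)
    (Y := fun w => L2 1 w l 0 * L2 1 w m 0)).
  - by apply: measurable_funM; exact: m1.
  - by apply: measurable_funM; exact: m2.
  apply: (@same_marginal L1 L2 1 (fun x => x l 0 * x m 0)
    (fun x => x 0 l * x 0 m) fdd ler01); first exact: coord_mul_continuous.
  by move=> x; rewrite !mxE.
have Vcov l m : levy_cov P L l m = V l m.
  rewrite mxE unlock -V1.
  rewrite (ip_ae_eql (sqX1 l) (sq1 m) (m1 _ l ler01) (ae1 _ _ ler01)).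
  rewrite (si_C si (sqX1 l) (sq1 m)).
  rewrite (ip_ae_eql (sqX1 m) (sqX1 l) (m1 _ m ler01) (ae1 _ _ ler01)).
  by rewrite (si_C si (sqX1 m) (sqX1 l)).
pose Y1 u l (w : T) : R := L1 u w l 0.
pose Y2 u l (w : T) : R := L2 u w l 0.
have S1 u l : 0 <= u -> sqint P (Y1 u l) by exact: levy_sqint.
have S2 u l : 0 <= u -> sqint P (Y2 u l) by exact: levy_sqint.
have C1 u v l m : 0 <= u -> 0 <= v -> ip P (Y1 u l) (Y1 v m) = Num.min u v * V l m.
  by move=> u0 v0; rewrite -V1; exact: levy_covariance.
have C2 u v l m : 0 <= u -> 0 <= v -> ip P (Y2 u l) (Y2 v m) = Num.min u v * V l m.
  by move=> u0 v0; exact: levy_covariance.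
have C12 u v l m : 0 <= u -> 0 <= v -> ip P (Y1 u l) (Y2 v m) = 0.
  move=> u0 v0; apply: etrans (indep_expectM (m1 _ _ u0) (m2 _ _ v0) _ (S1 _ _ u0) (S2 _ _ v0)) _.
    move=> B C mB mC; apply: indep; apply: sub_sigma_algebra.
      exists u, ((fun x : 'cV[R]_k => x l 0) @^-1` B); split=> //.
      by apply: borel_preimage; [exact: coord_continuous|exact: measurable_borel].
    exists v, ((fun x : 'cV[R]_k => x m 0) @^-1` C); split=> //.
    by apply: borel_preimage; [exact: coord_continuous|exact: measurable_borel].
  by rewrite (levy_mean HL1 sq1 mean1)// mul0r.
(* the left limit defining L at a negative time is also the mean-square limit,
   by the covariance formula *)
have ae2 u l : u < 0 -> {ae P, forall w, X u l w = - Y2 (- u) l w}.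
  move=> u0; have r0 : 0 < - u by rewrite oppr_gt0.
  pose s_ (n : nat) := - u - (- u) / n.+1%:R.
  have s0 n : 0 <= s_ n.
    by rewrite /s_ subr_ge0 ler_pdivrMr// ler_peMr ?ler1n// ltW.
  have slt n : s_ n < - u by rewrite /s_ ltrBlDr ltrDl divr_gt0.
  have scvg : s_ n @[n --> \oo] --> - u.
    rewrite -[X in _ --> X]subr0 -[X in _ - X](mulr0 (- u)).
    apply: cvgB; first exact: cvg_cst.
    by apply: cvgMr; exact: cvg_harmonic.
  have Sr := S2 (- u) l (ltW r0).
  pose g := Y2 (- u) l + X u l.
  have mg : measurable_fun setT g.
    by apply: measurable_funD => //; exact: m2 (ltW r0).
  have V0 : 0 <= V l l by exact: (si_ge0 si (sq2 l)).
  have bnd N : (\int[P]_w (g w ^+ 2)%:E <= ((- u) / N.+1%:R * V l l)%:E)%E.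
    pose h n := Y2 (- u) l - Y2 (s_ (n + N)%N) l.
    apply: (@fatou_sqr _ _ _ P h).
    - by move=> n; apply: measurable_funB; [exact: m2 (ltW r0)|exact: m2 (s0 _)].
    - exact: mg.
    - apply: filterS ae => w [_ /(_ u u0) lw].
      have : L2 s w l 0 @[s --> (- u)^'-] --> (- L u w) l 0.
        by apply: (cvg_comp _ (fun x : 'cV[R]_k => x l 0) lw); exact: coord_continuous.
      rewrite mxE => /cvg_at_leftP/(_ (fun n => s_ (n + N)%N)) lim.
      have {lim}lim : L2 (s_ (n + N)%N) w l 0 @[n --> \oo] --> - L u w l 0.
        apply: lim; split; first by move=> n; exact: slt.
        by rewrite (cvg_shiftn N s_).
      rewrite /g /h !fctE -[X in _ + X]opprK.
      by apply: cvgB; [exact: cvg_cst|exact: lim].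
    - move=> n; have Sn := S2 (s_ (n + N)%N) l (s0 _).
      rewrite (integral_sqrE (si_domB si Sr Sn)) lee_fin (si_sqrB si Sr Sn).
      rewrite (C2 _ _ _ _ (ltW r0) (ltW r0)) (C2 _ _ _ _ (ltW r0) (s0 _)) (C2 _ _ _ _ (s0 _) (s0 _)).
      rewrite !minxx (min_idPr (ltW (slt _))).
      have -> : - u * V l l - 2 * (s_ (n + N)%N * V l l) + s_ (n + N)%N * V l l =
        (- u) / (n + N).+1%:R * V l l by rewrite /s_; ring.
      rewrite ler_wpM2r// ler_wpM2l// ?(ltW r0)//.
      by rewrite lef_pV2 ?posrE// ler_nat ltnS leq_addl.
  have sg : sqint P g by apply: sqintP => //; exact: le_lt_trans (bnd 0%N) (ltry _).
  have g0 : ip P g g = 0.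
    apply/eqP; rewrite eq_le (si_ge0 si sg) andbT.
    have c : ((- u) * V l l * n.+1%:R^-1) @[n --> \oo] --> ((- u) * V l l * 0 : R).
      by apply: cvgMr; exact: cvg_harmonic.
    rewrite mulr0 in c; rewrite leNgt; apply/negP => q0.
    have [n _ /(_ n (leqnn _))/=] := cvgr_lt _ c _ q0.
    rewrite ltNge => /negP; apply.
    by have := bnd n; rewrite (integral_sqrE sg) lee_fin mulrAC.
  apply: filterS (ip0_ae sg g0) => w; rewrite /g fctE => /eqP.
  by rewrite addrC addr_eq0 => /eqP.
pose Z u l := if 0 <= u then Y1 u l else - Y2 (- u) l.
have aeZ u l : {ae P, forall w, X u l w = Z u l w}.
  by rewrite /Z; case: leP => u0; [exact: ae1|exact: ae2].
have sZ u l : sqint P (Z u l).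
  rewrite /Z; case: leP => u0; first exact: S1.
  by apply: (si_domN si); apply: S2; rewrite oppr_ge0 ltW.
have aeZ' u l : {ae P, forall w, Z u l w = X u l w}.
  by apply: filterS (aeZ u l) => w ->.
have sX u l : sqint P (X u l).
  by have [] := sqint_ae_eq (sZ u l) (mX u l) (aeZ' u l).
split => //.
rewrite (ip_ae_eql (sZ s i) (sX t j) (mX s i) (aeZ' s i)).
rewrite (si_C si (sZ s i) (sX t j)).
rewrite (ip_ae_eql (sZ t j) (sZ s i) (mX t j) (aeZ' t j)).
rewrite (si_C si (sZ t j) (sZ s i)) Vcov mulrC /Z.
case: leP => s0; case: leP => t0.
- by rewrite C1// ip_chi_pos.
- have t1 : 0 <= - t by rewrite oppr_ge0 ltW.
  rewrite (si_Nr si (S1 _ _ s0) (S2 _ _ t1)) C12// oppr0.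
  by rewrite (si_C (sqint_semi_inner _) (chi_sqint s) (chi_sqint t)) ip_chi_opp// mul0r.
- have s1 : 0 <= - s by rewrite oppr_ge0 ltW.
  rewrite (si_Nl si (S2 _ _ s1) (S1 _ _ t0)) (si_C si (S2 _ _ s1) (S1 _ _ t0)).
  by rewrite C12// oppr0 ip_chi_opp// mul0r.
- have s1 : 0 <= - s by rewrite oppr_ge0 ltW.
  have t1 : 0 <= - t by rewrite oppr_ge0 ltW.
  rewrite (si_Nl si (S2 _ _ s1) (si_domN si (S2 _ _ t1))).
  by rewrite (si_Nr si (S2 _ _ s1) (S2 _ _ t1)) opprK C2// ip_chi_neg.
Qed.

End two_sided.

(** * The isometry of the stochastic integral *)

Section ms_cvg_components.
Context {R : realType} {d : measure_display} {T : measurableType d}.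
Variable mu : {measure set T -> \bar R}.

Lemma cvg_components (I : finType) (h : nat -> I -> T -> R) :
  (forall n i, measurable_fun setT (h n i)) ->
  (\int[mu]_x (\sum_i h n i x ^+ 2)%:E)%E @[n --> \oo] --> 0%E ->
  forall i, (\forall n \near \oo, sqint mu (h n i)) /\
    ip mu (h n i) (h n i) @[n --> \oo] --> 0.
Proof.
move=> mh h0 i.
have le n : (\int[mu]_x (h n i x ^+ 2)%:E <= \int[mu]_x (\sum_i h n i x ^+ 2)%:E)%E.
  apply: ge0_le_integral => //.
  - by move=> x _; rewrite lee_fin sqr_ge0.
  - by apply/measurable_EFinP; exact: measurable_funX.
  - by apply/measurable_EFinP; apply: measurable_sum => j; exact: measurable_funX.
  - move=> x _; rewrite lee_fin (bigD1 i)//= lerDl.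
    by apply: sumr_ge0 => j _; exact: sqr_ge0.
have fin : \forall n \near \oo, (\int[mu]_x (\sum_i h n i x ^+ 2)%:E < +oo)%E.
  suff : \forall n \near \oo, (\int[mu]_x (\sum_i h n i x ^+ 2)%:E < 1%:E)%E.
    by apply: filterS => n /lt_trans; apply; rewrite ltry.
  have lt1 : nbhs 0%E [set x : \bar R | (x < 1%:E)%E].
    by apply: open_nbhs_nbhs; split; [exact: open_ereal_lt_ereal|rewrite /= lte_fin].
  exact: (h0 _ lt1).
have sq : \forall n \near \oo, sqint mu (h n i).
  by apply: filterS fin => n fn; apply: sqintP => //; exact: le_lt_trans (le n) fn.
split => //.
have /fine_cvg := h0 => c0.
apply: (@squeeze_cvgr _ _ _ _ (fun=> 0)
  (fun n => fine (\int[mu]_x (\sum_i h n i x ^+ 2)%:E)%E)) => //; last exact: cvg_cst.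
near=> n.
have sn : sqint mu (h n i) by near: n.
rewrite (si_ge0 (sqint_semi_inner _))//= -lee_fin -integral_sqrE// fineK//.
rewrite ge0_fin_numE; first by near: n.
by apply: integral_ge0 => x _; rewrite lee_fin; apply: sumr_ge0 => j _; exact: sqr_ge0.
Unshelve. all: by end_near. Qed.

Lemma sqint_ms_limit (x : nat -> T -> R) (y : T -> R) :
  (forall n, sqint mu (x n)) -> (\forall n \near \oo, sqint mu (x n - y)) ->
  sqint mu y.
Proof.
move=> sx [n _ /(_ n (leqnn _)) sxy].
by rewrite -(subKr (x n) y); exact: (si_domB (sqint_semi_inner mu)).
Qed.

End ms_cvg_components.

Section integral_isometry.
Context {R : realType} {d : measure_display} {T : measurableType d}.
Variables (P : probability T R) (k : nat) (L : R -> T -> 'cV[R]_k).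
Hypothesis HL : driving_levy P L.
Let siP := sqint_semi_inner P.
Let siL := sqint_semi_inner (@lebesgue_measure R).
Let X t i (w : T) : R := L t w i 0.
Let dX (x : R * R) i : T -> R := X x.2 i - X x.1 i.
Let dchi (x : R * R) : R -> R := chi x.2 - chi x.1.

Let sqX t i : sqint P (X t i). Proof. by have [] := levy_isometry HL t t i i. Qed.
Let sqdX x i : sqint P (dX x i). Proof. exact: (si_domB siP). Qed.
Let sqdchi x : sqint lebesgue_measure (dchi x).
Proof. by apply: (si_domB siL); exact: chi_sqint. Qed.

Let ip_dX x y i j :
  ip P (dX x i) (dX y j) = levy_cov P L i j * ip lebesgue_measure (dchi x) (dchi y).
Proof.
have E s t : ip P (X s i) (X t j) = levy_cov P L i j * ip lebesgue_measure (chi s) (chi t).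
  by have [] := levy_isometry HL s t i j.
have c (s : R) := chi_sqint s.
rewrite (si_BB siP (sqX _ _) (sqX _ _) (sqX _ _) (sqX _ _)) !E.
by rewrite (si_BB siL (c _) (c _) (c _) (c _)) -!mulrBr.
Qed.

Let stepI m (S : step_data k m) i : T -> R := fun w => step_integral L S w i 0.
Let stepF m (S : step_data k m) i j : R -> R := fun u => step_fun S u i j.

Let stepIE m (S : step_data k m) i :
  stepI S i = \sum_(x <- S) \sum_j x.2 i j *: dX x.1 j.
Proof.
apply/funext => w; rewrite /stepI /step_integral summxE fct_sumE.
apply: eq_bigr => x _; rewrite mxE fct_sumE; apply: eq_bigr => j _.
by rewrite !mxE.
Qed.

Let stepFE m (S : step_data k m) i j : all (fun x => x.1.1 <= x.1.2) S ->
  stepF S i j = \sum_(x <- S) x.2 i j *: dchi x.1.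
Proof.
move=> /allP Sle; apply/funext => u; rewrite /stepF /step_fun summxE fct_sumE.
rewrite big_mkcond/= big_seq [RHS]big_seq; apply: eq_bigr => x xS.
rewrite -[RHS]/(x.2 i j * (chi x.1.2 u - chi x.1.1 u)) chiB; last exact: Sle.
by case: ifP => _; rewrite ?mulr1 ?mulr0.
Qed.

Let sq_stepI m (S : step_data k m) i : sqint P (stepI S i).
Proof.
rewrite stepIE; apply: (si_dom_sum siP) => x _; apply: (si_dom_sum siP) => j _.
exact: (si_domZ siP).
Qed.

Let sq_stepF m (S : step_data k m) i j : all (fun x => x.1.1 <= x.1.2) S ->
  sqint lebesgue_measure (stepF S i j).
Proof.
move=> Sle; rewrite stepFE//; apply: (si_dom_sum siL) => x _.
exact: (si_domZ siL).
Qed.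

Let step_isometry m n (S : step_data k m) (S' : step_data k n) i i' :
  all (fun x => x.1.1 <= x.1.2) S -> all (fun x => x.1.1 <= x.1.2) S' ->
  ip P (stepI S i) (stepI S' i') =
  \sum_j \sum_j' levy_cov P L j j' * ip lebesgue_measure (stepF S i j) (stepF S' i' j').
Proof.
move=> Sle Sle'.
have sqa l (x : R * R * 'M[R]_(l, k)) v j :
  sqint P (x.2 v j *: dX x.1 j) by exact: (si_domZ siP).
have sqb l (x : R * R * 'M[R]_(l, k)) v j :
  sqint lebesgue_measure (x.2 v j *: dchi x.1) by exact: (si_domZ siL).
pose t (x : R * R * 'M[R]_(m, k)) j (y : R * R * 'M[R]_(n, k)) l := levy_cov P L j l *
  (x.2 i j * (y.2 i' l * ip lebesgue_measure (dchi x.1) (dchi y.1))).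
transitivity (\sum_(x <- S) \sum_j \sum_(y <- S') \sum_l t x j y l).
  rewrite !stepIE (si_suml siP) => [|x _|]; last 2 first.
  - by apply: (si_dom_sum siP) => j _; exact: sqa.
  - by apply: (si_dom_sum siP) => x _; apply: (si_dom_sum siP) => j _; exact: sqa.
  apply: eq_bigr => x _; rewrite (si_suml siP) => [|j _|]; last 2 first.
  - exact: sqa.
  - by apply: (si_dom_sum siP) => y _; apply: (si_dom_sum siP) => j _; exact: sqa.
  apply: eq_bigr => j _; rewrite (si_sumr siP) => [|y _|]; last 2 first.
  - by apply: (si_dom_sum siP) => l _; exact: sqa.
  - exact: sqa.
  apply: eq_bigr => y _; rewrite (si_sumr siP) => [|l _|]; last 2 first.
  - exact: sqa.
  - exact: sqa.
  apply: eq_bigr => l _; rewrite (si_Zl siP (x.2 i j) (sqdX _ _) (sqa _ _ _ _)).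
  by rewrite (si_Zr siP (y.2 i' l) (sqdX _ _) (sqdX _ _)) ip_dX /t; ring.
transitivity (\sum_j \sum_l \sum_(x <- S) \sum_(y <- S') t x j y l).
  rewrite exchange_big; apply: eq_bigr => j _ /=.
  rewrite [RHS]exchange_big; apply: eq_bigr => x _ /=.
  by rewrite exchange_big.
apply: eq_bigr => j _; apply: eq_bigr => l _.
rewrite (stepFE _ _ Sle) (stepFE _ _ Sle') (si_suml siL) => [|x _|]; last 2 first.
- exact: sqb.
- by apply: (si_dom_sum siL) => y _; exact: sqb.
rewrite mulr_sumr; apply: eq_bigr => x _.
rewrite (si_sumr siL) => [|y _|]; last 2 first.
- exact: sqb.
- exact: sqb.
rewrite mulr_sumr; apply: eq_bigr => y _.
rewrite (si_Zl siL (x.2 i j) (sqdchi _) (sqb _ _ _ _)).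
by rewrite (si_Zr siL (y.2 i' l) (sqdchi _) (sqdchi _)).
Qed.

Let integral_cvg m (f : R -> 'M[R]_(m, k)) (Z : T -> 'cV[R]_m) :
  (forall i j, measurable_fun setT (fun u => f u i j)) ->
  is_levy_integral P L f Z ->
  (forall i, sqint P (fun w => Z w i 0)) /\
  (forall i j, sqint lebesgue_measure (fun u => f u i j)) /\
  exists S : nat -> step_data k m,
    [/\ forall n, all (fun x => x.1.1 <= x.1.2) (S n),
       forall i j, ip lebesgue_measure (stepF (S n) i j - (fun u => f u i j))
         (stepF (S n) i j - (fun u => f u i j)) @[n --> \oo] --> 0 &
       forall i, ip P (stepI (S n) i - (fun w => Z w i 0))
         (stepI (S n) i - (fun w => Z w i 0)) @[n --> \oo] --> 0].
Proof.
move=> mf [rZ [S [Sle cS cI]]].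
have mZ i : measurable_fun setT (fun w => Z w i 0).
  apply: (@random_element_measurable _ _ _ _ Z (fun x => x i 0)) => //.
  exact: coord_continuous.
have hI := @cvg_components _ _ _ P 'I_m (fun n i => stepI (S n) i - (fun w => Z w i 0)).
have {}hI := hI (fun n i => measurable_funB (sq_stepI (S n) i).1 (mZ i)).
have {cI}hI := hI ltac:(by move: cI; rewrite unlock).
have mF n ij : measurable_fun setT
    (stepF (S n) ij.1 ij.2 - (fun u => f u ij.1 ij.2)).
  by apply: measurable_funB => //; have [] := sq_stepF ij.1 ij.2 (Sle n).
have hF := @cvg_components _ _ _ (@lebesgue_measure R) ('I_m * 'I_k)%type
  (fun n ij => stepF (S n) ij.1 ij.2 - (fun u => f u ij.1 ij.2)) mF.
have {cS}hF := hF ltac:(by move: cS; under eq_fun do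
  under eq_integral do rewrite (pair_bigA _ (fun i j => (step_fun _ _ i j - f _ i j) ^+ 2))).
split; last split.
- by move=> i; apply: sqint_ms_limit (hI i).1 => n; exact: sq_stepI.
- by move=> i j; apply: sqint_ms_limit (hF (i, j)).1 => n; exact: sq_stepF.
exists S; split => // [i j|i]; first exact: (hF (i, j)).2.
exact: (hI i).2.
Qed.

Lemma levy_integral_sqint m (f : R -> 'M[R]_(m, k)) (Z : T -> 'cV[R]_m) :
  (forall i j, measurable_fun setT (fun u => f u i j)) ->
  is_levy_integral P L f Z ->
  (forall i, sqint P (fun w => Z w i 0)) /\
  (forall i j, sqint lebesgue_measure (fun u => f u i j)).
Proof. by move=> mf /(integral_cvg mf)[? [? _]]. Qed.

(** The identity holds for step functions, where it is bilinear in
    increments, and both sides are continuous for mean-square limits. *)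
Lemma levy_integral_isometry m n (f : R -> 'M[R]_(m, k)) (g : R -> 'M[R]_(n, k))
    (Z : T -> 'cV[R]_m) (W : T -> 'cV[R]_n) i i' :
  (forall i j, measurable_fun setT (fun u => f u i j)) ->
  (forall i j, measurable_fun setT (fun u => g u i j)) ->
  is_levy_integral P L f Z -> is_levy_integral P L g W ->
  ip P (fun w => Z w i 0) (fun w => W w i' 0) =
  \sum_j \sum_j' levy_cov P L j j' *
    ip lebesgue_measure (fun u => f u i j) (fun u => g u i' j').
Proof.
move=> mf mg /(integral_cvg mf)[sZ [sf [S [Sle cS cI]]]].
move=> /(integral_cvg mg)[sW [sg [S' [Sle' cS' cI']]]].
have c1 : ip P (stepI (S n) i) (stepI (S' n) i') @[n --> \oo] -->
    ip P (fun w => Z w i 0) (fun w => W w i' 0).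
  by apply: (si_cvg siP) => //; near=> N; exact: sq_stepI.
have c2 : (\sum_j \sum_j' levy_cov P L j j' * ip lebesgue_measure (stepF (S n) i j)
    (stepF (S' n) i' j')) @[n --> \oo] -->
    \sum_j \sum_j' levy_cov P L j j' *
    ip lebesgue_measure (fun u => f u i j) (fun u => g u i' j').
  apply: cvg_bigsum => j; apply: cvg_bigsum => j'; apply: cvgMr.
  by apply: (si_cvg siL) => //; near=> N; exact: sq_stepF.
apply: cvg_unique c1 _ => //.
apply: cvg_eq_near c2; near=> N.
by rewrite step_isometry.
Unshelve. all: by end_near. Qed.

End integral_isometry.

(** * The matrix exponential *)

Lemma cvg_mx {R : realType} m n (f : nat -> 'M[R]_(m, n)) (l : 'M[R]_(m, n)) :
  (forall i j, f N i j @[N --> \oo] --> l i j) -> f N @[N --> \oo] --> l.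
Proof.
move=> fl; apply/cvgrPdist_lt => e e0.
have H : \forall N \near \oo, forall ij : 'I_m * 'I_n,
    `|l ij.1 ij.2 - f N ij.1 ij.2| < e.
  apply: filter_forall => -[i j] /=.
  by move: (fl i j) => /cvgrPdist_lt/(_ _ e0).
apply: filterS H => N HN.
have [->//|/mx_norm_coord_eq[i [j ->]]] := eqVneq `|l - f N| 0.
by rewrite !mxE; exact: (HN (i, j)).
Qed.

Section matrix_exponential.
Context {R : realType} {n : nat}.
Variable M : 'M[R]_n.

Definition entry_sum := \sum_i \sum_j `|M i j|.

Lemma entry_sum_ge0 : 0 <= entry_sum.
Proof. by apply: sumr_ge0 => i _; exact: sumr_ge0. Qed.

Lemma mx_expr_bound m i j : `|(M ^+ m) i j| <= entry_sum ^+ m.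
Proof.
elim: m i j => [|m IH] i j.
  by rewrite expr0 mxE; case: (_ == _); rewrite ?normr1 ?normr0// ler01.
rewrite !exprS -[M * _]/(M *m _) mxE (le_trans (ler_norm_sum _ _ _))//.
apply: (@le_trans _ _ (\sum_l `|M i l| * entry_sum ^+ m)).
  by apply: ler_sum => l _; rewrite normrM ler_wpM2l.
rewrite -mulr_suml ler_wpM2r ?exprn_ge0 ?entry_sum_ge0//.
rewrite /entry_sum [leRHS](bigD1 i)//= lerDl.
by apply: sumr_ge0 => l _; exact: sumr_ge0.
Qed.

Definition exp_entry i j m : R := (m`!%:R)^-1 * (M ^+ m) i j.

Let cvg_bounded (a : nat -> R) C x :
  (forall m, `|a m| <= C * ((m`!%:R)^-1 * entry_sum ^+ m)) ->
  cvgn (pseries a x).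
Proof.
move=> ab; apply: normed_cvg.
have C0 : 0 <= C.
  by have := ab 0%N; rewrite fact0 invr1 expr0 !mulr1; apply: le_trans.
apply: (@series_le_cvg _ _ (fun m => C * exp_coeff (entry_sum * `|x|) m)).
- by move=> m; exact: normr_ge0.
- move=> m; rewrite mulr_ge0// /exp_coeff/= divr_ge0// exprn_ge0//.
  by rewrite mulr_ge0// entry_sum_ge0.
- move=> m; rewrite -[leLHS]/(`|a m * x ^+ m|) normrM normrX.
  rewrite (le_trans (ler_wpM2r _ (ab m))) ?exprn_ge0//.
  by rewrite /exp_coeff/= exprMn le_eqVlt; apply/orP; left; apply/eqP; ring.
- exact/is_cvg_seriesZ/is_cvg_series_exp_coeff.
Qed.

Let exp_entry_bound i j m :
  `|exp_entry i j m| <= 1 * ((m`!%:R)^-1 * entry_sum ^+ m).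
Proof.
rewrite mul1r /exp_entry normrM ger0_norm ?invr_ge0// ler_wpM2l ?invr_ge0//.
exact: mx_expr_bound.
Qed.

Lemma exp_entry_cvg i j x : cvgn (pseries (exp_entry i j) x).
Proof. exact: cvg_bounded (exp_entry_bound i j). Qed.

Let diffsE i j m : pseries_diffs (exp_entry i j) m = (m`!%:R)^-1 * (M ^+ m.+1) i j.
Proof.
rewrite /pseries_diffs /exp_entry factS natrM; field.
by rewrite pnatr_eq0 -lt0n fact_gt0/= gt_eqF//.
Qed.

Lemma exp_entry_diffsl i j : pseries_diffs (exp_entry i j) =
  fun m => \sum_l M i l * exp_entry l j m.
Proof.
apply/funext => m; rewrite diffsE exprS -[M * _]/(M *m _) mxE mulr_sumr.
by apply: eq_bigr => l _; rewrite /exp_entry; ring.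
Qed.

Lemma exp_entry_diffsr i j : pseries_diffs (exp_entry i j) =
  fun m => \sum_l M l j * exp_entry i l m.
Proof.
apply/funext => m; rewrite diffsE exprSr -[_ * M]/(_ *m M) mxE mulr_sumr.
by apply: eq_bigr => l _; rewrite /exp_entry; ring.
Qed.

Let pseries_sum (a : 'I_n -> R) (b : 'I_n -> nat -> R) x :
  pseries (fun m => \sum_l a l * b l m) x =
  fun N => \sum_l a l * pseries (b l) x N.
Proof.
apply/funext => N; rewrite /pseries/series/=.
under eq_bigr do rewrite mulr_suml.
rewrite exchange_big/=; apply: eq_bigr => l _; rewrite mulr_sumr.
by apply: eq_bigr => m _; rewrite mulrA.
Qed.

Let cvg_pseries_sum (a : 'I_n -> R) (b : 'I_n -> nat -> R) x :
  (forall l, cvgn (pseries (b l) x)) ->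
  pseries (fun m => \sum_l a l * b l m) x N @[N --> \oo] -->
    \sum_l a l * limn (pseries (b l) x).
Proof.
by move=> cb; rewrite pseries_sum; apply: cvg_bigsum => l; apply: cvgMr; exact: cb.
Qed.

Lemma mxexpE x i j : mxexp (x *: M) i j = limn (pseries (exp_entry i j) x).
Proof.
pose l : 'M[R]_n := \matrix_(i, j) limn (pseries (exp_entry i j) x).
suff -> : mxexp (x *: M) = l by rewrite mxE.
apply: cvg_lim => //; apply: cvg_mx => i' j'; rewrite mxE.
have c : pseries (exp_entry i' j') x N @[N --> \oo] -->
  limn (pseries (exp_entry i' j') x) := @exp_entry_cvg i' j' x.
apply: cvg_eq_near c; near=> N.
rewrite summxE /pseries/series/= big_mkord; apply: eq_bigr => m _.
have -> : (x *: M) ^+ m = x ^+ m *: M ^+ m.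
  elim: (nat_of_ord m) => [|p IH]; first by rewrite !expr0 scale1r.
  rewrite !exprS IH -[LHS]/((x *: M) *m (x ^+ p *: M ^+ p)).
  by rewrite -scalemxAl -scalemxAr scalerA.
by rewrite !mxE /exp_entry; ring.
Unshelve. all: by end_near. Qed.

Let lim_diffs i j x : is_derive x (1 : R) (fun y => mxexp (y *: M) i j)
  (limn (pseries (pseries_diffs (exp_entry i j)) x)).
Proof.
have -> : (fun y => mxexp (y *: M) i j) = (fun y => limn (pseries (exp_entry i j) y)).
  by apply/funext => y; rewrite mxexpE.
have cd i' j' y : cvgn (pseries (pseries_diffs (exp_entry i' j')) y).
  rewrite exp_entry_diffsl; apply/cvg_ex; eexists; apply: cvg_pseries_sum => l.
  exact: exp_entry_cvg.
apply: (@pseries_snd_diffs _ _ (`|x| + 1)).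
- exact: exp_entry_cvg.
- exact: cd.
- have -> : pseries_diffs (pseries_diffs (exp_entry i j)) =
      fun m => \sum_l M i l * pseries_diffs (exp_entry l j) m.
    apply/funext => m; rewrite {1}/pseries_diffs exp_entry_diffsl mulr_sumr.
    by apply: eq_bigr => l _; rewrite /pseries_diffs mulrCA.
  by apply/cvg_ex; eexists; apply: cvg_pseries_sum => l; exact: cd.
- by rewrite [ltRHS]ger0_norm ?addr_ge0// ltrDl.
Qed.

Lemma mxexp_is_derivel i j x : is_derive x (1 : R) (fun y => mxexp (y *: M) i j)
  ((M *m mxexp (x *: M)) i j).
Proof.
have := lim_diffs i j x; rewrite exp_entry_diffsl.
rewrite (cvg_lim _ (@cvg_pseries_sum (M i) (fun l => exp_entry l j) x
  (fun l => @exp_entry_cvg l j x)))//.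
by rewrite mxE; under [in X in _ -> X]eq_bigr do rewrite mxexpE.
Qed.

Lemma mxexp_is_deriver i j x : is_derive x (1 : R) (fun y => mxexp (y *: M) i j)
  ((mxexp (x *: M) *m M) i j).
Proof.
have := lim_diffs i j x; rewrite exp_entry_diffsr.
rewrite (cvg_lim _ (@cvg_pseries_sum (M^~ j) (fun l => exp_entry i l) x
  (fun l => @exp_entry_cvg i l x)))//.
by rewrite mxE; under [in X in _ -> X]eq_bigr do rewrite mxexpE mulrC.
Qed.

Lemma mxexp0 : mxexp (0 *: M) = 1%:M.
Proof.
apply/matrixP => i j; rewrite mxexpE.
apply: cvg_lim => //; apply: cvg_eq_near (cvg_cst _).
near=> N; have N0 : (0 < N)%N by near: N; exists 1%N.
rewrite /pseries/series/= -(prednK N0) big_nat_recl//= expr0 mulr1 big1.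
  by rewrite addr0 /exp_entry fact0 invr1 mul1r expr0.
by move=> m _; rewrite expr0n/= mulr0.
Unshelve. all: by end_near. Qed.

Lemma mxexp_continuous i j : continuous (fun x : R => mxexp (x *: M) i j).
Proof.
move=> x; apply: differentiable_continuous; apply/derivable1_diffP.
by have [] := mxexp_is_derivel i j x.
Qed.

Lemma mxexp_is_derive_sub i l (c x : R) :
  is_derive x (1 : R) (fun y => mxexp ((c - y) *: M) i l)
    (- (mxexp ((c - x) *: M) *m M) i l).
Proof.
have dc : is_derive x (1 : R) (fun y => c - y) (- 1).
  by rewrite -[X in is_derive _ _ _ X]sub0r; exact: is_deriveB.
have := @is_derive1_comp _ (fun y => mxexp (y *: M) i l) (fun y => c - y) x _ _
  (mxexp_is_deriver i l (c - x)) dc.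
by rewrite mulrN1.
Qed.

(** For fixed c = s + t, the product of the exponentials at c - x and x has zero
    derivative in x. *)
Lemma mxexpD s t : mxexp ((s + t) *: M) = mxexp (s *: M) *m mxexp (t *: M).
Proof.
apply/matrixP => i j; pose c := s + t.
pose phi x := \sum_l mxexp ((c - x) *: M) i l * mxexp (x *: M) l j.
have -> : mxexp (c *: M) i j = phi 0.
  rewrite /phi subr0 mxexp0 (bigD1 j)//= mxE eqxx mulr1 big1 ?addr0// => l lj.
  by rewrite mxE (negbTE lj) mulr0.
have -> : (mxexp (s *: M) *m mxexp (t *: M)) i j = phi t.
  by rewrite mxE /phi /c addrK.
apply: is_derive_0_is_cst => x.
have d1 l := mxexp_is_derive_sub i l c x.
have d2 l := is_deriveM (d1 l) (mxexp_is_derivel l j x).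
have := is_derive_sum d2; rewrite fct_sumE.
rewrite (_ : \sum_(l < n) _ = 0) //.
rewrite [X in _ = X](_ : 0 = ((mxexp ((c - x) *: M) *m (M *m mxexp (x *: M))) i j
  - ((mxexp ((c - x) *: M) *m M) *m mxexp (x *: M)) i j)); last first.
  by rewrite mulmxA subrr.
rewrite !mxE -sumrB; apply: eq_bigr => l _.
congr (_ + _); set p := mxexp _ l j; set r := (_ *m M) i l.
by rewrite -[LHS]/(p * - r) mulrN mulrC.
Qed.

(** Exponential weights of rate above [entry_sum] dominate the kernel of the
    state in the remote past. *)
Lemma mxexp_bound i j x : `|mxexp (x *: M) i j| <= expR (entry_sum * `|x|).
Proof.
rewrite mxexpE.
have c : pseries (exp_entry i j) x N @[N --> \oo] -->
  limn (pseries (exp_entry i j) x) := @exp_entry_cvg i j x.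
have ce : series (exp_coeff (entry_sum * `|x|)) N @[N --> \oo] -->
  expR (entry_sum * `|x|) := @is_cvg_series_exp_coeff R (entry_sum * `|x|).
apply: (ler_cvg_to (cvg_norm c) ce); near=> N.
rewrite /pseries/series/= (le_trans (ler_norm_sum _ _ _))//.
apply: ler_sum => m _; rewrite normrM normrX.
rewrite (le_trans (ler_wpM2r _ (exp_entry_bound i j m))) ?exprn_ge0//.
by rewrite mul1r /exp_coeff/= exprMn le_eqVlt; apply/orP; left; apply/eqP; ring.
Unshelve. all: by end_near. Qed.

End matrix_exponential.

(** * Block structure of the state space *)

Section blocks.
Context {R : realType} {k q : nat}.
Implicit Types (i j : 'I_q.+1) (c : 'I_k).

Lemma blockpos_inj i j c c' :
  (@blockpos k q i c == blockpos j c') = (i == j) && (c == c').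
Proof.
apply/eqP/andP => [E|[/eqP-> /eqP->//]].
have E1 : i = j by have := congr1 (@tagnat.sig1 _ _) E; rewrite /blockpos !tagnat.Rank1K.
split; first by rewrite E1.
have : blockpos i c = blockpos j c' :> nat by rewrite E.
rewrite !blockposE E1 => /eqP.
by rewrite eqn_add2l => /eqP H; apply/eqP/val_inj.
Qed.

Lemma blockpos_surj (r : 'I_(dimX k q)) : exists j c, r = blockpos j c.
Proof.
by exists (tagnat.sig1 r), (tagnat.sig2 r); rewrite /blockpos tagnat.sig2K.
Qed.

Lemma EblockE j (r : 'I_(dimX k q)) c :
  Eblock k j r c = (r == blockpos j c)%:R :> R.
Proof.
have [i [c' ->]] := blockpos_surj r.
have := congr1 (fun W : 'M[R]_k => W c' c)
  (mxcolK (fun i : 'I_q.+1 => if i == j then 1%:M else 0 : 'M[R]_k) i).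
rewrite mxE => ->; rewrite blockpos_inj; case: (i == j) => /=; by rewrite mxE.
Qed.

Lemma CblockE c (r : 'I_(dimX k q)) :
  Cblock k q c r = (r == blockpos ord0 c)%:R :> R.
Proof.
have [i [c' ->]] := blockpos_surj r.
have := congr1 (fun W : 'M[R]_k => W c c')
  (mxrowK (fun i : 'I_q.+1 => if i == ord0 then 1%:M else 0 : 'M[R]_k) i).
rewrite mxE => ->; rewrite blockpos_inj; case: (i == ord0) => /=; rewrite mxE//.
by rewrite eq_sym.
Qed.

Lemma BblockE : Bblock k q = Eblock k ord_max :> 'M[R]_(_, _).
Proof. by []. Qed.

Lemma companionE (A : 'I_q.+1 -> 'M[R]_k) i j c c' :
  companion A (blockpos i c) (blockpos j c') =
  (if i == ord_max then - A (rev_ord j)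
   else if j == i.+1 :> nat then 1%:M else 0 : 'M[R]_k) c c'.
Proof.
have := congr1 (fun W : 'M[R]_k => W c c')
  (mxblockK (fun i j : 'I_q.+1 => if i == ord_max then - A (rev_ord j)
    else if j == i.+1 :> nat then 1%:M else 0 : 'M[R]_k) i j).
by rewrite mxE.
Qed.

Lemma mul_mx_Eblock m (W : 'M[R]_(m, dimX k q)) j (i : 'I_m) c :
  (W *m Eblock k j) i c = W i (blockpos j c).
Proof.
rewrite mxE (bigD1 (blockpos j c))//= EblockE eqxx mulr1 big1 ?addr0// => s sj.
by rewrite EblockE (negbTE sj) mulr0.
Qed.

Lemma mul_Cblock_mx n (W : 'M[R]_(dimX k q, n)) c (i : 'I_n) :
  (Cblock k q *m W) c i = W (blockpos ord0 c) i.
Proof.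
rewrite mxE (bigD1 (blockpos ord0 c))//= CblockE eqxx mul1r big1 ?addr0// => s sj.
by rewrite CblockE (negbTE sj) mul0r.
Qed.

Lemma mul_trEblock_mx n (W : 'M[R]_(dimX k q, n)) j c (i : 'I_n) :
  ((Eblock k j)^T *m W) c i = W (blockpos j c) i.
Proof.
rewrite mxE (bigD1 (blockpos j c))//= mxE EblockE eqxx mul1r big1 ?addr0// => s sj.
by rewrite mxE EblockE (negbTE sj) mul0r.
Qed.

Lemma companion_row (A : 'I_q.+1 -> 'M[R]_k) i j c (v : 'I_(dimX k q) -> R) :
  j = i.+1 :> nat -> \sum_s companion A (blockpos i c) s * v s = v (blockpos j c).
Proof.
move=> ji; have iM : i != ord_max.
  by apply/eqP => E; have := ltn_ord j; rewrite ji E /= ltnn.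
rewrite (bigD1 (blockpos j c))//= companionE (negbTE iM) ji eqxx mxE eqxx mul1r.
rewrite big1 ?addr0// => s sj; have [l [c' E]] := blockpos_surj s.
move: sj; rewrite E companionE (negbTE iM) blockpos_inj negb_and.
have [li|li] := eqVneq (l : nat) i.+1; last by rewrite mxE mul0r.
rewrite (_ : l = j) ?eqxx//=; last by apply/val_inj; rewrite /= li ji.
by rewrite mxE eq_sym => /negbTE->; rewrite mul0r.
Qed.

End blocks.

(** * Covariances of the state process *)

Section state.
Context {R : realType} {d : measure_display} {T : measurableType d}.
Variables (P : probability T R) (k q : nat) (A : 'I_q.+1 -> 'M[R]_k).
Variables (L : R -> T -> 'cV[R]_k) (X : R -> T -> 'cV[R]_(dimX k q)).
Hypothesis HL : driving_levy P L.
Hypothesis HX : forall t, is_levy_integral P L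
  (fun u => if u <= t then mxexp ((t - u) *: companion A) *m Bblock k q else 0) (X t).
Let M := companion A.
Let siP := sqint_semi_inner P.
Let siL := sqint_semi_inner (@lebesgue_measure R).
Let E (h : R) := mxexp (h *: M).
Let x t r : T -> R := fun w => X t w r 0.
Let top c := @blockpos k q ord_max c.

Definition state_kernel t r c : R -> R :=
  fun u => if u <= t then mxexp ((t - u) *: companion A) r (@blockpos k q ord_max c) else 0.

Let kernelE t u r c :
  (if u <= t then mxexp ((t - u) *: companion A) *m Bblock k q else 0) r c =
  state_kernel t r c u.
Proof.
rewrite /state_kernel; case: ifP => _; last by rewrite mxE.
by rewrite BblockE mul_mx_Eblock.
Qed.

Let measurable_kernel t r c : measurable_fun setT (state_kernel t r c).
Proof.
apply: measurable_fun_ifT => //=.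
  by apply: measurable_fun_ler.
apply: continuous_measurable_fun => u.
apply: (continuous_comp (f := fun v => t - v) (g := fun v => mxexp (v *: M) r (top c))).
  by apply: cvgB; [exact: cvg_cst|exact: cvg_id].
exact: mxexp_continuous.
Qed.

Lemma state_sqint t r : sqint P (x t r).
Proof.
have [|H _] := levy_integral_sqint HL _ (HX t); last exact: H.
by move=> i j; under eq_fun do rewrite kernelE; exact: measurable_kernel.
Qed.

Lemma state_kernel_sqint t r c : sqint lebesgue_measure (state_kernel t r c).
Proof.
have [|_ /(_ r c)] := levy_integral_sqint HL _ (HX t).
  by move=> i j; under eq_fun do rewrite kernelE; exact: measurable_kernel.
by under eq_fun do rewrite kernelE.
Qed.

Definition kernel_form (F G : 'I_k -> R -> R) : R :=
  \sum_c \sum_c' levy_cov P L c c' * ip lebesgue_measure (F c) (G c').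

Let state_isometry s t r r' :
  ip P (x s r) (x t r') = kernel_form (state_kernel s r) (state_kernel t r').
Proof.
have mk u i j : measurable_fun setT (fun v : R =>
    (if v <= u then mxexp ((u - v) *: companion A) *m Bblock k q else 0) i j).
  by under eq_fun do rewrite kernelE; exact: measurable_kernel.
rewrite (levy_integral_isometry HL r r' (mk s) (mk t) (HX s) (HX t)).
apply: eq_bigr => c _; apply: eq_bigr => c' _.
have kE u i j : (fun v => (if v <= u then mxexp ((u - v) *: companion A) *m
    Bblock k q else 0) i j) = state_kernel u i j.
  by apply/funext => v; exact: kernelE.
by rewrite !kE.
Qed.

Definition state_comb (l : seq (R * (R * 'I_(dimX k q)))) : T -> R :=
  \sum_(p <- l) p.1 *: (fun w => X p.2.1 w p.2.2 0).

Definition kernel_comb (l : seq (R * (R * 'I_(dimX k q)))) (c : 'I_k) : R -> R :=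
  \sum_(p <- l) p.1 *: state_kernel p.2.1 p.2.2 c.

Lemma state_comb_sqint l : sqint P (state_comb l).
Proof.
apply: (si_dom_sum siP) => p _; apply: (si_domZ siP); exact: state_sqint.
Qed.

Lemma kernel_comb_sqint l c : sqint lebesgue_measure (kernel_comb l c).
Proof.
apply: (si_dom_sum siL) => p _; apply: (si_domZ siL); exact: state_kernel_sqint.
Qed.

Lemma state_comb_isometry l l' :
  ip P (state_comb l) (state_comb l') = kernel_form (kernel_comb l) (kernel_comb l').
Proof.
have sx p : sqint P (p.1 *: x p.2.1 p.2.2).
  by apply: (si_domZ siP); exact: state_sqint.
have sk (p : R * (R * 'I_(dimX k q))) c :
    sqint lebesgue_measure (p.1 *: state_kernel p.2.1 p.2.2 c).
  by apply: (si_domZ siL); exact: state_kernel_sqint.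
rewrite /state_comb (si_suml siP) => [|p _|]; last 2 first.
- exact: sx.
- exact: state_comb_sqint.
under eq_bigr.
  move=> p _; rewrite (si_sumr siP); last 2 first.
  - by move=> p' _; exact: sx.
  - exact: sx.
  under eq_bigr do rewrite (si_Zl siP _ (state_sqint _ _) (sx _))
    (si_Zr siP _ (state_sqint _ _) (state_sqint _ _)) state_isometry /kernel_form.
  over.
rewrite /kernel_form.
under [RHS]eq_bigr do under eq_bigr do rewrite /kernel_comb
  (si_suml siL _ (fun p _ => sk p _) (kernel_comb_sqint l' _)) mulr_sumr.
under [RHS]eq_bigr do rewrite exchange_big/=.
rewrite [RHS]exchange_big/=; apply: eq_bigr => p _.
under [RHS]eq_bigr do under eq_bigr do rewrite
  (si_sumr siL _ (fun p _ => sk p _) (sk _ _)) mulr_sumr.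
under [RHS]eq_bigr do rewrite exchange_big/=.
rewrite [RHS]exchange_big/=; apply: eq_bigr => p' _.
rewrite !mulr_sumr; apply: eq_bigr => c _; rewrite !mulr_sumr; apply: eq_bigr => c' _.
rewrite (si_Zl siL _ (state_kernel_sqint _ _ _) (sk _ _)).
by rewrite (si_Zr siL _ (state_kernel_sqint _ _ _) (state_kernel_sqint _ _ _)); ring.
Qed.

(** The innovation of the state between t and t + h: its kernel vanishes
    outside of this interval. *)
Definition noise t h r : T -> R :=
  x (t + h) r - \sum_s mxexp (h *: companion A) r s *: x t s.

Let noise_list t h r : seq (R * (R * 'I_(dimX k q))) :=
  (1, (t + h, r)) :: [seq (- E h r s, (t, s)) | s <- index_enum _].

Let noise_comb t h r : noise t h r = state_comb (noise_list t h r).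
Proof.
rewrite /state_comb big_cons big_map scale1r /noise; congr (_ + _).
by rewrite -sumrN; apply: eq_bigr => s _; rewrite scaleNr.
Qed.

Let dchiE (t h u : R) : chi (t + h) u - chi t u = (u <= t + h)%R%:R - (u <= t)%R%:R.
Proof.
have [th|/ltW th] := leP t (t + h).
  rewrite chiB//; have [ut|ut] := leP u t; last by rewrite subr0.
  by rewrite (le_trans ut th) subrr.
apply: oppr_inj; rewrite !opprB chiB//; have [ut|ut] := leP u (t + h).
  by rewrite (le_trans ut th) subrr.
by rewrite subr0.
Qed.

Let noise_kernel t h r c : kernel_comb (noise_list t h r) c =
  fun u => (chi (t + h) u - chi t u) * E (t + h - u) r (top c).
Proof.
apply/funext => u.
rewrite dchiE /kernel_comb big_cons big_map scale1r.
rewrite -[LHS]/(state_kernel (t + h) r c u + (\sum_(s <- index_enum _)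
  - E h r s *: state_kernel t s c) u) fct_sumE /state_kernel.
rewrite (eq_bigr (fun s => - (E h r s * (if u <= t then E (t - u) s (top c) else 0)))); last first.
  by move=> s _; rewrite -mulNr.
rewrite sumrN; have -> : \sum_s E h r s * (if u <= t then E (t - u) s (top c) else 0) =
    (u <= t)%R%:R * E (t + h - u) r (top c).
  case: (u <= t); last by rewrite mul0r big1// => s _; rewrite mulr0.
  rewrite mul1r (_ : t + h - u = h + (t - u)); last by ring.
  have -> : E (h + (t - u)) = E h *m E (t - u) by exact: mxexpD.
  by rewrite mxE.
rewrite mulrBl; congr (_ - _).
by rewrite -/(E (t + h - u)) -/(top c); case: ifP; rewrite ?mul1r ?mul0r.
Qed.

Lemma noise_sqint t h r : sqint P (noise t h r).
Proof. by rewrite noise_comb; exact: state_comb_sqint. Qed.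

(** The kernels of the two variables have disjoint supports. *)
Lemma noise_orth t h r s r' : 0 <= h -> s <= t -> ip P (noise t h r) (x s r') = 0.
Proof.
move=> h0 st; have -> : x s r' = state_comb [:: (1, (s, r'))].
  by rewrite /state_comb big_seq1 scale1r.
rewrite noise_comb state_comb_isometry /kernel_form big1// => c _; rewrite big1// => c' _.
rewrite [X in _ * X](_ : _ = 0) ?mulr0// /ip (_ : (fun u => _) = cst 0).
  by rewrite /Rintegral integral0_eq.
apply/funext => u; rewrite noise_kernel /kernel_comb big_seq1 scale1r/=.
rewrite chiB ?lerDl// /state_kernel; have [us|us] := leP u s; last by rewrite mulr0.
by rewrite ltNge (le_trans us st) !mul0r.
Qed.

Let form_le (F : 'I_k -> R -> R) : (forall c, sqint lebesgue_measure (F c)) ->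
  kernel_form F F <= (\sum_c \sum_c' `|levy_cov P L c c'|) *
    (\sum_c ip lebesgue_measure (F c) (F c)).
Proof.
move=> sF; have F0 c := si_ge0 siL (sF c).
rewrite /kernel_form mulr_suml; apply: ler_sum => c _.
rewrite mulr_suml; apply: ler_sum => c' _.
set S := \sum_i _; apply: le_trans (ler_norm _) _; rewrite normrM ler_wpM2l//.
have S0 : 0 <= S by apply: sumr_ge0.
have le1 i : ip lebesgue_measure (F i) (F i) <= S.
  by rewrite /S (bigD1 i)//= lerDl; apply: sumr_ge0.
rewrite -(ler_pXn2r (n := 2)) ?nnegrE// real_normK ?num_real//.
apply: le_trans (cauchy_schwarz siL (sF c) (sF c')) _.
by rewrite expr2 ler_pM.
Qed.

Lemma mxexp_quotient r s :
  h^-1 * (E h r s - (r == s)%:R) @[h --> 0^'] --> M r s.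
Proof.
have [dE vE] := mxexp_is_derivel M r s 0.
rewrite mxexp0 mulmx1 in vE; rewrite -vE.
apply: cvg_eq_near dE; near=> h.
by rewrite /= -[_ *: _]/(_ * _) -[h *: 1]/(h * 1) mulr1 addr0 mxexp0 mxE.
Unshelve. all: by end_near. Qed.

(** Outside of the last block the entries of e^{Ah} B vanish at h = 0. The
    kernel of the noise is then O(h) on an interval of length |h|, and its
    squared norm is O(|h|^3). *)
Lemma noise_small t r : (forall c, r != top c) ->
  (h^-1) ^+ 2 * ip P (noise t h r) (noise t h r) @[h --> 0^'] --> 0.
Proof.
move=> rtop; pose C : R := entry_sum M + 1.
have C0 : 0 <= C by rewrite addr_ge0// entry_sum_ge0.
have [e /= e0 He] : exists2 e : R, 0 < e & forall y : R, `|y| < e ->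
    forall c, `|E y r (top c)| <= C * `|y|.
  have /nbhs_ballP[e /= e0 He] : \forall y \near 0^',
      forall c, `|y^-1 * (E y r (top c) - (r == top c)%:R)| <= C.
    apply: filter_forall => c; have /cvg_norm := @mxexp_quotient r (top c).
    move=> /cvgr_le; apply; apply: le_lt_trans (ltr_pwDr ltr01 (lexx _)).
    rewrite /entry_sum (bigD1 r)//= (bigD1 (top c))//= -addrA lerDl.
    by rewrite addr_ge0//; apply: sumr_ge0 => // i _; apply: sumr_ge0.
  exists e => // y ye c; have [->|y0] := eqVneq y 0.
    by rewrite /E mxexp0 mxE (negbTE (rtop c)) normr0 mulr0.
  have := He y; rewrite /ball/= sub0r normrN => /(_ ye y0 c).
  rewrite (negbTE (rtop c)) subr0 normrM normfV ler_pdivrMl ?normr_gt0//.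
  by rewrite mulrC.
pose K : R := \sum_c \sum_c' `|levy_cov P L c c'|.
have K0 : 0 <= K by apply: sumr_ge0 => c _; apply: sumr_ge0.
have bnd h : `|h| < e -> ip P (noise t h r) (noise t h r) <=
    K * (k%:R * ((C * `|h|) ^+ 2 * `|h|)).
  move=> he; rewrite noise_comb state_comb_isometry.
  apply: le_trans (form_le (fun c => kernel_comb_sqint _ c)) _.
  rewrite ler_wpM2l// mulr_natl -[k in X in _ <= X]card_ord -sumr_const.
  apply: ler_sum => c _.
  have h0 : 0 <= C * `|h| by rewrite mulr_ge0.
  apply: le_trans (ip_sqr_le h0 (kernel_comb_sqint _ c)
    (si_domB siL (chi_sqint (t + h)) (chi_sqint t)) _) _; last first.
    by rewrite ip_dchi addrAC subrr add0r.
  move=> u; rewrite noise_kernel -[(_ - _) u]/(chi (t + h) u - chi t u).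
  rewrite normrM mulrC.
  have [->|d0] := eqVneq (chi (t + h) u - chi t u) 0; first by rewrite normr0 !mulr0.
  have uh : `|t + h - u| <= `|h|.
    move: d0; rewrite dchiE.
    have [ut|ut] := leP u t; have [uh|uh] := leP u (t + h); rewrite ?subrr ?eqxx// => _.
      by rewrite !ler0_norm; lra.
    by rewrite !ger0_norm; lra.
  rewrite ler_wpM2r// (le_trans (He _ _ c)) ?ler_wpM2l//.
  exact: le_lt_trans uh he.
have c0 : `|h| @[h --> (0 : R)^'] --> `|0 : R|.
  by apply: cvg_within_filter; apply: cvg_norm; exact: cvg_id.
have lim : (K * k%:R * C ^+ 2) * `|h| @[h --> (0 : R)^'] --> (0 : R).
  by have := cvgM (cvg_cst (K * k%:R * C ^+ 2)) c0; rewrite normr0 mulr0; exact.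
have neare : \forall h \near (0 : R)^', `|h| < e.
  by apply/nbhs_ballP; exists e => // h; rewrite /ball/= sub0r normrN => ? _.
have near0 : \forall h \near (0 : R)^', h != 0 by exact: nbhs_dnbhs_neq.
apply: squeeze_cvgr lim; last exact: cvg_cst.
near=> h; have h0 : h != 0 by near: h.
have he : `|h| < e by near: h.
rewrite mulr_ge0 ?sqr_ge0 ?(si_ge0 siP (noise_sqint _ _ _))//=.
apply: le_trans (ler_wpM2l (sqr_ge0 _) (bnd h he)) _.
rewrite le_eqVlt; apply/orP; left; apply/eqP.
have n0 : `|h| != 0 by rewrite normr_eq0.
rewrite -(real_normK (num_real h^-1)) normfV.
rewrite -[LHS]/(`|h|^-1 ^+ 2 * (K * (k%:R * ((C * `|h|) ^+ 2 * `|h|)))).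
rewrite -[RHS]/(K * k%:R * C ^+ 2 * `|h|).
move: n0; move: `|h| => y y0; field.
exact: y0.
Unshelve. all: by end_near. Qed.

(** In mean square, the blocks of the state are the successive derivatives of
    the first one. *)
Lemma state_deriv t (i j : 'I_q.+1) b : j = i.+1 :> nat ->
  let D h := h^-1 *: (x (t + h) (blockpos i b) - x t (blockpos i b)) -
    x t (blockpos j b) in
  ip P (D h) (D h) @[h --> 0^'] --> 0.
Proof.
move=> ij D; pose r := blockpos i b.
pose a s h := h^-1 * (E h r s - (r == s)%:R) - M r s.
pose S h := \sum_s a s h *: x t s.
have DE h : D h = h^-1 *: noise t h r + S h.
  rewrite /S; under eq_bigr do rewrite scalerBl -scalerA scalerBl scalerBr.
  rewrite !sumrB -!scaler_sumr /noise scalerBr addrA addrA subrK.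
  rewrite (bigD1 r)//= eqxx scale1r big1 ?addr0; last first.
    by move=> s sr; rewrite eq_sym (negbTE sr) scale0r.
  rewrite /D scalerBr; congr (_ - _); apply/funext => w; rewrite fct_sumE.
  by rewrite -(companion_row A b (fun s => x t s w) ij).
have sS h : sqint P (S h).
  apply: (si_dom_sum siP) => s _; apply: (si_domZ siP); exact: state_sqint.
have sN h : sqint P (h^-1 *: noise t h r).
  by apply: (si_domZ siP); exact: noise_sqint.
have c1 : ip P (h^-1 *: noise t h r) (h^-1 *: noise t h r) @[h --> 0^'] --> 0.
  have rtop c : r != top c.
    rewrite blockpos_inj negb_and; apply/orP; left; apply/eqP => iE.
    by have := ltn_ord j; rewrite ij iE /= ltnn.
  apply: cvg_eq_near (noise_small t rtop); near=> h.
  rewrite (si_Zl siP _ (noise_sqint _ _ _) (sN _)).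
  by rewrite (si_Zr siP _ (noise_sqint _ _ _) (noise_sqint _ _ _)); ring.
have c2 : ip P (S h) (S h) @[h --> 0^'] --> 0.
  apply: (si_comb_cvg0 siP) => s; first exact: state_sqint.
  rewrite -[X in _ --> X](subrr (M r s)).
  by apply: cvgB; [exact: mxexp_quotient|exact: cvg_cst].
have c3 : (2 * (ip P (h^-1 *: noise t h r) (h^-1 *: noise t h r) + ip P (S h) (S h)))
    @[h --> 0^'] --> (2 * (0 + 0) : R) by apply: cvgMr; exact: cvgD.
rewrite addr0 mulr0 in c3.
apply: squeeze_cvgr c3; last exact: cvg_cst.
near=> h; rewrite (si_ge0 siP)/=; last by rewrite DE; exact: (si_domD siP).
by rewrite DE; exact: (si_sqrD_le siP).
Unshelve. all: by end_near. Qed.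

End state.

(** * The state is not determined by the past of the other components *)

Lemma FTC_segment {R : realType} (f F : R -> R) (a b : R) : a < b ->
  (forall x : R, is_derive x (1 : R) F (f x)) -> continuous f ->
  \int[lebesgue_measure]_(x in `[a, b]) f x = F b - F a.
Proof.
move=> ab dF cf.
have cF : continuous F.
  move=> x; apply: differentiable_continuous; apply/derivable1_diffP.
  by have [] := dF x.
rewrite /Rintegral (@continuous_FTC2 R f F)//.
- exact: continuous_subspaceT.
- split; first by move=> x _; have [] := dF x.
  + exact/cvg_at_right_filter/cF.
  + exact/cvg_at_left_filter/cF.
- by move=> x _; rewrite derive1E; have [_ ->] := dF x.
Qed.

Section window.
Context {R : realType}.
Variables (lam t : R).
Hypothesis lam0 : 0 < lam.

(** Exponential weights are cut off far in the past to remain on a compact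
    interval; all bounds are uniform in the cutoff. *)
Definition window (n : nat) : R -> R :=
  (fun u => expR (lam * (u - t))) \_ `[- n%:R, t].

Lemma expw_continuous (m : R) : continuous (fun u => expR (m * (u - t))).
Proof.
move=> u; apply: (continuous_comp (f := fun v => m * (v - t)) (g := @expR R)).
  by apply: cvgMr; apply: cvgB; [exact: cvg_id|exact: cvg_cst].
exact: continuous_expR.
Qed.

Lemma expw_is_derive (m u : R) :
  is_derive u (1 : R) (fun v => expR (m * (v - t))) (m * expR (m * (u - t))).
Proof.
have da : is_derive u (1 : R) (fun v => m * (v - t)) m.
  apply: (is_derive_eq (f := m \*: (id - cst t))).
  by rewrite subr0 -[LHS]/(m * 1) mulr1.
by have := @is_derive1_comp _ (@expR R) _ u _ _ (is_derive_expR _) da; rewrite mulrC.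
Qed.

Let window_sqr n : (fun u => window n u * window n u) =
  (fun u => expR ((2 * lam) * (u - t))) \_ `[- n%:R, t].
Proof.
apply/funext => u; rewrite /window !patchE; case: ifP => _; last by rewrite mulr0.
by rewrite -expRD; congr expR; ring.
Qed.

Lemma window_sqint n : - n%:R < t ->
  sqint lebesgue_measure (window n) /\
  ip lebesgue_measure (window n) (window n) <= (2 * lam)^-1.
Proof.
move=> nt.
have mw : measurable_fun setT (window n).
  apply/(measurable_restrictT _ _).1 => //.
  by apply: measurable_funTS; apply: continuous_measurable_fun; exact: expw_continuous.
have intE : \int[lebesgue_measure]_u (window n u * window n u) =
    (2 * lam)^-1 - (2 * lam)^-1 * expR ((2 * lam) * (- n%:R - t)).
  rewrite window_sqr -Rintegral_mkcond.
  have dF u : is_derive u (1 : R)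
      (fun u => (2 * lam)^-1 * expR ((2 * lam) * (u - t))) (expR ((2 * lam) * (u - t))).
    have dw := expw_is_derive (2 * lam) u.
    apply: (is_derive_eq (is_deriveZ (2 * lam)^-1 dw)).
    by rewrite -[LHS]/(_ * _) mulrA mulVf ?mul1r// gt_eqF// mulr_gt0.
  have FT := FTC_segment nt dF (@expw_continuous (2 * lam)).
  by rewrite FT subrr mulr0 expR0 mulr1.
split; last first.
  rewrite /ip intE gerBl mulr_ge0 ?expR_ge0// invr_ge0 ltW// mulr_gt0//.
split => //.
have := @continuous_compact_integrable R (fun u => expR ((2 * lam) * (u - t)))
  `[- n%:R, t]%classic (@segment_compact _ _ _) (@continuous_subspaceT _ _ _ _ (@expw_continuous (2 * lam))).
rewrite (@integrable_mkcond _ (measurableTypeR R) R lebesgue_measure `[- n%:R, t]%classic)//.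
apply: eq_integrable => // u _.
rewrite expr2.
have -> := congr1 (fun h => h u) (window_sqr n).
by rewrite !patchE; case: ifP.
Qed.

Lemma ip_windowE n (G : R -> R) s : s <= t -> (forall u, s < u -> G u = 0) ->
  ip lebesgue_measure G (window n) =
  \int[lebesgue_measure]_(u in `[- n%:R, s]) (expR (lam * (u - t)) * G u).
Proof.
move=> st G0; rewrite [RHS]Rintegral_mkcond; apply: eq_Rintegral => u _.
rewrite /window !patchE !mem_setE !in_itv/=.
have [us|us] := leP u s; last first.
  by rewrite G0// !mul0r andbF.
by rewrite (le_trans us st) !andbT; case: ifP; rewrite ?mulr0// mulrC.
Qed.

End window.

Lemma weighted_entry {R : realType} n (W1 W2 : 'M[R]_n) (v : 'cV[R]_n)
    (m e : R) r :
  e * (m *: (W1 *m v) - W2 *m v) r 0 =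
  \sum_y v y 0 * (e * - W2 r y + W1 r y * (m * e)).
Proof.
rewrite !mxE mulrBr mulrA mulr_sumr mulr_sumr -sumrB; apply: eq_bigr => y _.
by ring.
Qed.

Lemma coef_eq0_large_roots {R : realFieldType} n (c : 'I_n -> R) m :
  (forall y, m < y -> \sum_j c j * y ^+ j = 0) -> forall j, c j = 0.
Proof.
move=> c0; pose c' i := if insub i is Some j then c j else 0.
pose f := \poly_(i < n) c' i.
have f0 : f = 0.
  apply: (@roots_geq_poly_eq0 _ f [seq m + i.+1%:R | i <- iota 0 n]).
  - apply/allP => y /mapP[i _ ->]; rewrite rootE horner_poly; apply/eqP.
    rewrite -[RHS](c0 (m + i.+1%:R)) ?ltrDl//; apply: eq_bigr => j _.
    by rewrite /c' valK.
  - rewrite map_inj_uniq ?iota_uniq// => i i' /addrI /eqP.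
    by rewrite eqr_nat => /eqP[].
  - by rewrite size_map size_iota size_poly.
move=> j; have := congr1 (fun h : {poly R} => h`_j) f0.
by rewrite coef_poly ltn_ord coef0 /c' valK.
Qed.

Section test_functional.
Context {R : realType} {d : measure_display} {T : measurableType d}.
Variables (P : probability T R) (k q : nat) (A : 'I_q.+1 -> 'M[R]_k).
Variables (L : R -> T -> 'cV[R]_k) (X : R -> T -> 'cV[R]_(dimX k q)).
Hypothesis HL : driving_levy P L.
Hypothesis HX : forall t, is_levy_integral P L
  (fun u => if u <= t then mxexp ((t - u) *: companion A) *m Bblock k q else 0) (X t).
Hypothesis pos : posdefmx (levy_cov P L).
Let M := companion A.
Let S := levy_cov P L.
Let siL := sqint_semi_inner (@lebesgue_measure R).
Let E (h : R) := mxexp (h *: M).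
Let x t r : T -> R := fun w => X t w r 0.

Let S_sym c c' : S c c' = S c' c.
Proof. by rewrite !mxE; congr fine; rewrite !unlock; apply: eq_integral => w _; rewrite mulrC. Qed.

Let S_psd (v : 'I_k -> R) : 0 <= \sum_c \sum_c' S c c' * (v c * v c').
Proof.
pose V : 'cV[R]_k := \col_c v c.
have -> : \sum_c \sum_c' S c c' * (v c * v c') = (V^T *m S *m V) 0 0.
  rewrite mxE; under [RHS]eq_bigr do rewrite mxE mulr_suml.
  rewrite exchange_big/=; apply: eq_bigr => c _; apply: eq_bigr => c' _.
  by rewrite [V^T _ _]mxE ![V _ _]mxE S_sym; ring.
have [->|V0] := eqVneq V 0; last by apply: ltW; exact: pos.
by rewrite mulmx0 mxE.
Qed.

Let S_unit : S \in unitmx.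
Proof.
rewrite -row_free_unit -kermx_eq0; apply/eqP/row_matrixP => i.
rewrite row0; set v := row i _.
have vS : v *m S = 0 by apply/sub_kermxP; exact: row_sub.
apply/eqP/negPn/negP => v0.
have : v^T != 0 by rewrite -trmx0 (inj_eq trmx_inj).
by move=> /pos; rewrite trmxK vS mul0mx mxE ltxx.
Qed.

Let form := @kernel_form R d T P k L.
Let dom : set ('I_k -> R -> R) := [set F | forall c, sqint lebesgue_measure (F c)].

Let form_semi_inner : semi_inner (fun a (F : 'I_k -> R -> R) => fun c => a *: F c) dom form.
Proof.
split.
- by move=> c; exact: (si_dom0 siL).
- by move=> F G sF sG c; exact: (si_domD siL).
- by move=> F sF c; exact: (si_domN siL).
- by move=> a F sF c; exact: (si_domZ siL).
- move=> F G H sF sG sH; rewrite /form /kernel_form -big_split/=.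
  apply: eq_bigr => c _; rewrite -big_split/=; apply: eq_bigr => c' _.
  by rewrite -mulrDr -(si_Dl siL).
- move=> a F G sF sG; rewrite /form /kernel_form mulr_sumr.
  apply: eq_bigr => c _; rewrite mulr_sumr; apply: eq_bigr => c' _.
  by rewrite (si_Zl siL)// mulrCA.
- move=> F G sF sG; rewrite /form /kernel_form exchange_big/=.
  apply: eq_bigr => c _; apply: eq_bigr => c' _.
  by rewrite -/S S_sym (si_C siL).
- move=> F sF.
  have sc c c' : lebesgue_measure.-integrable setT (fun u => (S c c' * (F c u * F c' u))%:E).
    have := integrableZl measurableT (S c c') (sqint_int_mul (sF c) (sF c')).
    exact.
  have -> : form F F = \int[lebesgue_measure]_u \sum_c \sum_c' S c c' * (F c u * F c' u).
    have sc2 c := Rintegral_bigsum (index_enum _) (sc c).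
    rewrite (Rintegral_bigsum (index_enum _) (fun c => (sc2 c).1)).2.
    apply: eq_bigr => c _; rewrite (sc2 c).2; apply: eq_bigr => c' _.
    by rewrite RintegralZl//; exact: sqint_int_mul.
  by apply: Rintegral_ge0 => u _; exact: S_psd.
Qed.

Section fixed_rate.
Variables (lam t : R) (a : 'I_k).
Hypotheses (lam0 : 0 < lam) (lamM : entry_sum M < lam).

(** The companion matrix shifts blocks, so [lam - M] maps the vector of powers of
    lam, placed in component a of each block, into the last block, whatever
    the coefficients are. *)
Let v : 'cV[R]_(dimX k q) :=
  \col_r \sum_(j < q.+1) lam ^+ j * (r == blockpos j a)%:R.

Let vE j c : v (blockpos j c) 0 = lam ^+ j * (c == a)%:R.
Proof.
rewrite mxE (bigD1 j)//= blockpos_inj eqxx/= big1 ?addr0// => i ij.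
by rewrite blockpos_inj eq_sym (negbTE ij) mulr0.
Qed.

Let p : 'cV[R]_k := \col_c (lam *: v - M *m v) (blockpos ord_max c) 0.

Let resolvent : lam *: v - M *m v = Bblock k q *m p.
Proof.
apply/colP => r; have [i [c ->]] := blockpos_surj r.
rewrite [RHS]mxE; under eq_bigr do rewrite BblockE EblockE blockpos_inj.
have [iM|iM] := eqVneq i ord_max.
  rewrite iM (bigD1 c)//= eqxx mul1r big1 ?addr0; last first.
    by move=> c' cc'; rewrite eq_sym (negbTE cc') mul0r.
  by rewrite [RHS]mxE.
rewrite big1; last by move=> c' _; rewrite mul0r.
have iq : (i.+1 < q.+1)%N.
  by rewrite ltnS ltn_neqAle -ltnS ltn_ord andbT; apply: contra iM => /eqP iq; apply/eqP/val_inj.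
rewrite [LHS]mxE [X in X + _]mxE vE [X in _ + X]mxE [X in _ - X]mxE.
rewrite (companion_row (j := Ordinal iq) A c (fun s => v s 0))// vE /= exprS.
by rewrite mulrA subrr.
Qed.

(** The test kernel is an exponential in time with values in the direction
    S^-1 p, the inverse cancelling the covariance matrix in [form]. *)
Let g : 'cV[R]_k := invmx S *m p.

Let Sg : S *m g = p. Proof. by rewrite mulmxA mulmxV// mul1mx. Qed.

Let test n (c : 'I_k) : R -> R := g c 0 *: window lam t n.

Let test_dom n : - n%:R < t -> dom (test n).
Proof.
by move=> nt c; apply: (si_domZ siL); have [] := window_sqint lam0 nt.
Qed.

Let form_test (F : 'I_k -> R -> R) n : - n%:R < t -> dom F ->
  form F (test n) = ip lebesgue_measure (\sum_c p c 0 *: F c) (window lam t n).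
Proof.
move=> nt sF; have [sw _] := window_sqint lam0 nt.
rewrite (si_suml siL) => [|c _|//]; last exact: (si_domZ siL).
apply: eq_bigr => c _; rewrite (si_Zl siL)// -Sg mxE mulr_suml.
apply: eq_bigr => c' _; rewrite (si_Zr siL)// ?mulrA//.
Qed.

Let Phi s r u := expR (lam * (u - t)) * (E (s - u) *m v) r 0.
Let phi s r u := expR (lam * (u - t)) * (E (s - u) *m (Bblock k q *m p)) r 0.

(** Pairing the kernel of X(s) with the test kernel integrates [phi], which is an
    exact derivative because (lam - M) v = B p. *)
Let Phi_derive s r u : is_derive u (1 : R) (Phi s r) (phi s r u).
Proof.
have dy y := is_deriveZ (v y 0)
  (is_deriveM (expw_is_derive t lam u) (mxexp_is_derive_sub M r y s u)).
have := is_derive_sum dy; rewrite fct_sumE => H.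
have PE : Phi s r = fun u => \sum_(y < dimX k q)
  (v y 0 \*: ((fun v : R => expR (lam * (v - t))) * (fun y0 : R => mxexp ((s - y0) *: M) r y))) u.
  apply/funext => u'; rewrite /Phi mxE mulr_sumr; apply: eq_bigr => y _.
  by rewrite -[RHS]/(v y 0 * (expR (lam * (u' - t)) * E (s - u') r y)); ring.
rewrite PE; apply: is_derive_eq H _.
rewrite /phi -resolvent mulmxBr -scalemxAr mulmxA.
rewrite (weighted_entry _ _ _ lam (expR (lam * (u - t)))).
by apply: eq_bigr => y _.
Qed.

Let phi_continuous s r : continuous (phi s r).
Proof.
move=> u; apply: cvgM; first exact: expw_continuous.
pose w := Bblock k q *m p.
have -> : (fun u => (E (s - u) *m (Bblock k q *m p)) r 0) =
    fun u => \sum_y E (s - u) r y * w y 0 by apply/funext => u'; rewrite mxE.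
rewrite [X in _ --> X]mxE; apply: cvg_bigsum => y; apply: cvgMl.
apply: (continuous_comp (f := fun v => s - v) (g := fun v => mxexp (v *: M) r y)).
  by apply: cvgB; [exact: cvg_cst|exact: cvg_id].
exact: mxexp_continuous.
Qed.

Let Phi_vanish s r : Phi s r (- n%:R) @[n --> \oo] --> 0.
Proof.
pose K := entry_sum M; pose V : R := \sum_y `|v y 0|.
pose C := V * expR (K * s - lam * t).
have c : C * expR (- (lam - K)) ^+ n @[n --> \oo] --> (C * 0 : R).
  apply: cvgMr; apply: cvg_expr.
  by rewrite ger0_norm ?expR_ge0// expR_lt1 oppr_lt0 subr_gt0.
rewrite mulr0 in c; apply/norm_cvg0P; apply: squeeze_cvgr c; last exact: cvg_cst.
near=> n.
have sn : 0 <= s + n%:R.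
  rewrite addrC -lerBlDr sub0r; near: n; exact: nbhs_infty_ger.
rewrite normr_ge0/= /Phi normrM ger0_norm ?expR_ge0// opprK.
have le : `|(E (s + n%:R) *m v) r 0| <= expR (K * (s + n%:R)) * V.
  rewrite [X in `|X|]mxE (le_trans (ler_norm_sum _ _ _))// mulr_sumr.
  apply: ler_sum => y _; rewrite normrM ler_wpM2r//.
  by apply: le_trans (mxexp_bound M r y _) _; rewrite ger0_norm.
apply: le_trans (ler_wpM2l (expR_ge0 _) le) _.
rewrite -expRM_natr mulrA -expRD /C mulrC -mulrA -expRD.
rewrite ler_wpM2l//; first by apply: sumr_ge0.
rewrite ler_expR le_eqVlt; apply/orP; left; apply/eqP; rewrite -/K; ring.
Unshelve. all: by end_near. Qed.

Let test_kernel s r : s <= t ->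
  form (state_kernel A s r) (test n) @[n --> \oo] --> expR (lam * (s - t)) * v r 0.
Proof.
move=> st; have -> : expR (lam * (s - t)) * v r 0 = Phi s r s - 0.
  by rewrite /Phi subr0 subrr /E mxexp0 mul1mx.
apply: cvg_eq_near (cvgB (cvg_cst (Phi s r s)) (Phi_vanish s r)).
have nears : \forall n \near \oo, - n%:R < s.
  near=> n; rewrite ltrNl; near: n; exact: nbhs_infty_gtr.
near=> n; have ns : - n%:R < s by near: n.
have nt : - n%:R < t by exact: lt_le_trans ns st.
rewrite form_test// => [|c]; last exact: state_kernel_sqint HL HX s r c.
have GE u : (\sum_c p c 0 *: state_kernel A s r c) u =
    if u <= s then (E (s - u) *m (Bblock k q *m p)) r 0 else 0.
  rewrite fct_sumE /state_kernel; case: ifP => us; last first.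
    by rewrite big1// => c _; rewrite -[LHS]/(p c 0 * (if u <= s then _ else 0)) us mulr0.
  rewrite mulmxA mxE; apply: eq_bigr => c _.
  rewrite -[LHS]/(p c 0 * (if u <= s then _ else 0)) us mulrC.
  by rewrite BblockE mul_mx_Eblock.
rewrite (ip_windowE lam n st); last first.
  by move=> u su; rewrite GE leNgt su.
have FT := FTC_segment ns (Phi_derive s r) (@phi_continuous s r).
rewrite -[LHS]/(Phi s r s - Phi s r (- n%:R)) -FT.
apply: eq_Rintegral => u; rewrite inE/= in_itv/= => /andP[_ us].
by rewrite GE us.
Unshelve. all: by end_near. Qed.

Let test_comb (l : seq (R * (R * 'I_(dimX k q)))) : all (fun p => p.2.1 <= t) l ->
  form (kernel_comb A l) (test n) @[n --> \oo] -->
  \sum_(p <- l) p.1 * (expR (lam * (p.2.1 - t)) * v p.2.2 0).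
Proof.
move=> lt.
have sk (p0 : R * (R * 'I_(dimX k q))) :
    dom (fun c => p0.1 *: state_kernel A p0.2.1 p0.2.2 c).
  by move=> c; apply: (si_domZ siL); exact: state_kernel_sqint HL HX _ _ _.
have c : (\sum_(p0 <- l) p0.1 * form (state_kernel A p0.2.1 p0.2.2) (test n))
    @[n --> \oo] --> \sum_(p <- l) p.1 * (expR (lam * (p.2.1 - t)) * v p.2.2 0).
  elim: l lt => [_|p0 l IH /= /andP[p0t lt]].
    by rewrite big_nil; under eq_fun do rewrite big_nil; exact: cvg_cst.
  rewrite big_cons; under eq_fun do rewrite big_cons.
  by apply: cvgD (IH lt); apply: cvgMr; exact: test_kernel.
apply: cvg_eq_near c; near=> n.
have nt : - n%:R < t by rewrite ltrNl; near: n; exact: nbhs_infty_gtr.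
have -> : kernel_comb A l = \sum_(p0 <- l) (fun c => p0.1 *: state_kernel A p0.2.1 p0.2.2 c).
  by apply/funext => c0; rewrite fct_sumE.
rewrite (si_suml form_semi_inner) => [|p0 _|]; last 2 first.
- exact: sk.
- exact: test_dom.
apply: eq_bigr => p0 _.
apply/esym; apply: (si_Zl form_semi_inner); last exact: test_dom.
by move=> c0; exact: state_kernel_sqint HL HX _ _ _.
Unshelve. all: by end_near. Qed.

(** In the limit of the windows, the pairing with the test kernel takes the value
    e^{lam (s - t)} v_r on the kernel of the r-th coordinate of X(s). Only the
    coordinates of component a contribute, since v vanishes elsewhere, and the
    Cauchy-Schwarz inequality bounds the pairing by the norm in L^2. *)
Lemma power_sum_bound : exists2 K : R, 0 <= K &
  forall l : seq (R * (R * 'I_(dimX k q))), all (fun p => p.2.1 <= t) l ->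
    (\sum_(p <- l) p.1 * (expR (lam * (p.2.1 - t)) *
       \sum_(j < q.+1) lam ^+ j * (p.2.2 == blockpos j a)%:R)) ^+ 2 <=
    ip P (state_comb X l) (state_comb X l) * K.
Proof.
pose G : R := \sum_c \sum_c' S c c' * (g c 0 * g c' 0).
have G0 : 0 <= G by exact: S_psd.
exists (G * (2 * lam)^-1) => [|l lt].
  by rewrite mulr_ge0// invr_ge0 mulr_ge0// ltW.
have lim := test_comb lt.
have sk : dom (kernel_comb A l) by move=> c; exact: kernel_comb_sqint HL HX _ _.
pose s0 := \sum_(p <- l) p.1 * (expR (lam * (p.2.1 - t)) * v p.2.2 0).
have lim2 : (form (kernel_comb A l) (test n) * form (kernel_comb A l) (test n))
    @[n --> \oo] --> s0 * s0 by exact: (cvgM lim lim).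
have -> : \sum_(p <- l) p.1 * (expR (lam * (p.2.1 - t)) *
       \sum_(j < q.+1) lam ^+ j * (p.2.2 == blockpos j a)%:R) =
   \sum_(p <- l) p.1 * (expR (lam * (p.2.1 - t)) * v p.2.2 0).
  by apply: eq_bigr => p0 _; rewrite mxE.
rewrite expr2; apply: (ler_cvg_to lim2 (cvg_cst _)); near=> n.
have nt : - n%:R < t by rewrite ltrNl; near: n; exact: nbhs_infty_gtr.
have := cauchy_schwarz form_semi_inner sk (test_dom nt).
rewrite -[form (test n) (test n)](_ : G * ip lebesgue_measure (window lam t n) (window lam t n) = _); last first.
  rewrite /form /kernel_form mulr_suml; apply: eq_bigr => c _.
  rewrite mulr_suml; apply: eq_bigr => c' _; have [sw _] := window_sqint lam0 nt.
  by rewrite (si_Zl siL _ sw (si_domZ siL _ sw)) (si_Zr siL _ sw sw) /S; ring.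
rewrite expr2 => /le_trans; apply.
rewrite (state_comb_isometry HL HX) ler_wpM2l//.
  by have := si_ge0 form_semi_inner sk.
by rewrite ler_wpM2l//; have [] := window_sqint lam0 nt.
Unshelve. all: by end_near. Qed.

End fixed_rate.

(** A linear combination of the derivatives of one component can be read off,
    as a polynomial in the rate of the exponential weight, from functionals
    that do not see the other components. *)
Lemma state_independent t (a : 'I_k) (c : 'I_q.+1 -> R) :
  (forall e : R, 0 < e -> exists2 l : seq (R * (R * 'I_(dimX k q))),
     (forall p, p \in l -> p.2.1 <= t /\ exists2 v, v != a & p.2.2 = blockpos ord0 v) &
     let Z := \sum_j c j *: x t (blockpos j a) - state_comb X l in ip P Z Z < e) ->
  forall j, c j = 0.
Proof.
move=> approx; apply: (@coef_eq0_large_roots _ _ _ (Num.max (entry_sum M) 0)) => y.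
rewrite gt_max => /andP[yM y0]; have [K K0 bound] := power_sum_bound t a y0 yM.
set z := \sum_j _; have zK e : 0 < e -> z ^+ 2 <= e * K.
  move=> /approx[l lP Ze].
  pose l' := [seq (c j, (t, blockpos j a)) | j <- index_enum 'I_q.+1] ++
    [seq (- p.1, p.2) | p <- l].
  have l't : all (fun p => p.2.1 <= t) l'.
    by rewrite all_cat !all_map; apply/andP; split; apply/allP => p //= /lP[].
  have combE : state_comb X l' = \sum_j c j *: x t (blockpos j a) - state_comb X l.
    rewrite /state_comb big_cat !big_map; congr (_ + _); rewrite -sumrN.
    by apply: eq_bigr => p _; rewrite scaleNr.
  apply: le_trans (ler_wpM2r K0 (ltW Ze)); rewrite /= -combE.
  apply: le_trans (bound _ l't); rewrite big_cat !big_map /=.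
  rewrite [X in _ + X]big_seq [X in _ + X]big1 ?addr0; last first.
    move=> p /lP[_ [v va ->]]; rewrite big1 ?mulr0// => j _.
    by rewrite blockpos_inj (negbTE va) andbF mulr0.
  rewrite le_eqVlt; apply/orP; left; apply/eqP; congr (_ ^+ 2); apply: eq_bigr => j _.
  rewrite subrr mulr0 expR0 mul1r (bigD1 j)//= eqxx mulr1 big1 ?addr0// => i ij.
  by rewrite blockpos_inj eq_sym (negbTE ij) mulr0.
apply/eqP; rewrite -sqrf_eq0 eq_le sqr_ge0 andbT; apply/ler_addgt0Pr => e e0.
rewrite add0r; have K1 : 0 < K + 1 by rewrite ltr_wpDl.
apply: le_trans (zK (e / (K + 1)) (divr_gt0 e0 K1)) _.
by rewrite mulrAC ler_pdivrMr// ler_wpM2l ?lerDl// ltW.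
Qed.

End test_functional.

(** * Complex random variables and projections on closed spans *)

Section complex_L2.
Context {R : realType} {d : measure_display} {T : measurableType d}.
Variable P : probability T R.
Implicit Types (X Y Z W : T -> R[i]) (G H : set (T -> R[i])) (c : R[i]).
Let siP := sqint_semi_inner P.

Definition re_part X : T -> R := fun w => complex.Re (X w).
Definition im_part X : T -> R := fun w => complex.Im (X w).
Definition cscale c X : T -> R[i] := fun w => c * X w.
Definition of_real (f : T -> R) : T -> R[i] := fun w => (f w)%:C%C.

(** The real part of the inner product. It turns L^2 into a real Hilbert space,
    where the complex inner product is recovered as
    [rip X Y + i * rip X (i Y)]. *)
Definition rip X Y : R :=
  ip P (re_part X) (re_part Y) + ip P (im_part X) (im_part Y).

Definition imul X := cscale (0 +i* 1)%C X.

Lemma re_partD X Y : re_part (X + Y) = re_part X + re_part Y.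
Proof. by apply/funext => w; rewrite /re_part /= !fctE; case: (X w) (Y w) => ? ? []. Qed.

Lemma im_partD X Y : im_part (X + Y) = im_part X + im_part Y.
Proof. by apply/funext => w; rewrite /im_part /= !fctE; case: (X w) (Y w) => ? ? []. Qed.

Lemma re_part_cscale c X :
  re_part (cscale c X) = complex.Re c *: re_part X - complex.Im c *: im_part X.
Proof. apply/funext => w; rewrite /re_part /cscale.
rewrite -[RHS]/(complex.Re c * complex.Re (X w) - complex.Im c * complex.Im (X w)).
by case: c (X w) => ? ? []. Qed.

Lemma im_part_cscale c X :
  im_part (cscale c X) = complex.Re c *: im_part X + complex.Im c *: re_part X.
Proof. apply/funext => w; rewrite /im_part /cscale.
rewrite -[RHS]/(complex.Re c * complex.Im (X w) + complex.Im c * complex.Re (X w)).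
by case: c (X w) => ? ? []. Qed.

Lemma Lfun2P (f : T -> R) : f \in Lfun P 2%:E <-> sqint P f.
Proof.
split=> [fL|[mf sf]].
  split; last exact: Lfun2_integrable_sqr.
  by move: fL; rewrite inE => /andP[mf _]; move: mf; rewrite inE.
rewrite inE; apply/andP; split; first by rewrite inE.
rewrite inE /finite_norm unlock /=.
apply: poweR_lty; move/integrableP: sf => [_].
apply: le_lt_trans; rewrite le_eqVlt; apply/orP; left; apply/eqP.
apply: eq_integral => w _ /=.
by rewrite normrX; congr EFin; exact: (powR_mulrn 2).
Qed.

Lemma cL2P X : cL2 P X <-> sqint P (re_part X) /\ sqint P (im_part X).
Proof. by split=> -[/Lfun2P ? /Lfun2P ?]. Qed.

Lemma cL2_cscale c X : cL2 P X -> cL2 P (cscale c X).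
Proof.
move=> /cL2P[sr si]; apply/cL2P; rewrite re_part_cscale im_part_cscale; split.
  by apply: (si_domB siP); exact: (si_domZ siP).
by apply: (si_domD siP); exact: (si_domZ siP).
Qed.

Lemma cscaleN1 X : cscale (-1) X = - X.
Proof. by apply/funext => w; rewrite /cscale mulN1r. Qed.

Lemma rip_semi_inner : semi_inner (fun a : R => cscale a%:C%C) (cL2 P) rip.
Proof.
split.
- by apply/cL2P; split; exact: (si_dom0 siP).
- move=> X Y /cL2P[? ?] /cL2P[? ?]; apply/cL2P; rewrite re_partD im_partD.
  by split; exact: (si_domD siP).
- by move=> X sX; rewrite -cscaleN1; exact: cL2_cscale.
- by move=> a X; exact: cL2_cscale.
- move=> X Y Z /cL2P[? ?] /cL2P[? ?] /cL2P[? ?]; rewrite /rip re_partD im_partD.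
  by rewrite !(si_Dl siP)//; ring.
- move=> a X Y /cL2P[? ?] /cL2P[? ?].
  rewrite /rip re_part_cscale im_part_cscale /= !scale0r subr0 addr0.
  by rewrite !(si_Zl siP)// mulrDr.
- by move=> X Y /cL2P[? ?] /cL2P[? ?]; rewrite /rip; congr (_ + _); exact: (si_C siP).
- by move=> X /cL2P[? ?]; rewrite addr_ge0//; exact: (si_ge0 siP).
Qed.
Let sic := rip_semi_inner.

Lemma cL2_complete : si_complete (cL2 P) rip.
Proof.
move=> x sx dx.
have sre n : sqint P (re_part (x n)) by have /cL2P[] := sx n.
have sim n : sqint P (im_part (x n)) by have /cL2P[] := sx n.
have BE n Z : rip (x n - Z) (x n - Z) =
    ip P (re_part (x n) - re_part Z) (re_part (x n) - re_part Z) +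
    ip P (im_part (x n) - im_part Z) (im_part (x n) - im_part Z).
  by rewrite /rip re_partD im_partD -cscaleN1 re_part_cscale im_part_cscale /=
    oppr0 !scale0r subr0 addr0 !scaleN1r.
have dre n : ip P (re_part (x n.+1) - re_part (x n)) (re_part (x n.+1) - re_part (x n)) <=
    4^-1 ^+ n.
  apply: le_trans (dx n); rewrite BE lerDl.
  exact: (si_ge0 siP (si_domB siP (sim n.+1) (sim n))).
have dim n : ip P (im_part (x n.+1) - im_part (x n)) (im_part (x n.+1) - im_part (x n)) <=
    4^-1 ^+ n.
  apply: le_trans (dx n); rewrite BE lerDr.
  exact: (si_ge0 siP (si_domB siP (sre n.+1) (sre n))).
have [u su cu] := sqint_complete sre dre.
have [v sv cv] := sqint_complete sim dim.
exists (fun w => (u w +i* v w)%C); first by apply/cL2P.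
under eq_fun do rewrite BE.
by rewrite -[0 : R]addr0; exact: cvgD.
Qed.

Lemma cinnerE X Y : cL2 P X -> cL2 P Y ->
  cinner P X Y = (rip X Y +i* rip X (imul Y))%C.
Proof.
move=> /cL2P[rX iX] /cL2P[rY iY].
have fE (f : T -> R) : fine (expectation P f) = \int[P]_w f w by rewrite unlock.
rewrite /cinner /cexpectation !fE /rip re_part_cscale im_part_cscale /=.
rewrite !scale0r !scale1r sub0r add0r; congr (_ +i* _)%C.
  apply: etrans (RintegralD measurableT (sqint_int_mul rX rY) (sqint_int_mul iX iY)).
  by apply: eq_Rintegral => w _; rewrite /re_part /im_part; case: (X w) (Y w) => ? ? [? ?] /=; ring.
have rY' := si_domN siP iY.
apply: etrans (RintegralD measurableT (sqint_int_mul rX rY') (sqint_int_mul iX rY)).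
apply: eq_Rintegral => w _; rewrite !fctE /re_part /im_part; case: (X w) (Y w) => ? ? [? ?] /=; ring.
Qed.

Lemma cinner_eq0 X Y : cL2 P X -> cL2 P Y ->
  cinner P X Y = 0 <-> rip X Y = 0 /\ rip X (imul Y) = 0.
Proof.
move=> sX sY; rewrite cinnerE//; split=> [[-> ->]//|[-> ->]//].
Qed.

Lemma rip_imul X Y : cL2 P X -> cL2 P Y -> rip (imul X) Y = - rip X (imul Y).
Proof.
move=> /cL2P[? ?] /cL2P[? ?].
rewrite /rip !re_part_cscale !im_part_cscale /= !scale0r !scale1r !sub0r !add0r.
by rewrite (si_Nl siP)// (si_Nr siP)//; ring.
Qed.

Lemma msdist2E X Y : cL2 P X -> cL2 P Y -> msdist2 P X Y = (rip (X - Y) (X - Y))%:E.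
Proof.
move=> sX sY; have /cL2P[sr si] := si_domB sic sX sY.
rewrite /msdist2 unlock /rip EFinD -(integral_sqrE sr) -(integral_sqrE si).
rewrite -ge0_integralD//.
- by move=> w _; rewrite lee_fin sqr_ge0.
- by apply/measurable_EFinP; apply: measurable_funX; case: sr.
- by move=> w _; rewrite lee_fin sqr_ge0.
- by apply/measurable_EFinP; apply: measurable_funX; case: si.
Qed.

Lemma ms_cvgP {I : Type} (F : set_system I) {FF : Filter F} (x : I -> T -> R[i]) Z :
  ms_cvg P F x Z <-> [/\ \forall i \near F, cL2 P (x i), cL2 P Z &
    rip (x i - Z) (x i - Z) @[i --> F] --> 0].
Proof.
have near_msdist : (\forall i \near F, cL2 P (x i)) -> cL2 P Z ->
    \forall i \near F, msdist2 P (x i) Z = (rip (x i - Z) (x i - Z))%:E.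
  by move=> sx sZ; apply: filterS sx => i sxi; exact: msdist2E.
split=> -[sx sZ c]; split => //; have E := near_msdist sx sZ.
  by apply: cvg_eq_near (fine_cvg c); apply: filterS E => i /= ->.
apply: (@cvg_EFin _ _ _ FF); first by apply: filterS E => i ->.
by apply: cvg_eq_near c; apply: filterS E => i /= ->.
Qed.

Lemma of_realD (f g : T -> R) : of_real (f + g) = of_real f + of_real g.
Proof. by apply/funext => w; exact: (rmorphD (real_complex R)). Qed.

Lemma of_realZ (a : R) (f : T -> R) : of_real (a *: f) = cscale a%:C%C (of_real f).
Proof. by apply/funext => w; exact: (rmorphM (real_complex R)). Qed.

Lemma of_realB (f g : T -> R) : of_real (f - g) = of_real f - of_real g.
Proof. by apply/funext => w; exact: (rmorphB (real_complex R)). Qed.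

Lemma of_real_sum I (r : seq I) (p : pred I) (f : I -> T -> R) :
  of_real (\sum_(i <- r | p i) f i) = \sum_(i <- r | p i) of_real (f i).
Proof. by elim/big_rec2: _ => [//|i y z _ <-]; rewrite of_realD. Qed.

Lemma cL2_of_real f : cL2 P (of_real f) <-> sqint P f.
Proof.
rewrite cL2P; split=> [[]//|sf]; split => //; exact: (si_dom0 siP).
Qed.

Lemma rip_of_real f g : rip (of_real f) (of_real g) = ip P f g.
Proof.
by rewrite /rip [X in _ + X](_ : _ = 0) ?addr0// (si_0l siP)//; exact: (si_dom0 siP).
Qed.

Lemma rip_of_real_imul f g : sqint P f -> sqint P g -> rip (of_real f) (imul (of_real g)) = 0.
Proof.
move=> sf sg; rewrite /rip re_part_cscale im_part_cscale /= !scale0r scale1r scale1r.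
have z0 := si_dom0 siP.
have -> : im_part (of_real g) = 0 by [].
have -> : im_part (of_real f) = 0 by [].
by rewrite subr0 add0r (si_0r siP)// (si_0l siP)// addr0.
Qed.

Lemma rip0_ae X Y : cL2 P X -> cL2 P Y -> rip (X - Y) (X - Y) = 0 ->
  {ae P, forall w, X w = Y w}.
Proof.
move=> sX sY; have /cL2P[sr si] := si_domB sic sX sY.
rewrite /rip => /eqP; rewrite paddr_eq0 ?(si_ge0 siP sr) ?(si_ge0 siP si)//.
move=> /andP[/eqP r0 /eqP i0].
apply: filterS2 (ip0_ae sr r0) (ip0_ae si i0) => w.
rewrite /re_part /im_part !fctE; case: (X w) (Y w) => [a b] [a' b'] /= /eqP.
by rewrite subr_eq0 => /eqP-> /eqP; rewrite subr_eq0 => /eqP->.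
Qed.

Lemma ae_rip0 X Y : cL2 P X -> cL2 P Y -> {ae P, forall w, X w = Y w} ->
  rip (X - Y) (X - Y) = 0.
Proof.
move=> sX sY XY; have /cL2P[[mr _] [mi _]] := si_domB sic sX sY.
have rXY : {ae P, forall w, re_part (X - Y) w = 0}.
  by apply: filterS XY => w E; rewrite /re_part !fctE E subrr.
have iXY : {ae P, forall w, im_part (X - Y) w = 0}.
  by apply: filterS XY => w E; rewrite /im_part !fctE E subrr.
by rewrite /rip (ip_ae0 mr rXY).2 (ip_ae0 mi iXY).2 addr0.
Qed.

Section closed_span.
Variable G : set (T -> R[i]).
Hypothesis GL2 : G `<=` cL2 P.

Lemma lin_span_cL2 : lin_span G `<=` cL2 P.
Proof.
move=> _ [n [c [g [Gg ->]]]].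
rewrite (_ : (fun w => _) = \sum_i cscale (c i) (g i)); last first.
  by apply/funext => w; rewrite fct_sumE.
by apply: (si_dom_sum sic) => i _; apply: cL2_cscale; exact: GL2.
Qed.

Lemma lin_spanD X Y : lin_span G X -> lin_span G Y -> lin_span G (X + Y).
Proof.
move=> [n [c [g [Gg ->]]]] [m [e [h [Gh ->]]]]; exists (n + m)%N.
exists (fun i => match fintype.split i with inl j => c j | inr j => e j end).
exists (fun i => match fintype.split i with inl j => g j | inr j => h j end).
split=> [i|]; first by case: (fintype.split i) => j; [exact: Gg|exact: Gh].
apply/funext => w; rewrite big_split_ord/=; congr (_ + _); apply: eq_bigr => i _.
  by rewrite (unsplitK (inl i)).
by rewrite (unsplitK (inr i)).
Qed.

Lemma lin_span_cscale c X : lin_span G X -> lin_span G (cscale c X).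
Proof.
move=> [n [e [g [Gg ->]]]]; exists n, (fun i => c * e i), g; split => //.
by apply/funext => w; rewrite /cscale mulr_sumr; apply: eq_bigr => i _; rewrite mulrA.
Qed.

Lemma lin_span_gen X : G X -> lin_span G X.
Proof.
move=> GX; exists 1%N, (fun=> 1), (fun=> X); split => //.
by apply/funext => w; rewrite big_ord1 mul1r.
Qed.

Lemma lin_span0 : lin_span G 0.
Proof.
exists 0%N, (fun=> 0), (fun=> 0); split; first by case.
by apply/funext => w; rewrite big_ord0.
Qed.

Lemma closed_spanP Z : closed_span P G Z <-> cL2 P Z /\
  forall e : R, 0 < e -> exists2 X, lin_span G X & rip (X - Z) (X - Z) < e.
Proof.
split=> -[sZ H]; split => // e /H[X GX XZ]; exists X => //; move: XZ;
  by rewrite msdist2E ?lte_fin//; exact: lin_span_cL2.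
Qed.

Lemma closed_span_cL2 : closed_span P G `<=` cL2 P. Proof. by move=> Z []. Qed.

(** Closed spans are closed under limits within themselves, although their
    definition only speaks of limits of finite combinations. *)
Lemma closed_span_closed Z : cL2 P Z ->
  (forall e : R, 0 < e -> exists2 X, closed_span P G X & rip (X - Z) (X - Z) < e) ->
  closed_span P G Z.
Proof.
move=> sZ H; apply/closed_spanP; split => // e e0.
have e4 : 0 < e / 4 by rewrite divr_gt0.
have [X /closed_spanP[sX HX] XZ] := H _ e4; have [Y GY YX] := HX _ e4.
exists Y => //; apply: le_lt_trans (si_sqr_triangle sic (lin_span_cL2 GY) sX sZ) _.
lra.
Qed.

Lemma lin_span_closed_span : lin_span G `<=` closed_span P G.
Proof.
move=> X GX; apply/closed_spanP; split; first exact: lin_span_cL2.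
by move=> e e0; exists X => //; rewrite subrr (si_0l sic)//; exact: (si_dom0 sic).
Qed.

Lemma closed_span_gen X : G X -> closed_span P G X.
Proof. by move=> /lin_span_gen /lin_span_closed_span. Qed.

Lemma closed_span0 : closed_span P G 0.
Proof. exact/lin_span_closed_span/lin_span0. Qed.

Lemma closed_spanD X Y : closed_span P G X -> closed_span P G Y ->
  closed_span P G (X + Y).
Proof.
move=> /closed_spanP[sX HX] /closed_spanP[sY HY].
apply/closed_spanP; split; first exact: (si_domD sic).
move=> e e0; have e4 : 0 < e / 4 by rewrite divr_gt0.
have [X' GX' XX'] := HX _ e4; have [Y' GY' YY'] := HY _ e4.
exists (X' + Y'); first exact: lin_spanD.
have sX' := lin_span_cL2 GX'; have sY' := lin_span_cL2 GY'.
rewrite opprD addrACA.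
apply: le_lt_trans (si_sqrD_le sic (si_domB sic sX' sX) (si_domB sic sY' sY)) _.
lra.
Qed.

Lemma rip_cscale c X : cL2 P X ->
  rip (cscale c X) (cscale c X) = (complex.Re c ^+ 2 + complex.Im c ^+ 2) * rip X X.
Proof.
move=> /cL2P[? ?]; rewrite /rip re_part_cscale im_part_cscale.
have sZ a f := @si_domZ _ _ _ _ _ siP a f.
rewrite (si_sqrB siP) ?(si_sqrD siP)//; try exact: sZ.
rewrite !(si_Zl siP) ?(si_Zr siP)//; try exact: sZ.
by rewrite (@si_C _ _ _ _ _ siP (im_part X) (re_part X))//; ring.
Qed.

Lemma closed_span_cscale c X : closed_span P G X -> closed_span P G (cscale c X).
Proof.
move=> /closed_spanP[sX HX]; apply/closed_spanP; split; first exact: cL2_cscale.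
move=> e e0; pose K := complex.Re c ^+ 2 + complex.Im c ^+ 2.
have K0 : 0 <= K by rewrite addr_ge0 ?sqr_ge0.
have K1 : 0 < K + 1 by rewrite ltr_wpDl.
have [Y GY YX] := HX _ (divr_gt0 e0 K1).
exists (cscale c Y); first exact: lin_span_cscale.
rewrite (_ : cscale c Y - cscale c X = cscale c (Y - X)); last first.
  by apply/funext => w; rewrite /cscale !fctE mulrBr.
have sYX := si_domB sic (lin_span_cL2 GY) sX.
rewrite rip_cscale// -/K; move: YX; rewrite ltr_pdivlMr//; apply: le_lt_trans.
by rewrite mulrC ler_wpM2l ?(si_ge0 sic)// lerDl.
Qed.

Lemma closed_spanB X Y : closed_span P G X -> closed_span P G Y ->
  closed_span P G (X - Y).
Proof.
by move=> GX GY; rewrite -cscaleN1; apply: closed_spanD => //; exact: closed_span_cscale.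
Qed.

Lemma closed_span_sum I (r : seq I) (p : pred I) (x : I -> T -> R[i]) :
  (forall i, p i -> closed_span P G (x i)) -> closed_span P G (\sum_(i <- r | p i) x i).
Proof. by move=> Gx; elim/big_ind: _ => //; [exact: closed_span0|exact: closed_spanD]. Qed.

Lemma closed_span_limit {I : Type} (F : set_system I) {FF : ProperFilter F}
    (x : I -> T -> R[i]) Z : (\forall i \near F, closed_span P G (x i)) -> cL2 P Z ->
  rip (x i - Z) (x i - Z) @[i --> F] --> 0 -> closed_span P G Z.
Proof.
move=> Gx sZ c; apply: closed_span_closed => // e e0.
near F => i; exists (x i); near: i => //.
exact: (cvgr_lt _ c _ e0).
Unshelve. all: by end_near. Qed.

(** Both real conditions on the generators are needed to have orthogonality
    to their complex multiples. *)
Lemma orth_closed_span X : cL2 P X ->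
  (forall Y, G Y -> rip X Y = 0 /\ rip X (imul Y) = 0) ->
  forall Z, closed_span P G Z -> rip X Z = 0.
Proof.
move=> sX H Z /closed_spanP[sZ HZ].
have X0 Y : lin_span G Y -> rip X Y = 0.
  move=> [n [c [g [Gg ->]]]].
  rewrite (_ : (fun w => _) = \sum_i cscale (c i) (g i)); last first.
    by apply/funext => w; rewrite fct_sumE.
  rewrite (si_sumr sic) => [|i _|//]; last by apply: cL2_cscale; exact: GL2.
  rewrite big1// => i _.
  rewrite (_ : cscale (c i) (g i) = cscale (complex.Re (c i))%:C%C (g i) +
    cscale (complex.Im (c i))%:C%C (imul (g i))); last first.
    apply/funext => w; rewrite /imul /cscale !fctE; case: (c i) (g i w) => a b [a' b'] /=.
    by apply/eqP; rewrite eq_complex /=; apply/andP; split; apply/eqP; ring.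
  have [r0 i0] := H _ (Gg i); have sg := GL2 (Gg i).
  rewrite (si_Dr sic)//; try exact: cL2_cscale; last by do 2 apply: cL2_cscale.
  by rewrite !(si_Zr sic)// ?r0 ?i0 ?mulr0 ?addr0//; exact: cL2_cscale.
apply/eqP; rewrite -sqrf_eq0 eq_le sqr_ge0 andbT; apply/ler_addgt0Pr => e e0.
rewrite add0r; have K0 := si_ge0 sic sX.
have K1 : 0 < rip X X + 1 by rewrite ltr_wpDl.
have [Y GY YZ] := HZ _ (divr_gt0 e0 K1).
have sY := lin_span_cL2 GY; have sYZ := si_domB sic sY sZ.
rewrite -[rip X Z]opprK sqrrN -[- rip X Z]add0r -(X0 _ GY) -(si_Br sic)//.
apply: le_trans (cauchy_schwarz sic sX sYZ) _.
apply: le_trans (ler_wpM2l K0 (ltW YZ)) _.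
by rewrite mulrCA ler_piMr ?(ltW e0)// ler_pdivrMr// mul1r lerDl.
Qed.

Lemma orthoproj_prop X : cL2 P X ->
  closed_span P G (orthoproj P (closed_span P G) X) /\
  forall W, closed_span P G W -> rip (X - orthoproj P (closed_span P G) X) W = 0.
Proof.
move=> sX.
have half (Y : T -> R[i]) : cL2 P Y -> cscale (2^-1)%:C%C Y + cscale (2^-1)%:C%C Y = Y.
  move=> _; apply/funext => w; rewrite /cscale !fctE -mulrDl -[RHS]mul1r; congr (_ * _).
  by apply/eqP; rewrite eq_complex /= addr0 eqxx andbT; apply/eqP; field.
have [Z [sZ appr orth]] := projection_exists sic cL2_complete closed_span_cL2
   closed_span0 closed_spanD (fun a Y => @closed_span_cscale a%:C%C Y) half sX.
have GZ : closed_span P G Z.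
  by apply: closed_span_closed => // e /appr[W GW WZ]; exists W.
rewrite /orthoproj; case: xgetP => [Z' -> [GZ' orth']|/(_ Z)[]].
  split => // W GW; have /cinner_eq0[]// := orth' _ GW; last exact: closed_span_cL2.
  by apply: (si_domB sic) => //; exact: closed_span_cL2.
split => // W GW; apply/cinner_eq0.
- exact: (si_domB sic).
- exact: closed_span_cL2.
- by split; apply: orth => //; exact: closed_span_cscale.
Qed.

Lemma orthoproj_unique X Z : cL2 P X -> closed_span P G Z ->
  (forall W, closed_span P G W -> rip (X - Z) W = 0) ->
  let Z' := orthoproj P (closed_span P G) X in rip (Z' - Z) (Z' - Z) = 0.
Proof.
move=> sX GZ orth Z'; have [GZ' orth'] := orthoproj_prop sX.
have GD := closed_spanB GZ' GZ.
have sZ := closed_span_cL2 GZ; have sZ' := closed_span_cL2 GZ'; have sD := closed_span_cL2 GD.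
have -> : rip (Z' - Z) (Z' - Z) = rip (X - Z) (Z' - Z) - rip (X - Z') (Z' - Z).
  rewrite -(si_Bl sic)//; try exact: (si_domB sic).
  have -> // : X - Z - (X - Z') = Z' - Z by rewrite opprB addrC subrKA.
by rewrite orth// orth'// subrr.
Qed.

Lemma orthoproj_id X : closed_span P G X ->
  let Z := orthoproj P (closed_span P G) X in rip (X - Z) (X - Z) = 0.
Proof.
move=> GX Z; have sX := closed_span_cL2 GX; have [GZ orth] := orthoproj_prop sX.
by apply: orth; exact: closed_spanB.
Qed.

End closed_span.

Lemma closed_span_sub G H : G `<=` H -> closed_span P G `<=` closed_span P H.
Proof.
move=> GH Z [sZ HZ]; split => // e /HZ[X [n [c [g [Gg XE]]]] XZ]; exists X => //.
by exists n, c, g; split => // i; exact: GH.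
Qed.

End complex_L2.

(** * Granger non-causality of the state process *)

Section null_equality.
Context {R : realType} {d : measure_display} {T : measurableType d}.
Variable P : probability T R.
Implicit Types (X Y Z : T -> R[i]).
Let sic := rip_semi_inner P.

(** Almost sure equality in L^2, in the form in which it is produced by
    limits and projections. *)
Definition null_eq X Y := [/\ cL2 P X, cL2 P Y & rip P (X - Y) (X - Y) = 0].

Lemma null_eq_refl X : cL2 P X -> null_eq X X.
Proof. by move=> sX; split => //; rewrite subrr (si_0l sic)//; exact: (si_dom0 sic). Qed.

Lemma null_eq_sym X Y : null_eq X Y -> null_eq Y X.
Proof. by move=> [sX sY n]; split => //; rewrite (si_sqr_distC sic). Qed.

Lemma null_eqD X X' Y Y' : null_eq X X' -> null_eq Y Y' -> null_eq (X + Y) (X' + Y').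
Proof.
move=> [sX sX' n] [sY sY' n']; split; try exact: (si_domD sic).
by rewrite opprD addrACA; apply: (si_nullD sic) => //; exact: (si_domB sic).
Qed.

Lemma null_eq_cscale c X X' : null_eq X X' -> null_eq (cscale c X) (cscale c X').
Proof.
move=> [sX sX' n]; split; try exact: cL2_cscale.
rewrite (_ : cscale c X - cscale c X' = cscale c (X - X')); last first.
  by apply/funext => w; rewrite /cscale !fctE mulrBr.
by rewrite rip_cscale ?n ?mulr0//; exact: (si_domB sic).
Qed.

Lemma null_eqB X X' Y Y' : null_eq X X' -> null_eq Y Y' -> null_eq (X - Y) (X' - Y').
Proof. by move=> n n'; rewrite -!cscaleN1; apply: null_eqD => //; exact: null_eq_cscale. Qed.

Lemma null_eq_trans X Y Z : null_eq X Y -> null_eq Y Z -> null_eq X Z.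
Proof.
move=> XY YZ; have := null_eqD XY YZ => -[_ _]; have [sX _ _] := XY; have [sY sZ _] := YZ.
by rewrite opprD addrACA [X - Y + _](subrKA Y) => ?; split.
Qed.

Lemma null_eq_sum I (r : seq I) (p : pred I) (x y : I -> T -> R[i]) :
  (forall i, p i -> null_eq (x i) (y i)) ->
  null_eq (\sum_(i <- r | p i) x i) (\sum_(i <- r | p i) y i).
Proof.
move=> xy; elim/big_rec2: _ => [|i X Y pi]; first exact: null_eq_refl (si_dom0 sic).
by move=> n; apply: null_eqD => //; exact: xy.
Qed.

Lemma null_eq_rip X X' Z : null_eq X X' -> cL2 P Z -> rip P X Z = rip P X' Z.
Proof.
move=> [sX sX' n] sZ; apply/eqP; rewrite -subr_eq0 -(si_Bl sic)//; apply/eqP.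
by apply: (si_null sic) => //; exact: (si_domB sic).
Qed.

Lemma null_eq_dist X X' Z : null_eq X X' -> cL2 P Z ->
  rip P (X - Z) (X - Z) = rip P (X' - Z) (X' - Z).
Proof.
move=> n sZ; have n' := null_eqB n (null_eq_refl sZ).
have [sD sD' _] := n'.
by rewrite (null_eq_rip n' sD) (si_C sic)// (null_eq_rip n' sD').
Qed.

Lemma null_eqP X Y : cL2 P X -> cL2 P Y ->
  null_eq X Y <-> {ae P, forall w, X w = Y w}.
Proof.
by move=> sX sY; split=> [[_ _]|XY]; [exact: rip0_ae|split => //; exact: ae_rip0].
Qed.

Lemma ms_cvg_unique {I : Type} (F : set_system I) {FF : ProperFilter F}
    (x : I -> T -> R[i]) Z Z' : ms_cvg P F x Z -> ms_cvg P F x Z' -> null_eq Z Z'.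
Proof.
move=> /ms_cvgP[sx sZ c] /ms_cvgP[_ sZ' c']; split => //.
exact: (si_cvg_unique sic sx sZ sZ' c c').
Qed.

Lemma ms_cvg_null {I : Type} (F : set_system I) {FF : Filter F}
    (x y : I -> T -> R[i]) Z : (\forall i \near F, null_eq (x i) (y i)) ->
  ms_cvg P F y Z -> ms_cvg P F x Z.
Proof.
move=> xy /ms_cvgP[sy sZ c]; apply/ms_cvgP; split => //.
  by apply: filterS xy => i [].
apply: cvg_eq_near c; apply: filterS xy => i n.
by rewrite (null_eq_dist n).
Qed.

End null_equality.

Lemma dnbhs_at_left {R : realFieldType} (a : R) : a^'- `=>` a^'.
Proof. by move=> U; apply: (@filterS _ (nbhs a)) => h Uh ha; apply: Uh; rewrite lt_eqF. Qed.

Lemma dnbhs_at_right {R : realFieldType} (a : R) : a^'+ `=>` a^'.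
Proof. by move=> U; apply: (@filterS _ (nbhs a)) => h Uh ha; apply: Uh; rewrite gt_eqF. Qed.

Section granger.
Context {R : realType} {d : measure_display} {T : measurableType d}.
Variables (P : probability T R) (k q : nat) (A : 'I_q.+1 -> 'M[R]_k).
Variables (L Y : R -> T -> 'cV[R]_k) (X : R -> T -> 'cV[R]_(dimX k q)).
Hypothesis HL : driving_levy P L.
Hypothesis HX : forall t, is_levy_integral P L
  (fun u => if u <= t then mxexp ((t - u) *: companion A) *m Bblock k q else 0) (X t).
Hypothesis pos : posdefmx (levy_cov P L).
Hypothesis YE : forall t w, Y t w = Cblock k q *m X t w.
Let sic := rip_semi_inner P.
Let siP := sqint_semi_inner P.
Let E (h : R) := mxexp (h *: companion A).
Let x t r : T -> R := fun w => X t w r 0.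
Let cx t r : T -> R[i] := of_real (x t r).
Let past (B : set 'I_k) t := lin_past P Y B `]-oo, t].
Let prj B t := orthoproj P (past B t).

Let cx_cL2 t r : cL2 P (cx t r).
Proof. by apply/cL2_of_real; exact: state_sqint HL HX _ _. Qed.

Let componentE v t : component Y v t = cx t (blockpos ord0 v).
Proof. by apply/funext => w; rewrite /component YE mul_Cblock_mx. Qed.

Let gens (B : set 'I_k) (J : set R) : set (T -> R[i]) :=
  [set Z | exists v u, [/\ B v, J u & Z = component Y v u]].

Let gens_cL2 B J : gens B J `<=` cL2 P.
Proof. by move=> _ [v [u [_ _ ->]]]; rewrite componentE; exact: cx_cL2. Qed.

Let past_cL2 B t : past B t `<=` cL2 P.
Proof. by move=> Z []. Qed.

Let past_sub B B' t : B `<=` B' -> past B t `<=` past B' t.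
Proof.
move=> BB'; apply: closed_span_sub => _ [v [u [Bv tu ->]]].
by exists v, u; split => //; exact: BB'.
Qed.

(** All derivatives of a component are recovered from its past, as limits of
    difference quotients taken to the left. *)
Lemma past_state (B : set 'I_k) v j s t : B v -> s <= t -> past B t (cx s (blockpos j v)).
Proof.
move=> Bv; elim: {j}(nat_of_ord j) {-2}j (erefl (nat_of_ord j)) s => [|n IH] j jn s st.
  have -> : j = ord0 by apply/val_inj.
  apply: closed_span_gen; first exact: gens_cL2.
  by rewrite -componentE; exists v, s; split => //; rewrite /= in_itv.
have nq : (n < q.+1)%N by rewrite ltnW// -jn ltn_ord.
have D0 := @state_deriv _ _ _ P k q A L X HL HX s (Ordinal nq) j v jn.
pose Q h := cscale h^-1%:C%C (cx (s + h) (blockpos (Ordinal nq) v) - cx s (blockpos (Ordinal nq) v)).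
apply: (@closed_span_limit _ _ _ P _ (@gens_cL2 _ _) _ 0^'- _ Q).
- near=> h; have h0 : h <= 0 by near: h; exact: nbhs_left_le.
  apply: closed_span_cscale; first exact: gens_cL2.
  apply: closed_spanB; first exact: gens_cL2.
    by apply: IH => //; rewrite -[leRHS]addr0 lerD.
  exact: IH.
- exact: cx_cL2.
- have {D0} := cvg_trans (cvg_app _ (@dnbhs_at_left _ 0)) D0.
  apply: cvg_eq_near; near=> h; rewrite /= -rip_of_real of_realB of_realZ.
  by rewrite of_realB.
Unshelve. all: by end_near. Qed.

Let noise_past B t h r W : 0 <= h -> past B t W ->
  rip P (of_real (noise A X t h r)) W = 0.
Proof.
move=> h0; apply: orth_closed_span; first exact: gens_cL2.
  by apply/cL2_of_real; exact: noise_sqint HL HX _ _ _.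
move=> _ [v [u [_ ut ->]]]; rewrite componentE rip_of_real rip_of_real_imul.
- split => //; apply: noise_orth HL HX _ _ _ _ _ h0 _.
  by move: ut; rewrite /= in_itv.
- exact: noise_sqint HL HX _ _ _.
- exact: state_sqint HL HX _ _.
Qed.

Definition off_block (a : 'I_k) (s : 'I_(dimX k q)) := [forall j, s != blockpos j a].

Lemma off_blockE a j c : off_block a (blockpos j c) = (c != a).
Proof.
apply/forallP/idP => [/(_ j)|ca i]; first by rewrite blockpos_inj eqxx.
by rewrite blockpos_inj negb_and ca orbT.
Qed.

Lemma sum_block (V : nmodType) (F : 'I_(dimX k q) -> V) a :
  \sum_s F s = \sum_j F (blockpos j a) + \sum_(s | off_block a s) F s.
Proof.
rewrite (bigID (off_block a))/= addrC; congr (_ + _).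
rewrite (reindex_onto (fun j => blockpos j a) (fun s => tagnat.sig1 s)) /=.
  by apply: eq_bigl => j; rewrite off_blockE eqxx /blockpos tagnat.Rank1K eqxx.
move=> s; have [j [c ->]] := blockpos_surj s.
by rewrite off_blockE negbK => /eqP->; rewrite {1}/blockpos tagnat.Rank1K.
Qed.

Section fixed_components.
Variables (a b : 'I_k).
Let S t := past (~` [set a]) t.
Let V t := past setT t.

Let S_sub_V t : S t `<=` V t. Proof. exact: past_sub. Qed.

Let S_off t s : off_block a s -> S t (cx t s).
Proof.
have [j [c ->]] := blockpos_surj s; rewrite off_blockE => /eqP ca.
exact: past_state.
Qed.

Let V_state t s : V t (cx t s).
Proof. by have [j [c ->]] := blockpos_surj s; exact: past_state. Qed.

Let comb t (c : 'I_q.+1 -> R) := of_real (\sum_j c j *: x t (blockpos j a)).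

Let comb_past t c : past [set a] t (comb t c).
Proof.
rewrite /comb of_real_sum; apply: closed_span_sum; first exact: gens_cL2.
move=> j _; rewrite of_realZ; apply: closed_span_cscale; first exact: gens_cL2.
exact: past_state.
Qed.

(** The process being real, the real part of an approximating complex
    combination approximates at least as well, which reduces the claim to real
    coefficients. *)
Let comb_independent t c U : S t U -> null_eq P (comb t c) U -> forall j, c j = 0.
Proof.
move=> SU n; have [sW sU _] := n.
apply: (state_independent (a := a) (t := t) HL HX pos) => e e0.
have /closed_spanP[|_ H] := SU; first exact: gens_cL2.
have [Z GZ ZU] := H _ e0; have sZ := lin_span_cL2 (@gens_cL2 _ _) GZ.
have := ZU; rewrite (si_sqr_distC sic)// -(null_eq_dist n sZ) => {}ZU.
case: GZ => m [g [z [zG ZE]]].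
have /choice[f fP] : forall i, exists p : R * 'I_k,
    [/\ p.1 <= t, p.2 != a & z i = cx p.1 (blockpos ord0 p.2)].
  move=> i; have [v [u [/eqP va ut zE]]] := zG i; exists (u, v); split => //=.
  by rewrite zE componentE.
exists [seq (complex.Re (g i), ((f i).1, blockpos ord0 (f i).2)) | i <- index_enum 'I_m].
  move=> p /mapP[i _ ->]; have [ft fa _] := fP i; split; first exact: ft.
  by exists (f i).2.
apply: le_lt_trans ZU.
set D := \sum_j _ - _; have -> : D = re_part (comb t c - Z).
  rewrite /D ZE /state_comb big_map; apply/funext => w.
  rewrite -cscaleN1 re_partD re_part_cscale /= oppr0 scale0r subr0 scaleN1r !fctE; congr (_ - _).
  rewrite /re_part raddf_sum fct_sumE; apply: eq_bigr => i _; have [_ _ ->] := fP i.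
  by rewrite /cx /of_real; case: (g i) => r r'; rewrite /= mulr0 subr0.
rewrite /rip lerDl; apply: (si_ge0 siP).
by have /cL2P[] := si_domB sic sW sZ.
Qed.

(** The noise and the states of the components other than a are orthogonal
    to D, which leaves the coefficients on the state of a. *)
Let rip_future t h r D : 0 <= h -> V t D -> (forall W, S t W -> rip P W D = 0) ->
  rip P (cx (t + h) r) D = rip P (comb t (fun j => E h r (blockpos j a))) D.
Proof.
move=> h0 VD SD; have sD := past_cL2 VD.
have -> : cx (t + h) r = of_real (noise A X t h r) +
   \sum_s cscale (E h r s)%:C%C (cx t s).
  under eq_bigr do rewrite -of_realZ.
  by rewrite -of_real_sum -of_realD /noise subrK.
have sn := noise_sqint HL HX t h r.
rewrite (si_Dl sic)//; last 2 first.
- exact/cL2_of_real.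
- by apply: (si_dom_sum sic) => s _; exact: cL2_cscale.
rewrite (noise_past (B := setT))// add0r (sum_block _ a) (si_Dl sic)//; last 2 first.
- by apply: (si_dom_sum sic) => s _; exact: cL2_cscale.
- by apply: (si_dom_sum sic) => s _; exact: cL2_cscale.
rewrite [X in _ + X](_ : _ = 0) ?addr0; last first.
  apply: SD; apply: closed_span_sum; first exact: gens_cL2.
  move=> s sa; apply: closed_span_cscale; first exact: gens_cL2.
  exact: S_off.
by congr rip; rewrite /comb of_real_sum; apply: eq_bigr => j _; rewrite of_realZ.
Qed.

(** If the coefficients vanish, the best prediction of Y_b(t + h) from the whole
    past does not use component a. Conversely, take for the variable in the past
    of a the very term W that these coefficients contribute to the prediction of
    Y_b(h): by [rip_future], conditional orthogonality says that W - P W has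
    norm zero, and [comb_independent] applies. *)
Lemma granger_mxexp : granger_noncausal P Y a b <->
  forall h j, 0 <= h <= 1 -> E h (blockpos ord0 b) (blockpos j a) = 0.
Proof.
split=> [gr h j /andP[h0 h1]|E0 t X0 Y0 LX LY].
  pose c j := E h (blockpos ord0 b) (blockpos j a).
  pose W := comb 0 c; pose D := W - prj (~` [set a]) 0 W.
  have aW : past [set a] 0 W := comb_past 0 c.
  have sW := past_cL2 aW.
  have [SW orth] := orthoproj_prop (@gens_cL2 (~` [set a]) `]-oo, 0]) sW.
  have sD : cL2 P D by apply: (si_domB sic) => //; exact: past_cL2 SW.
  have VD : V 0 D.
    apply: closed_spanB; first exact: gens_cL2.
      exact: past_sub aW.
    exact: S_sub_V.
  have bh : lin_past P Y [set b] `[0, 0 + 1] (component Y b h).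
    apply: closed_span_gen; first exact: gens_cL2.
    by exists b, h; split => //; rewrite /= in_itv/= h0 add0r h1.
  have sb := closed_span_cL2 bh.
  have [Sb _] := orthoproj_prop (@gens_cL2 (~` [set a]) `]-oo, 0]) sb.
  have sSb := past_cL2 Sb; have sSW := past_cL2 SW.
  have SD U : S 0 U -> rip P U D = 0.
    by move=> SU; rewrite (si_C sic) ?orth//; exact: past_cL2 SU.
  have sbD : cL2 P (component Y b h - prj (~` [set a]) 0 (component Y b h)).
    exact: (si_domB sic).
  have [bD _] := (cinner_eq0 sbD sD).1 (gr 0 _ _ bh aW).
  move: bD; rewrite (si_Bl sic)// (SD (prj _ _ _))// subr0 componentE -[h in cx h _]add0r.
  rewrite (rip_future _ h0 VD SD) -/(comb 0 c) -/W => WD.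
  apply: (comb_independent (t := 0) (c := c) SW); split => //.
  by rewrite (si_Bl sic)// -/D WD (SD (prj _ _ _))// subr0.
have [SX _] := orthoproj_prop (@gens_cL2 (~` [set a]) `]-oo, t]) (closed_span_cL2 LX).
have [SY orth] := orthoproj_prop (@gens_cL2 (~` [set a]) `]-oo, t]) (closed_span_cL2 LY).
set PX := orthoproj _ _ X0 in SX *; set D := (fun w => Y0 w - _).
have sX := closed_span_cL2 LX; have sY := closed_span_cL2 LY.
have sPX := past_cL2 SX; have sPY := past_cL2 SY.
have sD : cL2 P D by exact: (si_domB sic).
have VD : V t D.
  apply: closed_spanB; first exact: gens_cL2.
    exact: past_sub LY.
  exact: S_sub_V.
have SD U : S t U -> rip P U D = 0.
  by move=> SU; rewrite (si_C sic) ?orth//; exact: past_cL2 SU.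
have SiD U : S t U -> rip P U (imul D) = 0.
  move=> SU; have sU := past_cL2 SU; apply: oppr_inj; rewrite oppr0 -rip_imul// SD//.
  by apply: closed_span_cscale => //; exact: gens_cL2.
have future D' Z : V t D' -> (forall U, S t U -> rip P U D' = 0) ->
    gens [set b] `[t, t + 1] Z -> rip P Z D' = 0.
  move=> VD' SD' [v [u [/= -> tu ->]]]; move: tu; rewrite in_itv/= => /andP[tu ut].
  have h0 : 0 <= u - t by rewrite subr_ge0.
  rewrite componentE -[u in cx u _](subrKC t) rip_future//.
  rewrite (_ : comb _ _ = 0) ?(si_0l sic)//; first exact: past_cL2 VD'.
  by rewrite /comb big1// => j _; rewrite E0 ?scale0r// h0/= lerBlDl.
have ViD : V t (imul D) by apply: closed_span_cscale => //; exact: gens_cL2.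
have siD := past_cL2 ViD.
have D0 : forall Z, lin_past P Y [set b] `[t, t + 1] Z -> rip P D Z = 0.
  apply: (orth_closed_span (@gens_cL2 _ _) sD).
  move=> g Gg; have sg := gens_cL2 Gg; split.
    by apply: etrans (future _ _ VD SD Gg); exact: (si_C sic).
  apply: oppr_inj; rewrite oppr0 -rip_imul//.
  by apply: etrans (future _ _ ViD SiD Gg); exact: (si_C sic).
have LiX : lin_past P Y [set b] `[t, t + 1] (imul X0).
  by apply: closed_span_cscale => //; exact: gens_cL2.
apply/cinner_eq0 => //; first exact: (si_domB sic).
have XD U : cL2 P U -> rip P (fun w => X0 w - PX w) U = rip P X0 U - rip P PX U.
  by move=> sU; exact: (si_Bl sic).
rewrite !XD// (SD PX)// (SiD PX)// !subr0 (si_C sic)// D0//; split => //.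
by apply: oppr_inj; rewrite oppr0 -rip_imul// (si_C sic) ?D0//; exact: closed_span_cL2 LiX.
Qed.

(** Uniqueness of mean-square limits identifies the chosen versions of the
    derivatives with the blocks of the state. *)
Let msderivn_state n (j : 'I_q.+1) t : j = n :> nat ->
  null_eq P (msderivn P n (component Y b) t) (cx t (blockpos j b)).
Proof.
elim: n j t => [|n IH] j t jn.
  have -> : j = ord0 by exact/val_inj.
  by rewrite /msderivn /= componentE; exact: null_eq_refl.
have nq : (n < q.+1)%N by rewrite ltnW// -jn ltn_ord.
have {}IH s : null_eq P (msderivn P n (component Y b) s) (cx s (blockpos (Ordinal nq) b)).
  exact: IH.
have D0 := @state_deriv _ _ _ P k q A L X HL HX t (Ordinal nq) j b jn.
have lim : ms_cvg P 0^' (diff_quotient (msderivn P n (component Y b)) t) (cx t (blockpos j b)).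
  apply: (@ms_cvg_null _ _ _ _ _ _ _ _ (fun h => cscale h^-1%:C%C
      (cx (t + h) (blockpos (Ordinal nq) b) - cx t (blockpos (Ordinal nq) b)))).
    by apply: nearW => h; apply: null_eq_cscale; exact: null_eqB.
  apply/ms_cvgP; split => //.
    by apply: nearW => h; apply: cL2_cscale; exact: (si_domB sic).
  apply: cvg_eq_near D0; near=> h.
  by rewrite /= -rip_of_real of_realB of_realZ of_realB.
rewrite /msderivn iterS /msderiv; case: xgetP => [W -> lim'|/(_ _ lim)//].
exact: ms_cvg_unique lim' lim.
Unshelve. all: by end_near. Qed.

Let r : 'I_(dimX k q) := blockpos ord_max b.
Let Q t h := diff_quotient (msderivn P q (component Y b)) t h.
Let quot h s := h^-1 * (E h r s - (r == s)%:R).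
Let lim B t := \sum_s cscale (companion A r s)%:C%C (prj B t (cx t s)).

(** The projected difference quotient is a combination of the projected states
    with the entries of (e^{Ah} - 1) / h as coefficients: the noise is
    orthogonal to the past, however large it is compared with h. *)
Let projected_quotient B t h : 0 < h ->
  null_eq P (prj B t (Q t h)) (\sum_s cscale (quot h s)%:C%C (prj B t (cx t s))).
Proof.
move=> h0; have QE : null_eq P (Q t h) (cscale h^-1%:C%C (cx (t + h) r - cx t r)).
  by apply: null_eq_cscale; apply: null_eqB; exact: msderivn_state.
have [sQ sQ' _] := QE.
have pB s := orthoproj_prop (@gens_cL2 B `]-oo, t]) (cx_cL2 t s).
have past_sum : past B t (\sum_s cscale (quot h s)%:C%C (prj B t (cx t s))).
  apply: closed_span_sum; first exact: gens_cL2.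
  move=> s _; apply: closed_span_cscale; first exact: gens_cL2.
  by have [] := pB s.
have [pQ _] := orthoproj_prop (@gens_cL2 B `]-oo, t]) sQ.
split; [exact: past_cL2 pQ|exact: past_cL2 past_sum|].
apply: (orthoproj_unique (@gens_cL2 _ _) sQ past_sum) => W BW.
have sW := past_cL2 BW.
rewrite (null_eq_rip (null_eqB QE (null_eq_refl (past_cL2 past_sum))) sW).
have -> : cscale h^-1%:C%C (cx (t + h) r - cx t r) =
    cscale h^-1%:C%C (of_real (noise A X t h r)) + \sum_s cscale (quot h s)%:C%C (cx t s).
  rewrite -of_realB -!of_realZ; under eq_bigr do rewrite -of_realZ.
  rewrite -of_real_sum -of_realD; congr of_real.
  transitivity (h^-1 *: noise A X t h r + h^-1 *: (\sum_s E h r s *: x t s - x t r)).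
    by rewrite -scalerDr /noise subrKA.
  congr (_ + _).
  rewrite (_ : x t r = \sum_s (r == s)%:R *: x t s); last first.
    rewrite (bigD1 r)//= eqxx scale1r big1 ?addr0// => s sr.
    by rewrite eq_sym (negbTE sr) scale0r.
  by rewrite -sumrB scaler_sumr; apply: eq_bigr => s _; rewrite -scalerBl scalerA.
have sN : cL2 P (of_real (noise A X t h r)).
  by apply/cL2_of_real; exact: noise_sqint HL HX _ _ _.
rewrite -addrA -sumrB (si_Dl sic)//; last 2 first.
- exact: cL2_cscale.
- apply: (si_dom_sum sic) => s _; apply: (si_domB sic); apply: cL2_cscale => //.
  by have [/past_cL2] := pB s.
rewrite (si_Zl sic)// (noise_past r (ltW h0) BW) mulr0 add0r.
rewrite (si_suml sic)// => [|s _]; last first.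
  by apply: (si_domB sic); apply: cL2_cscale => //; have [/past_cL2] := pB s.
rewrite big1// => s _; have [Bs orth] := pB s; have sp := past_cL2 Bs.
rewrite (si_Bl sic) ?(si_Zl sic)//; try exact: cL2_cscale.
by rewrite -mulrBr -(si_Bl sic)// orth ?mulr0.
Qed.

Let local_limit B t : ms_cvg P 0^'+ (fun h => prj B t (Q t h)) (lim B t).
Proof.
have sp s : cL2 P (prj B t (cx t s)).
  by have [/past_cL2] := orthoproj_prop (@gens_cL2 B `]-oo, t]) (cx_cL2 t s).
apply: (@ms_cvg_null _ _ _ _ _ _ _ _ (fun h => \sum_s cscale (quot h s)%:C%C (prj B t (cx t s)))).
  by near=> h; apply: projected_quotient; near: h; exact: nbhs_right_gt.
have ssum (c : 'I_(dimX k q) -> R[i]) : cL2 P (\sum_s cscale (c s) (prj B t (cx t s))).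
  by apply: (si_dom_sum sic) => s _; exact: cL2_cscale.
apply/ms_cvgP; split; [by apply: nearW|exact: ssum|].
pose dq h s := quot h s - companion A r s.
have dlim s : dq h s @[h --> 0^'+] --> 0.
  have c : quot h s @[h --> 0^'+] --> companion A r s.
    have := @mxexp_quotient _ _ q A r s; apply: cvg_trans.
    exact: (cvg_app _ (@dnbhs_at_right _ 0)).
  have := cvgB c (cvg_cst (companion A r s)); rewrite subrr; exact.
pose ps s := prj B t (cx t s).
have limE h : \sum_s cscale (quot h s)%:C%C (ps s) - lim B t =
    \sum_s cscale (dq h s)%:C%C (ps s).
  rewrite -sumrB; apply: eq_bigr => s _; apply/funext => w.
  rewrite /cscale !fctE -mulrBl; congr (_ * _).
  by apply/esym; exact: (rmorphB (real_complex R)).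
apply: cvg_eq_near (si_comb_cvg0 sic (index_enum _) sp dlim); near=> h.
by rewrite limE.
Unshelve. all: by end_near. Qed.

(** The limit from the whole past is the combination of the state coordinates
    with the last block row of the companion matrix as coefficients. If the
    limit from the past without a agrees with it, the part contributed by a lies
    in that past, and [comb_independent] applies. *)
Lemma local_granger_companion : local_granger_noncausal P Y q.+1 a b <->
  forall j, companion A r (blockpos j a) = 0.
Proof.
pose M s := companion A r s.
have limV t : null_eq P (lim setT t) (\sum_s cscale (M s)%:C%C (cx t s)).
  apply: null_eq_sum => s _; apply: null_eq_cscale; apply: null_eq_sym.
  have [sp _] := orthoproj_prop (@gens_cL2 setT `]-oo, t]) (cx_cL2 t s).
  split => //; first exact: past_cL2 sp.
  by apply: (orthoproj_id (@gens_cL2 _ _)); exact: V_state.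
have offS t : null_eq P (\sum_(s | off_block a s) cscale (M s)%:C%C (prj (~` [set a]) t (cx t s)))
    (\sum_(s | off_block a s) cscale (M s)%:C%C (cx t s)).
  apply: null_eq_sum => s sa; apply: null_eq_cscale; apply: null_eq_sym.
  have [sp _] := orthoproj_prop (@gens_cL2 (~` [set a]) `]-oo, t]) (cx_cL2 t s).
  split => //; first exact: past_cL2 sp.
  by apply: (orthoproj_id (@gens_cL2 _ _)); exact: S_off.
split=> [loc|M0 t].
  have [Z1 [Z2 [c1 c2 Z12]]] := loc 0.
  have n1 : null_eq P Z1 (lim setT 0) by exact: ms_cvg_unique c1 (local_limit setT 0).
  have n2 : null_eq P Z2 (lim (~` [set a]) 0).
    exact: ms_cvg_unique c2 (local_limit (~` [set a]) 0).
  have n12 : null_eq P Z1 Z2 by apply/null_eqP => //; [case: n1|case: n2].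
  have n := null_eq_trans (null_eq_sym n1) (null_eq_trans n12 n2).
  have {}n := null_eq_trans (null_eq_sym (limV 0)) n.
  pose off := \sum_(s | off_block a s) cscale (M s)%:C%C (cx 0 s).
  have Soff : S 0 off.
    apply: closed_span_sum; first exact: gens_cL2.
    move=> s sa; apply: closed_span_cscale; first exact: gens_cL2.
    exact: S_off.
  apply: (comb_independent (t := 0) (c := fun j => M (blockpos j a)) (U := lim (~` [set a]) 0 - off)).
    apply: closed_spanB => //; first exact: gens_cL2.
    apply: closed_span_sum; first exact: gens_cL2.
    move=> s _; apply: closed_span_cscale; first exact: gens_cL2.
    by have [] := orthoproj_prop (@gens_cL2 (~` [set a]) `]-oo, 0]) (cx_cL2 0 s).
  have := null_eqB n (null_eq_refl (past_cL2 Soff)).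
  rewrite (sum_block _ a) -/off addrK /comb of_real_sum.
  by under eq_bigr do rewrite -of_realZ.
exists (lim setT t), (lim (~` [set a]) t); split.
- exact: local_limit.
- exact: local_limit.
have n : null_eq P (lim setT t) (lim (~` [set a]) t).
  apply: null_eq_trans (limV t) _; apply: null_eq_sym.
  have z j : cscale (M (blockpos j a))%:C%C = fun=> 0.
    by apply/funext => Z; apply/funext => w; rewrite /cscale /M M0 mul0r.
  rewrite /lim (sum_block _ a) [X in null_eq _ _ X](sum_block _ a).
  rewrite big1; last by move=> j _; rewrite z.
  rewrite [X in null_eq _ _ (X + _)]big1; last by move=> j _; rewrite z.
  by rewrite !add0r.
by have [s1 s2 _] := n; apply/null_eqP.
Qed.

End fixed_components.

End granger.

(** * The equivalences *)

Theorem proposition6p12 (R : realType) (d : measure_display)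
    (T : measurableType d) (P : probability T R) (k q : nat)
    (A : 'I_q.+1 -> 'M[R]_k) (L Y : R -> T -> 'cV[R]_k)
    (Ymcar : causal_mcar P A L Y) (SigmaL : posdefmx (levy_cov P L))
    (a b : 'I_k) (ab : a != b) :
  [/\ forall (h : R) (j : 'I_q.+1), 0 <= h <= 1 ->
        (Cblock k q *m mxexp (h *: companion A) *m Eblock k j) b a =
        mxexp (h *: companion A) (blockpos ord0 b) (blockpos j a),
      granger_noncausal P Y a b <->
        (forall (h : R) (j : 'I_q.+1), 0 <= h <= 1 ->
          (Cblock k q *m mxexp (h *: companion A) *m Eblock k j) b a = 0),
      local_granger_noncausal P Y q.+1 a b <->
        (forall j : 'I_q.+1,
          ((Eblock k ord_max)^T *m companion A *m Eblock k j) b a = 0) &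
      local_granger_noncausal P Y q.+1 a b <->
        (forall j : 'I_q.+1, A j b a = 0)].
Proof.
have [HL _ [X HX0]] := Ymcar.
have HX t := (HX0 t).1; have YE t w : Y t w = Cblock k q *m X t w := (HX0 t).2 w.
have CE h j : (Cblock k q *m mxexp (h *: companion A) *m Eblock k j) b a =
    mxexp (h *: companion A) (blockpos ord0 b) (blockpos j a).
  by rewrite mul_mx_Eblock mul_Cblock_mx.
have EE j : ((Eblock k ord_max)^T *m companion A *m Eblock k j) b a =
    companion A (blockpos ord_max b) (blockpos j a).
  by rewrite mul_mx_Eblock mul_trEblock_mx.
have gr := granger_mxexp HL HX SigmaL YE a b.
have loc := local_granger_companion HL HX SigmaL YE a b.
split=> [h j _|||]; first exact: CE.
- by apply: iff_trans gr _; split=> E0 h j hI; have := E0 h j hI; rewrite CE.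
- by apply: iff_trans loc _; split=> E0 j; have := E0 j; rewrite EE.
apply: iff_trans loc _.
have AE j : companion A (blockpos ord_max b) (blockpos j a) = - A (rev_ord j) b a.
  by rewrite companionE eqxx mxE.
split=> E0 j; last by rewrite AE E0 oppr0.
by have /eqP := E0 (rev_ord j); rewrite AE rev_ordK oppr_eq0 => /eqP.
Qed.
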